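(* Let $\mathcal{C}$ be a near-integral fusion category equipped with a braiding which is not symmetric, with distinguished fusion subcategory $\mathcal{D}$ and distinguished simple object $\rho$, and suppose $\mathrm{FPdim}(\mathcal{C})\in\mathbb{Z}$. Let $N:=\mathrm{FPdim}(\mathcal{D})$, $\kappa:=\dim_{\mathbb{C}}\mathrm{Hom}_{\mathcal{C}}(\rho,\rho\otimes\rho)$ and $d_+:=\mathrm{FPdim}(\rho)$. If $C_\mathcal{D}(\mathcal{D})$ is Tannakian, then $C_\mathcal{C}(\mathcal{C})=\mathcal{D}$, and either (1) $\theta_\rho=\pm\zeta_4$, $\kappa=0$, and $\dim(\mathcal{C})=2N$; (2) $\theta_\rho=\zeta_3^{\pm1}$, $N=2\kappa^2$, and $\dim(\mathcal{C})=3N=6\kappa^2$; or (3) $\theta_\rho=-1$, $N=\frac{3}{4}\kappa^2$, and $\dim(\mathcal{C})=4N=3\kappa^2$. In all cases, $d_+\in\mathbb{Z}$.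
   Context: Fusion categories are over $\mathbb{C}$; rank is the number of isomorphism classes of simple objects; $\mathrm{FPdim}$ is Frobenius-Perron dimension. A fusion category $\mathcal{C}$ is near-integral if it has a fusion subcategory $\mathcal{D}\subset\mathcal{C}$ with $\mathrm{rank}(\mathcal{D})+1=\mathrm{rank}(\mathcal{C})$; $\rho$ is the unique (up to isomorphism) simple object of $\mathcal{C}$ not in $\mathcal{D}$. For a braided fusion category $\mathcal{C}$ with braiding $\sigma$ and a fusion subcategory $\mathcal{E}$, the centralizer $C_\mathcal{C}(\mathcal{E})$ is the fusion subcategory of objects $X$ with $\sigma_{Y,X}\sigma_{X,Y}=\mathrm{id}_{X\otimes Y}$ for all $Y\in\mathcal{E}$; $C_\mathcal{C}(\mathcal{C})$ is the symmetric center, and $\mathcal{C}$ is symmetrically braided if $C_\mathcal{C}(\mathcal{C})=\mathcal{C}$. A symmetrically braided fusion category is Tannakian if it is braided equivalent to $\mathrm{Rep}(G)$ with its standard braiding for a finite group $G$. Since $\mathrm{FPdim}(\mathcal{C})\in\mathbb{Z}$, $\mathcal{C}$ is pseudounitary and is equipped with its canonical spherical structure, for which $\dim(X)=\mathrm{FPdim}(X)$ for all objects $X$; $\theta_\rho\in\mathbb{C}^\times$ is the corresponding twist of $\rho$. $\zeta_n=\exp(2\pi i/n)$. *)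

(* Defs.v *)
From mathcomp Require Import all_boot all_order all_algebra all_fingroup.
From mathcomp Require Import mxrepresentation complex mxtens.
From mathcomp Require Import classical_sets reals trigo.

Set Implicit Arguments.
Unset Strict Implicit.
Unset Printing Implicit Defensive.

Import Order.TTheory GRing.Theory Num.Theory.
Local Open Scope ring_scope.

Declare Scope cat_scope.
Delimit Scope cat_scope with cat.
Local Open Scope cat_scope.

(* K-linear categories with finite-dimensional Hom spaces. *)
Structure lincat (K : fieldType) := Lincat {
  ob :> Type;
  mor : ob -> ob -> vectType K;
  idm : forall X, mor X X;
  comp : forall X Y Z, mor Y Z -> mor X Y -> mor X Z;
  comp_idl : forall X Y (f : mor X Y), comp (idm Y) f = f;
  comp_idr : forall X Y (f : mor X Y), comp f (idm X) = f;
  comp_assoc : forall W X Y Z (h : mor Y Z) (g : mor X Y) (f : mor W X),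
    comp h (comp g f) = comp (comp h g) f;
  comp_linr : forall X Y Z (g : mor Y Z),
    linear (comp g : mor X Y -> mor X Z);
  comp_linl : forall X Y Z (f : mor X Y),
    linear (fun g : mor Y Z => comp g f)
}.
Arguments mor {K C} X Y : rename.
Arguments idm {K C} X : rename.
Arguments comp {K C X Y Z} g f : rename.
Arguments comp_linr {K C X Y Z} g a : rename.
Arguments comp_linl {K C X Y Z} f a : rename.
Notation "g \o f" := (comp g f) : cat_scope.

Section LinearCategory.
Variables (K : fieldType) (C : lincat K).
Implicit Types X Y Z S : C.

Definition inverse X Y (f : mor X Y) (g : mor Y X) : Prop :=
  g \o f = idm X /\ f \o g = idm Y.

Definition iso X Y (f : mor X Y) : Prop := exists g, inverse f g.

Definition isomorphic X Y : Prop := exists f : mor X Y, iso f.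

Definition monic X Y (f : mor X Y) : Prop :=
  forall Z (g h : mor Z X), f \o g = f \o h -> g = h.

Definition epic X Y (f : mor X Y) : Prop :=
  forall Z (g h : mor Y Z), g \o f = h \o f -> g = h.

Definition zero_object X : Prop :=
  forall Y, (forall f : mor X Y, f = 0) /\ (forall f : mor Y X, f = 0).

Definition simple X : Prop :=
  ~ zero_object X /\
  forall Y (f : mor Y X), monic f -> zero_object Y \/ iso f.

Definition is_kernel X Y Z (f : mor X Y) (k : mor Z X) : Prop :=
  f \o k = 0 /\
  forall W (g : mor W X), f \o g = 0 -> exists! h : mor W Z, k \o h = g.

Definition is_cokernel X Y Z (f : mor X Y) (q : mor Y Z) : Prop :=
  q \o f = 0 /\
  forall W (g : mor Y W), g \o f = 0 -> exists! h : mor Z W, h \o q = g.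

(* S is a direct sum (biproduct) of X_0, ..., X_{n-1}; for n = 0 this says
   that S is a zero object. *)
Definition direct_sum n (X : 'I_n -> C) S : Prop :=
  exists (i : forall k, mor (X k) S) (p : forall k, mor S (X k)),
  [/\ forall k, p k \o i k = idm (X k),
      forall j k, j != k -> p j \o i k = 0 &
      \sum_k (i k \o p k) = idm S].

Record abelian_category : Prop := {
  abelian_sum : forall n (X : 'I_n -> C), exists S, direct_sum X S;
  abelian_ker : forall X Y (f : mor X Y),
    exists Z (k : mor Z X), is_kernel f k;
  abelian_coker : forall X Y (f : mor X Y),
    exists Z (q : mor Y Z), is_cokernel f q;
  abelian_monic : forall X Y (f : mor X Y), monic f ->
    exists Z (g : mor Y Z), is_kernel g f;
  abelian_epic : forall X Y (f : mor X Y), epic f ->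
    exists Z (g : mor Z X), is_cokernel g f
}.

Definition semisimple_category : Prop :=
  forall X, exists n (Y : 'I_n -> C),
    (forall k, simple (Y k)) /\ direct_sum Y X.

Definition simple_representatives n (O : 'I_n -> C) : Prop :=
  [/\ forall i, simple (O i),
      forall i j, isomorphic (O i) (O j) -> i = j &
      forall X, simple X -> exists i, isomorphic X (O i)].

(* For simple X over an algebraically closed field, f = endo_scalar f *: idm X
   by Schur's lemma. *)
Definition endo_scalar X (f : mor X X) : K := coord [tuple idm X] ord0 f.

End LinearCategory.

(* Monoidal categories with bilinear tensor product on morphisms; [associ],
   [luniti], [runiti] are the inverses of the structure isomorphisms. *)
Structure moncat (K : fieldType) := Moncat {
  moncat_lincat :> lincat K;
  tens : moncat_lincat -> moncat_lincat -> moncat_lincat;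
  tensm : forall X X' Y Y' : moncat_lincat,
    mor X X' -> mor Y Y' -> mor (tens X Y) (tens X' Y');
  one : moncat_lincat;
  assoc : forall X Y Z, mor (tens (tens X Y) Z) (tens X (tens Y Z));
  associ : forall X Y Z, mor (tens X (tens Y Z)) (tens (tens X Y) Z);
  lunit : forall X, mor (tens one X) X;
  luniti : forall X, mor X (tens one X);
  runit : forall X, mor (tens X one) X;
  runiti : forall X, mor X (tens X one);
  tensm_id : forall X Y, tensm (idm X) (idm Y) = idm (tens X Y);
  tensm_comp : forall X X' X'' Y Y' Y'' (f' : mor X' X'') (f : mor X X')
      (g' : mor Y' Y'') (g : mor Y Y'),
    tensm (f' \o f) (g' \o g) = tensm f' g' \o tensm f g;
  tensm_linr : forall X X' Y Y' (f : mor X X'),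
    linear (tensm f : mor Y Y' -> mor (tens X Y) (tens X' Y'));
  tensm_linl : forall X X' Y Y' (g : mor Y Y'),
    linear (fun f : mor X X' => tensm f g);
  assocK : forall X Y Z, inverse (assoc X Y Z) (associ X Y Z);
  lunitK : forall X, inverse (lunit X) (luniti X);
  runitK : forall X, inverse (runit X) (runiti X);
  assoc_nat : forall X X' Y Y' Z Z'
      (f : mor X X') (g : mor Y Y') (h : mor Z Z'),
    assoc X' Y' Z' \o tensm (tensm f g) h
    = tensm f (tensm g h) \o assoc X Y Z;
  lunit_nat : forall X X' (f : mor X X'),
    lunit X' \o tensm (idm one) f = f \o lunit X;
  runit_nat : forall X X' (f : mor X X'),
    runit X' \o tensm f (idm one) = f \o runit X;
  pentagon : forall W X Y Z,
    tensm (idm W) (assoc X Y Z) \o assoc W (tens X Y) Z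
      \o tensm (assoc W X Y) (idm Z)
    = assoc W X (tens Y Z) \o assoc (tens W X) Y Z;
  triangle : forall X Y,
    tensm (idm X) (lunit Y) \o assoc X one Y = tensm (runit X) (idm Y)
}.
Arguments tens {K C} X Y : rename.
Arguments tensm {K C X X' Y Y'} f g : rename.
Arguments one {K C} : rename.
Arguments assoc {K C} X Y Z : rename.
Arguments associ {K C} X Y Z : rename.
Arguments lunit {K C} X : rename.
Arguments luniti {K C} X : rename.
Arguments runit {K C} X : rename.
Arguments runiti {K C} X : rename.
Notation "X ⊗ Y" := (tens X Y)
  (at level 40, left associativity, format "X  ⊗  Y") : cat_scope.
Notation "f ⊠ g" := (tensm f g)
  (at level 40, left associativity, format "f  ⊠  g") : cat_scope.

Structure brcat (K : fieldType) := Brcat {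
  brcat_moncat :> moncat K;
  braid : forall X Y : brcat_moncat, mor (X ⊗ Y) (Y ⊗ X);
  braid_iso : forall X Y, iso (braid X Y);
  braid_nat : forall X X' Y Y' (f : mor X X') (g : mor Y Y'),
    braid X' Y' \o (f ⊠ g) = (g ⊠ f) \o braid X Y;
  hexagon : forall X Y Z,
    assoc Y Z X \o braid X (Y ⊗ Z) \o assoc X Y Z
    = (idm Y ⊠ braid X Z) \o assoc Y X Z \o (braid X Y ⊠ idm Z);
  hexagoni : forall X Y Z,
    associ Z X Y \o braid (X ⊗ Y) Z \o associ X Y Z
    = (braid X Z ⊠ idm Y) \o associ X Z Y \o (idm X ⊠ braid Y Z)
}.
Arguments braid {K C} X Y : rename.

Section Rigidity.
Variables (K : fieldType) (C : moncat K).
Implicit Types X Y Z A : C.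

Definition is_left_dual X Y (ev : mor (Y ⊗ X) one) (coev : mor one (X ⊗ Y)) :
    Prop :=
  runit X \o (idm X ⊠ ev) \o assoc X Y X \o (coev ⊠ idm X) \o luniti X = idm X
  /\ lunit Y \o (ev ⊠ idm Y) \o associ Y X Y \o (idm Y ⊠ coev) \o runiti Y
     = idm Y.

(* Every object has a left dual and a right dual; Y is a right dual of X when
   X is a left dual of Y. *)
Definition rigid : Prop := forall X,
  (exists Y (ev : mor (Y ⊗ X) one) (coev : mor one (X ⊗ Y)),
     is_left_dual ev coev) /\
  (exists Y (ev : mor (X ⊗ Y) one) (coev : mor one (Y ⊗ X)),
     is_left_dual ev coev).

End Rigidity.

Structure fusion (K : fieldType) (C : moncat K) := Fusion {
  rank : nat;
  irr : 'I_rank -> C;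
  irrP : simple_representatives irr;
  fusion_abelian : abelian_category C;
  fusion_semisimple : semisimple_category C;
  fusion_rigid : rigid C;
  fusion_one : \dim {: mor (one : C) one} = 1%N
}.
Arguments irr {K C} f i : rename.

Section FrobeniusPerron.
Variables (R : realType) (K : fieldType) (C : moncat K) (F : fusion C).

(* Multiplication by the class of X on the Grothendieck ring. *)
Definition fusion_mx (X : C) : 'M[R]_(rank F) :=
  \matrix_(i, j) (\dim {: mor (irr F j) (X ⊗ irr F i)})%:R.

(* The largest nonnegative real eigenvalue. *)
Definition FPdim (X : C) : R :=
  sup [set x : R | 0 <= x /\ eigenvalue (fusion_mx X) x]%classic.

Definition FPdim_cat : R := \sum_i FPdim (irr F i) ^+ 2.

End FrobeniusPerron.
Arguments FPdim R {K C} F X.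
Arguments FPdim_cat R {K C} F.

Section Subcategory.
Variable K : fieldType.

Record tens_closed (C : moncat K) (D : C -> Prop) : Prop := {
  closed_one : D one;
  closed_tens : forall X Y, D X -> D Y -> D (X ⊗ Y)
}.

Record fusion_subcategory (C : moncat K) (D : C -> Prop) : Prop := {
  subcategory_closed :> tens_closed D;
  subcategory_sum : forall n (X : 'I_n -> C) S,
    direct_sum X S -> (forall k, D (X k)) -> D S;
  subcategory_summand : forall n (X : 'I_n -> C) S,
    direct_sum X S -> D S -> forall k, D (X k)
}.

(* The full subcategory on the objects satisfying D. *)
Definition sub_lincat (C : lincat K) (D : C -> Prop) : lincat K :=
  @Lincat K {X : C | D X} (fun X Y => mor (sval X) (sval Y))
    (fun X => idm (sval X)) (fun X Y Z g f => g \o f)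
    (fun _ _ => @comp_idl K C _ _) (fun _ _ => @comp_idr K C _ _)
    (fun _ _ _ _ => @comp_assoc K C _ _ _ _)
    (fun _ _ _ => @comp_linr K C _ _ _) (fun _ _ _ => @comp_linl K C _ _ _).

Section Closed.
Variables (C : moncat K) (D : C -> Prop) (hD : tens_closed D).

Definition sub_moncat : moncat K :=
  @Moncat K (sub_lincat D)
    (fun X Y => exist D _ (closed_tens hD (svalP X) (svalP Y)))
    (fun _ _ _ _ f g => f ⊠ g)
    (exist D _ (closed_one hD))
    (fun X Y Z => assoc (sval X) (sval Y) (sval Z))
    (fun X Y Z => associ (sval X) (sval Y) (sval Z))
    (fun X => lunit (sval X)) (fun X => luniti (sval X))
    (fun X => runit (sval X)) (fun X => runiti (sval X))
    (fun _ _ => @tensm_id K C _ _)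
    (fun _ _ _ _ _ _ => @tensm_comp K C _ _ _ _ _ _)
    (fun _ _ _ _ => @tensm_linr K C _ _ _ _)
    (fun _ _ _ _ => @tensm_linl K C _ _ _ _)
    (fun _ _ _ => @assocK K C _ _ _)
    (fun _ => @lunitK K C _) (fun _ => @runitK K C _)
    (fun _ _ _ _ _ _ => @assoc_nat K C _ _ _ _ _ _)
    (fun _ _ => @lunit_nat K C _ _) (fun _ _ => @runit_nat K C _ _)
    (fun _ _ _ _ => @pentagon K C _ _ _ _) (fun _ _ => @triangle K C _ _).

End Closed.

Definition sub_brcat (C : brcat K) (D : C -> Prop) (hD : tens_closed D) :
    brcat K :=
  @Brcat K (sub_moncat hD) (fun X Y => braid (sval X) (sval Y))
    (fun _ _ => @braid_iso K C _ _) (fun _ _ _ _ => @braid_nat K C _ _ _ _)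
    (fun _ _ _ => @hexagon K C _ _ _) (fun _ _ _ => @hexagoni K C _ _ _).

End Subcategory.

Section Cancellation.
Variables (K : fieldType) (C : lincat K).
Implicit Types X Y Z : C.

Lemma iso_cancel_left X Y Z (f : mor Y Z) (g h : mor X Y) :
  iso f -> f \o g = f \o h -> g = h.
Proof.
move=> [k [kf _]] /(congr1 (comp k)).
by rewrite !comp_assoc kf !comp_idl.
Qed.

Lemma iso_cancel_right X Y Z (f : mor X Y) (g h : mor Y Z) :
  iso f -> g \o f = h \o f -> g = h.
Proof.
move=> [k [_ fk]] /(congr1 (fun u => u \o k)).
by rewrite -!comp_assoc fk !comp_idr.
Qed.

Lemma inverse_sym X Y (f : mor X Y) (g : mor Y X) : inverse f g -> inverse g f.
Proof. by case. Qed.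

Lemma iso_id X : iso (idm X).
Proof. by exists (idm X); split; rewrite comp_idl. Qed.

End Cancellation.

Section UnitCoherence.
Variables (K : fieldType) (C : moncat K).
Implicit Types X Y Z : C.

Lemma assoc_iso X Y Z : iso (assoc X Y Z).
Proof. by exists (associ X Y Z); apply: assocK. Qed.

Lemma associ_iso X Y Z : iso (associ X Y Z).
Proof. by exists (assoc X Y Z); apply/inverse_sym/assocK. Qed.

Lemma lunit_iso X : iso (lunit X).
Proof. by exists (luniti X); apply: lunitK. Qed.

Lemma runit_iso X : iso (runit X).
Proof. by exists (runiti X); apply: runitK. Qed.

Lemma tensm_compl X X' X'' Y (f' : mor X' X'') (f : mor X X') :
  (f' \o f) ⊠ idm Y = (f' ⊠ idm Y) \o (f ⊠ idm Y).
Proof. by rewrite -tensm_comp comp_idl. Qed.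

Lemma tensm_compr X Y Y' Y'' (g' : mor Y' Y'') (g : mor Y Y') :
  idm X ⊠ (g' \o g) = (idm X ⊠ g') \o (idm X ⊠ g).
Proof. by rewrite -tensm_comp comp_idl. Qed.

Lemma tensm_iso X X' Y Y' (f : mor X X') (g : mor Y Y') :
  iso f -> iso g -> iso (f ⊠ g).
Proof.
move=> [f' [f'f ff']] [g' [g'g gg']]; exists (f' ⊠ g').
by split; rewrite -tensm_comp ?f'f ?g'g ?ff' ?gg' tensm_id.
Qed.

Lemma tensm_one_injl X Y (f g : mor X Y) :
  idm (one : C) ⊠ f = idm one ⊠ g -> f = g.
Proof.
move=> fg; apply: (iso_cancel_right (lunit_iso X)).
by rewrite -!lunit_nat fg.
Qed.

Lemma tensm_one_injr X Y (f g : mor X Y) :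
  f ⊠ idm (one : C) = g ⊠ idm one -> f = g.
Proof.
move=> fg; apply: (iso_cancel_right (runit_iso X)).
by rewrite -!runit_nat fg.
Qed.

Lemma lunit_tens X Y : lunit (X ⊗ Y) \o assoc one X Y = lunit X ⊠ idm Y.
Proof.
apply: tensm_one_injl.
apply: (iso_cancel_right (assoc_iso one (one ⊗ X) Y)).
apply: (iso_cancel_right (tensm_iso (assoc_iso one one X) (iso_id Y))).
rewrite tensm_compr -!comp_assoc (comp_assoc (idm one ⊠ assoc one X Y)).
rewrite pentagon.
rewrite comp_assoc triangle.
rewrite comp_assoc -assoc_nat -comp_assoc -tensm_compl triangle.
by rewrite -tensm_id -assoc_nat.
Qed.

Lemma runit_tens X Y : (idm X ⊠ runit Y) \o assoc X Y one = runit (X ⊗ Y).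
Proof.
apply: tensm_one_injr.
apply: (iso_cancel_left (assoc_iso X Y one)).
rewrite tensm_compl comp_assoc assoc_nat.
rewrite -triangle -[in LHS]comp_assoc tensm_compr.
rewrite -!comp_assoc (comp_assoc (idm X ⊠ assoc Y one one)) pentagon.
by rewrite comp_assoc -assoc_nat -comp_assoc tensm_id triangle.
Qed.

End UnitCoherence.

Section Centralizer.
Variables (K : fieldType) (C : brcat K).
Implicit Types X Y Z : C.

Lemma braid_one_right X : lunit X \o braid X one = runit X.
Proof.
apply: tensm_one_injr; apply: (iso_cancel_left (braid_iso X one)).
have /(congr1 (comp (lunit (one ⊗ X)))) := hexagon X one one.
rewrite !comp_assoc lunit_tens lunit_nat -(comp_assoc (braid X one)) lunit_tens.
rewrite -braid_nat -comp_assoc triangle => ->.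
by rewrite tensm_compl comp_assoc.
Qed.

Lemma braid_one_left X : runit X \o braid one X = lunit X.
Proof.
apply: tensm_one_injl; apply: (iso_cancel_left (braid_iso one X)).
have runit_associ Y Z :
    runit (Y ⊗ Z) \o associ Y Z one = idm Y ⊠ runit Z.
  have [_ k] := assocK Y Z one.
  by rewrite -runit_tens -comp_assoc k comp_idr.
have tri : (runit one ⊠ idm X) \o associ one one X = idm one ⊠ lunit X.
  have [_ k] := assocK one one X.
  by rewrite -triangle -comp_assoc k comp_idr.
have /(congr1 (comp (runit (X ⊗ one)))) := hexagoni one one X.
rewrite !comp_assoc runit_associ runit_nat -braid_nat -comp_assoc tri => ->.
rewrite -(comp_assoc (braid one X) (runit _)) runit_associ.
by rewrite tensm_compr comp_assoc.
Qed.

(* The centralizer of the full subcategory on the objects satisfying E. *)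
Definition centralizer (E : C -> Prop) (X : C) : Prop :=
  forall Y, E Y -> braid Y X \o braid X Y = idm (X ⊗ Y).

Lemma centralizer_closed (E : C -> Prop) : tens_closed (centralizer E).
Proof.
split=> [Y _ | X X' cX cX' Y EY].
  apply: (iso_cancel_left (lunit_iso Y)).
  by rewrite comp_assoc braid_one_right braid_one_left comp_idr.
have [aK1 aK1'] := assocK Y X X'; have [aK2 aK2'] := assocK X X' Y.
have [aK3 aK3'] := assocK X Y X'.
apply: (iso_cancel_left (assoc_iso X X' Y)).
apply: (iso_cancel_right (associ_iso X X' Y)).
apply: (iso_cancel_right (assoc_iso X X' Y)).
have := hexagon Y X X'; have := hexagoni X X' Y => h1 h2.
rewrite comp_idr aK2' comp_idl.
rewrite -comp_assoc aK2 comp_idr.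
have -> : braid (X ⊗ X') Y = assoc Y X X' \o ((braid X Y ⊠ idm X')
   \o associ X Y X' \o (idm X ⊠ braid X' Y)) \o assoc X X' Y.
  by rewrite -h1 !comp_assoc aK1' comp_idl -comp_assoc aK2 comp_idr.
rewrite !comp_assoc h2 -(comp_assoc (_ \o assoc X Y X')) -tensm_comp cX //.
rewrite comp_idl tensm_id comp_idr -(comp_assoc (idm X ⊠ _)) aK3' comp_idr.
by rewrite -tensm_comp cX' // comp_idl tensm_id comp_idl.
Qed.

Definition symmetric_center : C -> Prop := centralizer (fun=> True).

Lemma symmetric_center_closed : tens_closed symmetric_center.
Proof. exact: centralizer_closed. Qed.

Definition symmetrically_braided : Prop := forall X, symmetric_center X.

End Centralizer.

Section Equivalence.
Variables (K : fieldType) (C D : brcat K).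

(* Linear braided (strong) monoidal functors. *)
Structure braided_functor := BraidedFunctor {
  fob :> C -> D;
  fmap : forall X Y : C, mor X Y -> mor (fob X) (fob Y);
  fmap_id : forall X, fmap (idm X) = idm (fob X);
  fmap_comp : forall X Y Z (g : mor Y Z) (f : mor X Y),
    fmap (g \o f) = fmap g \o fmap f;
  fmap_linear : forall X Y : C,
    linear (@fmap X Y : mor X Y -> mor (fob X) (fob Y));
  ftens : forall X Y : C, mor (fob X ⊗ fob Y) (fob (X ⊗ Y));
  fone : mor (one : D) (fob one);
  ftens_iso : forall X Y, iso (ftens X Y);
  fone_iso : iso fone;
  ftens_nat : forall X X' Y Y' (f : mor X X') (g : mor Y Y'),
    ftens X' Y' \o (fmap f ⊠ fmap g) = fmap (f ⊠ g) \o ftens X Y;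
  ftens_assoc : forall X Y Z,
    fmap (assoc X Y Z) \o ftens (X ⊗ Y) Z \o (ftens X Y ⊠ idm (fob Z))
    = ftens X (Y ⊗ Z) \o (idm (fob X) ⊠ ftens Y Z)
      \o assoc (fob X) (fob Y) (fob Z);
  ftens_lunit : forall X,
    fmap (lunit X) \o ftens one X \o (fone ⊠ idm (fob X)) = lunit (fob X);
  ftens_runit : forall X,
    fmap (runit X) \o ftens X one \o (idm (fob X) ⊠ fone) = runit (fob X);
  ftens_braid : forall X Y,
    fmap (braid X Y) \o ftens X Y = ftens Y X \o braid (fob X) (fob Y)
}.

Definition is_equivalence (F : braided_functor) : Prop :=
  (forall X Y, bijective (@fmap F X Y)) /\
  (forall Y : D, exists X : C, isomorphic (F X) Y).

Definition braided_equivalent : Prop :=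
  exists F : braided_functor, is_equivalence F.

End Equivalence.

Section FunctionMatrix.
Variable K : fieldType.

(* The matrix of the linear map e_i |-> e_(s i), on row vectors. *)
Definition fun_mx m n (s : 'I_m -> 'I_n) : 'M[K]_(m, n) :=
  \matrix_(i, j) (s i == j)%:R.

Lemma mul_fun_mx m n p (s : 'I_m -> 'I_n) (A : 'M[K]_(n, p)) :
  fun_mx s *m A = \matrix_(i, j) A (s i) j.
Proof.
apply/matrixP=> i j; rewrite !mxE (bigD1 (s i)) //= big1 ?addr0.
  by rewrite mxE eqxx mul1r.
by move=> k; rewrite mxE eq_sym => /negPf->; rewrite mul0r.
Qed.

Lemma mulmx_fun m n p (s : 'I_m -> 'I_n) (t : 'I_n -> 'I_m)
    (A : 'M[K]_(p, m)) : cancel s t -> cancel t s ->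
  A *m fun_mx s = \matrix_(i, j) A i (t j).
Proof.
move=> sK tK; apply/matrixP=> i j; rewrite !mxE (bigD1 (t j)) //= big1 ?addr0.
  by rewrite mxE tK eqxx mulr1.
move=> k; rewrite mxE => kt; case: eqP => [e|]; last by rewrite mulr0.
by rewrite -e sK eqxx in kt.
Qed.

Lemma fun_mx_id n : fun_mx id = 1%:M :> 'M_n.
Proof. by apply/matrixP=> i j; rewrite !mxE. Qed.

Lemma fun_mx_comp m n p (s : 'I_m -> 'I_n) (t : 'I_n -> 'I_p) :
  fun_mx s *m fun_mx t = fun_mx (fun i => t (s i)).
Proof. by rewrite mul_fun_mx; apply/matrixP=> i j; rewrite !mxE. Qed.

Lemma eq_fun_mx m n (s t : 'I_m -> 'I_n) : s =1 t -> fun_mx s = fun_mx t.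
Proof. by move=> st; apply/matrixP=> i j; rewrite !mxE st. Qed.

Definition tens_fun m n p q (s : 'I_m -> 'I_n) (t : 'I_p -> 'I_q)
    (i : 'I_(m * p)) : 'I_(n * q) :=
  mxtens_index (s (mxtens_unindex i).1, t (mxtens_unindex i).2).

Lemma tens_fun_mx m n p q (s : 'I_m -> 'I_n) (t : 'I_p -> 'I_q) :
  fun_mx s *t fun_mx t = fun_mx (tens_fun s t).
Proof.
apply/matrixP=> i j; rewrite !mxE -natrM mulnb; congr ((nat_of_bool _)%:R).
case: (mxtens_indexP j) => k l; rewrite /tens_fun mxtens_indexK.
by rewrite (can_eq (@mxtens_indexK n q)) xpair_eqE.
Qed.

Lemma tensmx_id m n : (1%:M : 'M[K]_m) *t (1%:M : 'M[K]_n) = 1%:M.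
Proof.
rewrite -!fun_mx_id tens_fun_mx; apply: eq_fun_mx => i.
by case: (mxtens_indexP i) => k l; rewrite /tens_fun mxtens_indexK.
Qed.

Definition tassoc m n p (i : 'I_((m * n) * p)) : 'I_(m * (n * p)) :=
  let jk := mxtens_unindex i in let ij := mxtens_unindex jk.1 in
  mxtens_index (ij.1, mxtens_index (ij.2, jk.2)).

Definition tassoci m n p (i : 'I_(m * (n * p))) : 'I_((m * n) * p) :=
  let ij := mxtens_unindex i in let jk := mxtens_unindex ij.2 in
  mxtens_index (mxtens_index (ij.1, jk.1), jk.2).

Definition tlunit n (i : 'I_(1 * n)) : 'I_n := (mxtens_unindex i).2.
Definition tluniti n (i : 'I_n) : 'I_(1 * n) := mxtens_index (ord0, i).
Definition trunit n (i : 'I_(n * 1)) : 'I_n := (mxtens_unindex i).1.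
Definition truniti n (i : 'I_n) : 'I_(n * 1) := mxtens_index (i, ord0).

Definition tswap m n (i : 'I_(m * n)) : 'I_(n * m) :=
  mxtens_index ((mxtens_unindex i).2, (mxtens_unindex i).1).

Lemma tens_funE m n p q (s : 'I_m -> 'I_n) (t : 'I_p -> 'I_q) i j :
  tens_fun s t (mxtens_index (i, j)) = mxtens_index (s i, t j).
Proof. by rewrite /tens_fun mxtens_indexK. Qed.

Lemma tassocE m n p (i : 'I_m) (j : 'I_n) (k : 'I_p) :
  tassoc (mxtens_index (mxtens_index (i, j), k))
  = mxtens_index (i, mxtens_index (j, k)).
Proof. by rewrite /tassoc !mxtens_indexK. Qed.

Lemma tassociE m n p (i : 'I_m) (j : 'I_n) (k : 'I_p) :
  tassoci (mxtens_index (i, mxtens_index (j, k)))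
  = mxtens_index (mxtens_index (i, j), k).
Proof. by rewrite /tassoci !mxtens_indexK. Qed.

Lemma tlunitE n (i : 'I_1) (j : 'I_n) : tlunit (mxtens_index (i, j)) = j.
Proof. by rewrite /tlunit mxtens_indexK. Qed.

Lemma trunitE n (i : 'I_n) (j : 'I_1) : trunit (mxtens_index (i, j)) = i.
Proof. by rewrite /trunit mxtens_indexK. Qed.

Lemma tswapE m n (i : 'I_m) (j : 'I_n) :
  tswap (mxtens_index (i, j)) = mxtens_index (j, i).
Proof. by rewrite /tswap mxtens_indexK. Qed.

Lemma tassocK m n p : cancel (@tassoc m n p) (@tassoci m n p).
Proof.
move=> i; case: (mxtens_indexP i) => j k; case: (mxtens_indexP j) => {}i {}j.
by rewrite /tassoc /tassoci !mxtens_indexK.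
Qed.

Lemma tassociK m n p : cancel (@tassoci m n p) (@tassoc m n p).
Proof.
move=> i; case: (mxtens_indexP i) => {}i j; case: (mxtens_indexP j) => {}j k.
by rewrite /tassoc /tassoci !mxtens_indexK.
Qed.

Lemma tlunitK n : cancel (@tlunit n) (@tluniti n).
Proof.
move=> i; case: (mxtens_indexP i) => j k.
by rewrite /tlunit /tluniti mxtens_indexK [j]ord1.
Qed.

Lemma tlunitiK n : cancel (@tluniti n) (@tlunit n).
Proof. by move=> i; rewrite /tlunit /tluniti mxtens_indexK. Qed.

Lemma trunitK n : cancel (@trunit n) (@truniti n).
Proof.
move=> i; case: (mxtens_indexP i) => j k.
by rewrite /trunit /truniti mxtens_indexK [k]ord1.
Qed.

Lemma trunitiK n : cancel (@truniti n) (@trunit n).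
Proof. by move=> i; rewrite /trunit /truniti mxtens_indexK. Qed.

Lemma tswapK m n : cancel (@tswap m n) (@tswap n m).
Proof.
by move=> i; case: (mxtens_indexP i) => j k; rewrite /tswap !mxtens_indexK.
Qed.

Lemma tpentagon m n p q :
  (fun_mx (@tassoc m n p) *t 1%:M) *m
    (fun_mx (@tassoc m (n * p) q) *m (1%:M *t fun_mx (@tassoc n p q)))
  = fun_mx (@tassoc (m * n) p q) *m fun_mx (@tassoc m n (p * q)).
Proof.
rewrite -!fun_mx_id !tens_fun_mx !fun_mx_comp.
apply: eq_fun_mx => i; case: (mxtens_indexP i) => {}i l.
case: (mxtens_indexP i) => {}i k; case: (mxtens_indexP i) => {}i j.
by rewrite !(tens_funE, tassocE).
Qed.

Lemma ttriangle m n :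
  fun_mx (@tassoc m 1 n) *m (1%:M *t fun_mx (@tlunit n))
  = fun_mx (@trunit m) *t 1%:M.
Proof.
rewrite -!fun_mx_id !tens_fun_mx !fun_mx_comp.
apply: eq_fun_mx => i; case: (mxtens_indexP i) => {}i k.
case: (mxtens_indexP i) => {}i j.
by rewrite tassocE !tens_funE tlunitE trunitE.
Qed.

Lemma thexagon m n p :
  fun_mx (@tassoc m n p) *m
    (fun_mx (@tswap m (n * p)) *m fun_mx (@tassoc n p m))
  = (fun_mx (@tswap m n) *t 1%:M) *m
      (fun_mx (@tassoc n m p) *m (1%:M *t fun_mx (@tswap m p))).
Proof.
rewrite -!fun_mx_id !tens_fun_mx !fun_mx_comp.
apply: eq_fun_mx => i; case: (mxtens_indexP i) => {}i k.
case: (mxtens_indexP i) => {}i j.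
by rewrite !(tens_funE, tassocE, tswapE).
Qed.

Lemma thexagoni m n p :
  fun_mx (@tassoci m n p) *m
    (fun_mx (@tswap (m * n) p) *m fun_mx (@tassoci p m n))
  = (1%:M *t fun_mx (@tswap n p)) *m
      (fun_mx (@tassoci m p n) *m (fun_mx (@tswap m p) *t 1%:M)).
Proof.
rewrite -!fun_mx_id !tens_fun_mx !fun_mx_comp.
apply: eq_fun_mx => i; case: (mxtens_indexP i) => {}i k.
case: (mxtens_indexP k) => j l.
by rewrite !(tens_funE, tassociE, tswapE).
Qed.

Lemma tassoc_nat m m' n n' p p' (f : 'M[K]_(m, m')) (g : 'M[K]_(n, n'))
    (h : 'M[K]_(p, p')) :
  ((f *t g) *t h) *m fun_mx (@tassoc m' n' p')
  = fun_mx (@tassoc m n p) *m (f *t (g *t h)).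
Proof.
rewrite mul_fun_mx (mulmx_fun _ (@tassocK _ _ _) (@tassociK _ _ _)).
apply/matrixP=> i j; rewrite !mxE /tassoc /tassoci.
by rewrite !mxtens_indexK /= mulrA.
Qed.

Lemma tlunit_nat m n (f : 'M[K]_(m, n)) :
  (1%:M *t f) *m fun_mx (@tlunit n) = fun_mx (@tlunit m) *m f.
Proof.
rewrite mul_fun_mx (mulmx_fun _ (@tlunitK _) (@tlunitiK _)).
apply/matrixP=> i j; case: (mxtens_indexP i) => k l.
by rewrite !mxE /tlunit !mxtens_indexK [k]ord1 eqxx mul1r.
Qed.

Lemma trunit_nat m n (f : 'M[K]_(m, n)) :
  (f *t 1%:M) *m fun_mx (@trunit n) = fun_mx (@trunit m) *m f.
Proof.
rewrite mul_fun_mx (mulmx_fun _ (@trunitK _) (@trunitiK _)).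
apply/matrixP=> i j; case: (mxtens_indexP i) => k l.
by rewrite !mxE /trunit !mxtens_indexK [l]ord1 eqxx mulr1.
Qed.

Lemma tswap_nat m m' n n' (f : 'M[K]_(m, m')) (g : 'M[K]_(n, n')) :
  (f *t g) *m fun_mx (@tswap m' n') = fun_mx (@tswap m n) *m (g *t f).
Proof.
rewrite mul_fun_mx (mulmx_fun _ (@tswapK _ _) (@tswapK _ _)).
by apply/matrixP=> i j; rewrite !mxE !mxtens_indexK /= mulrC.
Qed.

End FunctionMatrix.

Section RepCategory.
Variables (K : fieldType) (gT : finGroupType) (G : {group gT}).

Structure rep := Rep {
  rep_dim : nat;
  rep_mx :> mx_representation K G rep_dim
}.

(* As in mxrepresentation, matrices act on row vectors by right
   multiplication, so that composition g \o f is the product f *m g. *)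
Definition intertwiner (V W : rep) : {vspace 'M[K]_(rep_dim V, rep_dim W)} :=
  (\bigcap_(x in G)
     lker (linfun (mulmx (V x) : 'M_(rep_dim V, rep_dim W) -> _)
           - linfun (mulmxr (W x)))%R)%VS.

Lemma intertwinerP (V W : rep) (f : 'M_(rep_dim V, rep_dim W)) :
  reflect (forall x, x \in G -> V x *m f = f *m W x) (f \in intertwiner V W).
Proof.
rewrite memvE; apply: (iffP subv_bigcapP) => h x /[dup] Gx /h;
  rewrite -memvE memv_ker add_lfunE opp_lfunE !lfunE /= subr_eq0; last first.
  by move->.
by move/eqP.
Qed.

Definition rep_hom (V W : rep) : vectType K := subvs_of (intertwiner V W).

Lemma rep_hom_inj V W (f g : rep_hom V W) : vsval f = vsval g -> f = g.
Proof. exact: val_inj. Qed.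

Lemma rep_homD V W a (f g : rep_hom V W) :
  vsval (a *: f + g) = a *: vsval f + vsval g.
Proof. exact: linearP. Qed.

Lemma rep_homP (V W : rep) (f : rep_hom V W) x :
  x \in G -> V x *m vsval f = vsval f *m W x.
Proof. by apply/intertwinerP; apply: subvsP. Qed.

Lemma rep_id_subproof V : 1%:M \in intertwiner V V.
Proof. by apply/intertwinerP=> x _; rewrite mulmx1 mul1mx. Qed.

Definition rep_id V : rep_hom V V := Subvs (rep_id_subproof V).

Lemma rep_comp_subproof U V W (g : rep_hom V W) (f : rep_hom U V) :
  vsval f *m vsval g \in intertwiner U W.
Proof.
apply/intertwinerP=> x Gx.
by rewrite mulmxA rep_homP // -mulmxA rep_homP ?mulmxA.
Qed.

Definition rep_comp U V W (g : rep_hom V W) (f : rep_hom U V) : rep_hom U W :=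
  Subvs (rep_comp_subproof g f).

Lemma rep_comp_idl U V (f : rep_hom U V) : rep_comp (rep_id V) f = f.
Proof. by apply: rep_hom_inj; rewrite /= mulmx1. Qed.

Lemma rep_comp_idr U V (f : rep_hom U V) : rep_comp f (rep_id U) = f.
Proof. by apply: rep_hom_inj; rewrite /= mul1mx. Qed.

Lemma rep_comp_assoc T U V W (h : rep_hom V W) (g : rep_hom U V)
  (f : rep_hom T U) : rep_comp h (rep_comp g f) = rep_comp (rep_comp h g) f.
Proof. by apply: rep_hom_inj; rewrite /= mulmxA. Qed.

Lemma rep_comp_linr U V W (g : rep_hom V W) :
  linear (rep_comp g : rep_hom U V -> rep_hom U W).
Proof.
by move=> a f f'; apply: rep_hom_inj; rewrite rep_homD /= mulmxDl -scalemxAl.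
Qed.

Lemma rep_comp_linl U V W (f : rep_hom U V) :
  linear (fun g : rep_hom V W => rep_comp g f).
Proof.
by move=> a g g'; apply: rep_hom_inj; rewrite rep_homD /= mulmxDr -scalemxAr.
Qed.

Definition rep_lincat : lincat K :=
  Lincat rep_comp_idl rep_comp_idr rep_comp_assoc rep_comp_linr rep_comp_linl.

Lemma rep_tens_subproof (V W : rep) : mx_repr G (fun x => V x *t W x).
Proof.
split=> [|x y Gx Gy]; first by rewrite !repr_mx1 tensmx_id.
by rewrite !repr_mxM // tensmx_mul.
Qed.

Definition rep_tens (V W : rep) : rep :=
  Rep (MxRepresentation (rep_tens_subproof V W)).

Lemma rep_tensm_subproof V V' W W' (f : rep_hom V V') (g : rep_hom W W') :
  vsval f *t vsval g \in intertwiner (rep_tens V W) (rep_tens V' W').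
Proof. by apply/intertwinerP=> x Gx; rewrite /= !tensmx_mul !rep_homP. Qed.

Definition rep_tensm V V' W W' (f : rep_hom V V') (g : rep_hom W W') :
    rep_hom (rep_tens V W) (rep_tens V' W') :=
  Subvs (rep_tensm_subproof f g).

Lemma rep_one_subproof : mx_repr G (fun _ => 1%:M : 'M[K]_1).
Proof. by split=> // x y _ _; rewrite mulmx1. Qed.

Definition rep_one : rep := Rep (MxRepresentation rep_one_subproof).

Lemma rep_assoc_subproof U V W :
  fun_mx K (@tassoc (rep_dim U) (rep_dim V) (rep_dim W))
  \in intertwiner (rep_tens (rep_tens U V) W) (rep_tens U (rep_tens V W)).
Proof. by apply/intertwinerP=> x _; rewrite /= tassoc_nat. Qed.

Definition rep_assoc U V W :
    rep_hom (rep_tens (rep_tens U V) W) (rep_tens U (rep_tens V W)) :=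
  Subvs (rep_assoc_subproof U V W).

Lemma rep_inv_subproof V W (s : 'I_(rep_dim V) -> 'I_(rep_dim W)) t :
  cancel s t -> cancel t s ->
  fun_mx K s \in intertwiner V W -> fun_mx K t \in intertwiner W V.
Proof.
move=> sK tK /intertwinerP h; apply/intertwinerP=> x /h e.
have st : fun_mx K s *m fun_mx K t = 1%:M.
  by rewrite fun_mx_comp -fun_mx_id; apply: eq_fun_mx.
have ts : fun_mx K t *m fun_mx K s = 1%:M.
  by rewrite fun_mx_comp -fun_mx_id; apply: eq_fun_mx.
by rewrite -[LHS]mul1mx -ts -mulmxA (mulmxA _ (W x)) -e -!mulmxA st mulmx1.
Qed.

Definition rep_associ U V W :
    rep_hom (rep_tens U (rep_tens V W)) (rep_tens (rep_tens U V) W) :=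
  Subvs (rep_inv_subproof (V := rep_tens (rep_tens U V) W)
    (W := rep_tens U (rep_tens V W)) (@tassocK _ _ _) (@tassociK _ _ _)
    (rep_assoc_subproof U V W)).

Lemma rep_lunit_subproof V :
  fun_mx K (@tlunit (rep_dim V)) \in intertwiner (rep_tens rep_one V) V.
Proof. by apply/intertwinerP=> x _; rewrite /= tlunit_nat. Qed.

Definition rep_lunit V :
    rep_hom (rep_tens rep_one V) V := Subvs (rep_lunit_subproof V).
Definition rep_luniti V :
    rep_hom V (rep_tens rep_one V) :=
  Subvs (rep_inv_subproof (V := rep_tens rep_one V) (@tlunitK _) (@tlunitiK _)
    (rep_lunit_subproof V)).

Lemma rep_runit_subproof V :
  fun_mx K (@trunit (rep_dim V)) \in intertwiner (rep_tens V rep_one) V.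
Proof. by apply/intertwinerP=> x _; rewrite /= trunit_nat. Qed.

Definition rep_runit V :
    rep_hom (rep_tens V rep_one) V := Subvs (rep_runit_subproof V).
Definition rep_runiti V :
    rep_hom V (rep_tens V rep_one) :=
  Subvs (rep_inv_subproof (V := rep_tens V rep_one) (@trunitK _) (@trunitiK _)
    (rep_runit_subproof V)).

Lemma rep_braid_subproof V W :
  fun_mx K (@tswap (rep_dim V) (rep_dim W))
  \in intertwiner (rep_tens V W) (rep_tens W V).
Proof. by apply/intertwinerP=> x _; rewrite /= tswap_nat. Qed.

Definition rep_braid V W :
    rep_hom (rep_tens V W) (rep_tens W V) := Subvs (rep_braid_subproof V W).

Lemma rep_tensm_id V W :
  rep_tensm (rep_id V) (rep_id W) = rep_id (rep_tens V W).
Proof. by apply: rep_hom_inj; rewrite /= tensmx_id. Qed.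

Lemma rep_tensm_comp V V' V'' W W' W'' (f' : rep_hom V' V'') (f : rep_hom V V')
    (g' : rep_hom W' W'') (g : rep_hom W W') :
  rep_tensm (rep_comp f' f) (rep_comp g' g)
  = rep_comp (rep_tensm f' g') (rep_tensm f g).
Proof. by apply: rep_hom_inj; rewrite /= tensmx_mul. Qed.

Lemma rep_tensm_linr V V' W W' (f : rep_hom V V') :
  linear (rep_tensm f :
    rep_hom W W' -> rep_hom (rep_tens V W) (rep_tens V' W')).
Proof.
move=> a g g'; apply: rep_hom_inj; rewrite rep_homD /=.
by apply/matrixP=> i j; rewrite !mxE mulrDr mulrCA.
Qed.

Lemma rep_tensm_linl V V' W W' (g : rep_hom W W') :
  linear (fun f : rep_hom V V' => rep_tensm f g).
Proof.
move=> a f f'; apply: rep_hom_inj; rewrite rep_homD /=.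
by apply/matrixP=> i j; rewrite !mxE mulrDl mulrA.
Qed.

Lemma rep_inverse V W (s : 'I_(rep_dim V) -> 'I_(rep_dim W)) t
    (sK : cancel s t) (tK : cancel t s) (h : fun_mx K s \in intertwiner V W) :
  @inverse K rep_lincat V W (Subvs h) (Subvs (rep_inv_subproof sK tK h)).
Proof.
split; apply: rep_hom_inj; rewrite /= fun_mx_comp -fun_mx_id;
  exact: eq_fun_mx.
Qed.

Lemma rep_pentagon (T U V W : rep) :
  rep_comp (rep_comp (rep_tensm (rep_id T) (rep_assoc U V W))
      (rep_assoc T (rep_tens U V) W))
    (rep_tensm (rep_assoc T U V) (rep_id W))
  = rep_comp (rep_assoc T U (rep_tens V W)) (rep_assoc (rep_tens T U) V W).
Proof.
exact/rep_hom_inj/tpentagon.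
Qed.

Lemma rep_triangle (V W : rep) :
  rep_comp (rep_tensm (rep_id V) (rep_lunit W)) (rep_assoc V rep_one W)
  = rep_tensm (rep_runit V) (rep_id W).
Proof.
exact/rep_hom_inj/ttriangle.
Qed.

Lemma rep_assocK (U V W : rep) :
  @inverse K rep_lincat _ _ (rep_assoc U V W) (rep_associ U V W).
Proof. exact: rep_inverse. Qed.

Lemma rep_lunitK (V : rep) :
  @inverse K rep_lincat _ _ (rep_lunit V) (rep_luniti V).
Proof. exact: rep_inverse. Qed.

Lemma rep_runitK (V : rep) :
  @inverse K rep_lincat _ _ (rep_runit V) (rep_runiti V).
Proof. exact: rep_inverse. Qed.

Lemma rep_assoc_nat U U' V V' W W'
    (f : rep_hom U U') (g : rep_hom V V') (h : rep_hom W W') :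
  rep_comp (rep_assoc U' V' W') (rep_tensm (rep_tensm f g) h)
  = rep_comp (rep_tensm f (rep_tensm g h)) (rep_assoc U V W).
Proof. exact/rep_hom_inj/tassoc_nat. Qed.

Lemma rep_lunit_nat V V' (f : rep_hom V V') :
  rep_comp (rep_lunit V') (rep_tensm (rep_id rep_one) f)
  = rep_comp f (rep_lunit V).
Proof. exact/rep_hom_inj/tlunit_nat. Qed.

Lemma rep_runit_nat V V' (f : rep_hom V V') :
  rep_comp (rep_runit V') (rep_tensm f (rep_id rep_one))
  = rep_comp f (rep_runit V).
Proof. exact/rep_hom_inj/trunit_nat. Qed.

Definition rep_moncat : moncat K :=
  @Moncat K rep_lincat rep_tens rep_tensm rep_one rep_assoc rep_associ
    rep_lunit rep_luniti rep_runit rep_runiti rep_tensm_id rep_tensm_comp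
    rep_tensm_linr rep_tensm_linl rep_assocK rep_lunitK rep_runitK
    rep_assoc_nat rep_lunit_nat rep_runit_nat rep_pentagon rep_triangle.

Lemma rep_braid_iso (V W : rep) : @iso K rep_lincat _ _ (rep_braid V W).
Proof.
exists (rep_braid W V); split; apply: rep_hom_inj;
  rewrite /= fun_mx_comp -fun_mx_id; apply: eq_fun_mx; exact: tswapK.
Qed.

Lemma rep_braid_nat V V' W W' (f : rep_hom V V') (g : rep_hom W W') :
  rep_comp (rep_braid V' W') (rep_tensm f g)
  = rep_comp (rep_tensm g f) (rep_braid V W).
Proof. exact/rep_hom_inj/tswap_nat. Qed.

Lemma rep_hexagon U V W :
  rep_comp (rep_comp (rep_assoc V W U) (rep_braid U (rep_tens V W)))
    (rep_assoc U V W)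
  = rep_comp (rep_comp (rep_tensm (rep_id V) (rep_braid U W)) (rep_assoc V U W))
      (rep_tensm (rep_braid U V) (rep_id W)).
Proof. exact/rep_hom_inj/thexagon. Qed.

Lemma rep_hexagoni U V W :
  rep_comp (rep_comp (rep_associ W U V) (rep_braid (rep_tens U V) W))
    (rep_associ U V W)
  = rep_comp (rep_comp (rep_tensm (rep_braid U W) (rep_id V))
      (rep_associ U W V))
      (rep_tensm (rep_id U) (rep_braid V W)).
Proof. exact/rep_hom_inj/thexagoni. Qed.

(* Rep(G) with its standard symmetric braiding. *)
Definition rep_brcat : brcat K :=
  @Brcat K rep_moncat rep_braid rep_braid_iso rep_braid_nat rep_hexagon
    rep_hexagoni.

End RepCategory.

Definition tannakian (K : fieldType) (C : brcat K) : Prop :=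
  exists (gT : finGroupType) (G : {group gT}),
    braided_equivalent C (rep_brcat K G).

Section Duality.
Variables (K : fieldType) (C : moncat K).

Structure left_duality := LeftDuality {
  ldual : C -> C;
  ev : forall X, mor (ldual X ⊗ X) one;
  coev : forall X, mor one (X ⊗ ldual X);
  dualP : forall X, is_left_dual (ev X) (coev X)
}.

Variable d : left_duality.
Implicit Types X Y A : C.

(* The morphism A -> X^* corresponding to a pairing A ⊗ X -> 1. *)
Definition mate A X (p : mor (A ⊗ X) one) : mor A (ldual d X) :=
  lunit (ldual d X) \o (p ⊠ idm (ldual d X)) \o associ A X (ldual d X)
    \o (idm A ⊠ coev d X) \o runiti A.

Definition dualm X Y (f : mor X Y) : mor (ldual d Y) (ldual d X) :=
  mate (ev d Y \o (idm (ldual d Y) ⊠ f)).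

(* The canonical isomorphism Y^* ⊗ X^* -> (X ⊗ Y)^*. *)
Definition dual_tens X Y : mor (ldual d Y ⊗ ldual d X) (ldual d (X ⊗ Y)) :=
  mate (ev d Y
    \o (idm (ldual d Y) ⊠
          (lunit Y \o (ev d X ⊠ idm Y) \o associ (ldual d X) X Y))
    \o assoc (ldual d Y) (ldual d X) (X ⊗ Y)).

(* The third condition is the compatibility of a with tensor products: up to
   the canonical isomorphism X^** ⊗ Y^** = (X ⊗ Y)^**, a (X ⊗ Y) is
   a X ⊠ a Y. *)
Definition pivotal (a : forall X, mor X (ldual d (ldual d X))) : Prop :=
  [/\ forall X, iso (a X),
      forall X Y (f : mor X Y), dualm (dualm f) \o a X = a Y \o f &
      forall X Y, dualm (dual_tens X Y) \o a (X ⊗ Y)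
        = dual_tens (ldual d Y) (ldual d X) \o (a X ⊠ a Y)].

Definition qdim (a : forall X, mor X (ldual d (ldual d X))) X : K :=
  endo_scalar (ev d (ldual d X) \o (a X ⊠ idm (ldual d X)) \o coev d X).

Definition spherical (a : forall X, mor X (ldual d (ldual d X))) : Prop :=
  pivotal a /\ forall X, qdim a (ldual d X) = qdim a X.

(* The sum over the simple objects X of |X|^2, the product of dim X and
   dim X^*. *)
Definition global_dim (F : fusion C)
    (a : forall X, mor X (ldual d (ldual d X))) : K :=
  \sum_i qdim a (irr F i) * qdim a (ldual d (irr F i)).

End Duality.

Section Twist.
Variables (K : fieldType) (C : brcat K) (d : left_duality C).

(* The Drinfeld isomorphism u. *)
Definition drinfeld (X : C) : mor X (ldual d (ldual d X)) :=
  mate d (ev d X \o braid X (ldual d X)).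

(* theta is the twist of the pivotal structure a: a = u theta. *)
Definition is_twist (a : forall X, mor X (ldual d (ldual d X)))
    (theta : forall X : C, mor X X) : Prop :=
  forall X, a X = drinfeld X \o theta X.

End Twist.

Definition zeta (R : realType) (n : nat) : R[i] :=
  (cos (2 * pi / n%:R) +i* sin (2 * pi / n%:R))%C.

(* Main.v *)
(* Let X be a simple object of D. Since X ⊗ rho is a multiple of rho, balancing
   makes the double braiding of X with rho the scalar theta_X^-1; hence
   theta_Z = theta_X theta_Y for every summand Z of X ⊗ Y in D, and balancing
   again shows that D is symmetric. D is therefore Tannakian, which makes each
   theta_X a positive number (compare FPdim X with the dimension of the
   corresponding representation), and multiplicativity on summands forces
   theta_X = 1. So D centralizes all of C.

   Put t = theta_rho, d = FPdim rho, so that d^2 = N + kappa d. The scalar s of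
   the endomorphism of rho given by a rho-labelled loop around rho satisfies
   s^2 = N + kappa s, and computing the trace of the double braiding gives
   t^2 s d = N + kappa d t. The solution s = d would make C symmetric, so
   s = -N/d and N t^2 + kappa d t + N = 0. Taking determinants of the full twist
   on Hom(rho, rho^3) (Vafa's argument) shows that t is a root of unity, so
   kappa d / N = -(t + 1/t) is an integer between 0 and 2; these are the three
   cases. When kappa = 0, the braiding of rho with itself has trace t d and
   square -1, so its spectral projections have integral dimension, whence d is
   an integer. *)
From HB Require Import structures.
From mathcomp Require Import all_fingroup mxrepresentation mxtens.
From mathcomp Require Import classical_sets trigo.
Require Import Defs.
From mathcomp Require Import all_boot all_order all_algebra.
From mathcomp Require Import complex reals.
From mathcomp Require Import ring lra.

Set Implicit Arguments.
Unset Strict Implicit.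
Unset Printing Implicit Defensive.

Import Order.TTheory GRing.Theory Num.Theory.
Local Open Scope ring_scope.
Local Open Scope complex_scope.
Local Open Scope cat_scope.

(** The supremum defining [FPdim] gives neither additivity nor multiplicativity by itself. Both come
    from [a_canonical]: a quantum dimension is a trace, and traces are computed with string
    diagrams. The eigenvalue definition is opened only for nonnegativity, for the unit object, and
    to compare dimensions in [D] with those in [C], where a positive eigenvector decides. Since
    [is_twist] only says [a = u theta], naturality and balancing of the twist have to be derived,
    and this is the main task of the string calculus.

    The solution [s = d] is excluded as follows. The trace equation becomes
    [(t - 1) (d^2 t + N) = 0]. Either [t = 1], or [|t| = 1] forces [d^2 = N], [kappa = 0] and
    [t = -1]; in both cases the twist of [rho ⊗ rho] is the identity and [t^2 = 1], so [rho]
    centralizes itself.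

    Integrality of [FPdim(C) = 2N + kappa d] makes [kappa d] an integer, so that [t + 1/t] is
    rational and, [t] being a root of unity, an integer. With [c = kappa d / N] one gets
    [kappa^2 (1 + c) = c^2 N], whence [d = 2 kappa] for [c = 1] and [d = 3 kappa / 2] for
    [c = 2]. *)

Local Notation comp := Defs.comp (only parsing).
Local Notation one := Defs.one (only parsing).

Notation "X ◁ f" := (tensm (idm X) f)
  (at level 40, left associativity, format "X  ◁  f") : cat_scope.
Notation "f ▷ Z" := (tensm f (idm Z))
  (at level 40, left associativity, format "f  ▷  Z") : cat_scope.

(** * Linear categories *)

Section LinearCategory.
Variables (K : fieldType) (C : lincat K).
Implicit Types X Y Z S : C.

HB.instance Definition _ X Y Z (g : mor Y Z) :=
  GRing.isLinear.Build K (mor X Y) (mor X Z) _ (comp g) (comp_linr g).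

Lemma compDr X Y Z (g : mor Y Z) (f f' : mor X Y) :
  g \o (f + f') = (g \o f) + (g \o f').
Proof. exact: (linearD (comp g)). Qed.

Lemma compZr X Y Z (g : mor Y Z) k (f : mor X Y) :
  g \o (k *: f) = k *: (g \o f).
Proof. exact: (linearZZ (comp g)). Qed.

Lemma comp0r X Y Z (g : mor Y Z) : g \o (0 : mor X Y) = 0.
Proof. exact: (linear0 (comp g)). Qed.

Lemma compBr X Y Z (g : mor Y Z) (f f' : mor X Y) :
  g \o (f - f') = (g \o f) - (g \o f').
Proof. exact: (linearB (comp g)). Qed.

Lemma comp_sumr X Y Z (g : mor Y Z) I r (P : pred I) (F : I -> mor X Y) :
  g \o (\sum_(i <- r | P i) F i) = \sum_(i <- r | P i) (g \o F i).
Proof. exact: (linear_sum (comp g)). Qed.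

(** A named function, so that linearity of composition in its left argument can be registered as a
    structure; [rtensm] does the same for tensor products. *)
Definition precomp X Y Z (f : mor X Y) (g : mor Y Z) : mor X Z := g \o f.

HB.instance Definition _ X Y Z (f : mor X Y) :=
  GRing.isLinear.Build K (mor Y Z) (mor X Z) _ (@precomp X Y Z f)
    (comp_linl f).

Lemma compDl X Y Z (f : mor X Y) (g g' : mor Y Z) :
  (g + g') \o f = (g \o f) + (g' \o f).
Proof. exact: (linearD (precomp f)). Qed.

Lemma compZl X Y Z (f : mor X Y) k (g : mor Y Z) :
  (k *: g) \o f = k *: (g \o f).
Proof. exact: (linearZZ (precomp f)). Qed.

Lemma comp0l X Y Z (f : mor X Y) : (0 : mor Y Z) \o f = 0.
Proof. exact: (linear0 (precomp f)). Qed.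

Lemma compBl X Y Z (f : mor X Y) (g g' : mor Y Z) :
  (g - g') \o f = (g \o f) - (g' \o f).
Proof. exact: (linearB (precomp f)). Qed.

Lemma comp_suml X Y Z (f : mor X Y) I r (P : pred I) (F : I -> mor Y Z) :
  (\sum_(i <- r | P i) F i) \o f = \sum_(i <- r | P i) (F i \o f).
Proof. exact: (linear_sum (precomp f)). Qed.

(** Composites are kept nested to the right; in this form an equation rewrites its left side in the
    middle of such a composite. *)
Lemma reassoc X Y Z (a : mor Y Z) (b : mor X Y) (c : mor X Z) :
  a \o b = c -> forall W (k : mor W X), a \o (b \o k) = c \o k.
Proof. by move=> <- W k; rewrite comp_assoc. Qed.

Lemma iso_comp X Y Z (f : mor X Y) (g : mor Y Z) : iso f -> iso g -> iso
  (g \o f).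
Proof.
move=> [f' [f'f ff']] [g' [g'g gg']]; exists (f' \o g').
split; rewrite -!comp_assoc.
  by rewrite (reassoc g'g) comp_idl.
by rewrite (reassoc ff') comp_idl.
Qed.

Lemma isomorphic_refl X : isomorphic X X.
Proof. by exists (idm X); apply: iso_id. Qed.

Lemma isomorphic_sym X Y : isomorphic X Y -> isomorphic Y X.
Proof. by case=> f [g fg]; exists g, f; apply: inverse_sym. Qed.

Lemma isomorphic_trans X Y Z :
  isomorphic X Y -> isomorphic Y Z -> isomorphic X Z.
Proof.
by move=> [f fi] [g gi]; exists (g \o f); apply: iso_comp.
Qed.

End LinearCategory.

(** * Monoidal categories: bilinearity and coherence *)

Section Families.
Variables (K : fieldType) (C : moncat K).
Implicit Types X Y Z A B W V : C.

HB.instance Definition _ X X' Y Y' (f : mor X X') :=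
  GRing.isLinear.Build K (mor Y Y') (mor (X ⊗ Y) (X' ⊗ Y')) _
    (@tensm K C _ _ _ _ f)
    (tensm_linr f).

Definition rtensm X X' Y Y' (g : mor Y Y') (f : mor X X') :
  mor (X ⊗ Y) (X' ⊗ Y') := f ⊠ g.

HB.instance Definition _ X X' Y Y' (g : mor Y Y') :=
  GRing.isLinear.Build K (mor X X') (mor (X ⊗ Y) (X' ⊗ Y')) _
    (@rtensm X X' Y Y' g) (tensm_linl g).

Lemma tensmZr X X' Y Y' (f : mor X X') k (g : mor Y Y') :
  f ⊠ (k *: g) = k *: (f ⊠ g).
Proof. exact: (linearZZ (tensm f)). Qed.

Lemma tensmBr X X' Y Y' (f : mor X X') (g g' : mor Y Y') :
  f ⊠ (g - g') = f ⊠ g - (f ⊠ g').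
Proof. exact: (linearB (tensm f)). Qed.

Lemma tensm0r X X' Y Y' (f : mor X X') : f ⊠ (0 : mor Y Y') = 0.
Proof. exact: (linear0 (tensm f)). Qed.

Lemma tensm_sumr X X' Y Y' (f : mor X X') I r (P : pred I) (F : I -> mor Y Y') :
  f ⊠ (\sum_(i <- r | P i) F i) = \sum_(i <- r | P i) (f ⊠ F i).
Proof. exact: (linear_sum (tensm f)). Qed.

Lemma tensmZl X X' Y Y' (f : mor X X') k (g : mor Y Y') :
  (k *: f) ⊠ g = k *: (f ⊠ g).
Proof. exact: (linearZZ (rtensm g)). Qed.

Lemma tensm_suml X X' Y Y' (g : mor Y Y') I r (P : pred I) (F : I -> mor X X') :
  (\sum_(i <- r | P i) F i) ⊠ g = \sum_(i <- r | P i) (F i ⊠ g).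
Proof. exact: (linear_sum (rtensm g)). Qed.

Lemma whiskerC X X' Y Y' (f : mor X X') (g : mor Y Y') :
  (f ▷ Y') \o (X ◁ g) = (X' ◁ g) \o (f ▷ Y).
Proof. by rewrite -!tensm_comp !comp_idl !comp_idr. Qed.

Lemma isomorphic_tens X X' Y Y' : isomorphic X X' -> isomorphic Y Y' ->
  isomorphic (X ⊗ Y) (X' ⊗ Y').
Proof. by move=> [f fi] [g gi]; exists (f ⊠ g); apply: tensm_iso. Qed.

Lemma associ_assoc X Y Z : associ X Y Z \o assoc X Y Z = idm _.
Proof. by case: (assocK X Y Z). Qed.
Lemma assoc_associ X Y Z : assoc X Y Z \o associ X Y Z = idm _.
Proof. by case: (assocK X Y Z). Qed.
Lemma luniti_lunit X : luniti X \o lunit X = idm _.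
Proof. by case: (lunitK X). Qed.
Lemma lunit_luniti X : lunit X \o luniti X = idm _.
Proof. by case: (lunitK X). Qed.
Lemma runit_runiti X : runit X \o runiti X = idm _.
Proof. by case: (runitK X). Qed.

Lemma luniti_iso X : iso (luniti X).
Proof. by exists (lunit X); apply/inverse_sym/lunitK. Qed.

Lemma associ_nat X X' Y Y' Z Z' (f : mor X X') (g : mor Y Y') (h : mor Z Z') :
  associ X' Y' Z' \o (f ⊠ (g ⊠ h)) = ((f ⊠ g) ⊠ h) \o associ X Y Z.
Proof.
apply: (iso_cancel_left (assoc_iso X' Y' Z')).
rewrite comp_assoc assoc_associ comp_idl comp_assoc assoc_nat.
by rewrite -comp_assoc assoc_associ comp_idr.
Qed.

Lemma luniti_nat X X' (f : mor X X') : luniti X' \o f = (one ◁ f) \o luniti X.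
Proof.
apply: (iso_cancel_left (lunit_iso X')); rewrite !comp_assoc lunit_luniti.
by rewrite lunit_nat -comp_assoc lunit_luniti comp_idl comp_idr.
Qed.

Lemma luniti_tens X Y : luniti X ▷ Y = associ one X Y \o luniti (X ⊗ Y).
Proof.
apply: (iso_cancel_left (assoc_iso one X Y)).
rewrite comp_assoc assoc_associ comp_idl.
apply: (iso_cancel_left (lunit_iso (X ⊗ Y))).
by rewrite comp_assoc lunit_tens -tensm_compl !lunit_luniti tensm_id.
Qed.

Lemma triangle_associ X Y : (runit X ▷ Y) \o associ X one Y = X ◁ lunit Y.
Proof. by rewrite -triangle -comp_assoc assoc_associ comp_idr. Qed.

Lemma triangle_runiti X Y : assoc X one Y \o (runiti X ▷ Y) = X ◁ luniti Y.
Proof.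
have iL : iso (X ◁ lunit Y) by apply: tensm_iso (iso_id _) (lunit_iso _).
apply: (iso_cancel_left iL); rewrite comp_assoc triangle -tensm_compl.
by rewrite runit_runiti -tensm_comp lunit_luniti comp_idl.
Qed.

Lemma pentagon_assoc W X Y Z :
  assoc W X (Y ⊗ Z) \o assoc (W ⊗ X) Y Z
  = (W ◁ assoc X Y Z) \o (assoc W (X ⊗ Y) Z \o (assoc W X Y ▷ Z)).
Proof. by rewrite -pentagon -?comp_assoc. Qed.

Lemma pentagon_associ W X Y Z :
  associ (W ⊗ X) Y Z \o associ W X (Y ⊗ Z)
  = (associ W X Y ▷ Z) \o (associ W (X ⊗ Y) Z \o (W ◁ associ X Y Z)).
Proof.
have i : iso (assoc W X (Y ⊗ Z) \o assoc (W ⊗ X) Y Z).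
  exists (associ (W ⊗ X) Y Z \o associ W X (Y ⊗ Z)).
  split; rewrite -?comp_assoc.
    by rewrite (reassoc (associ_assoc _ _ _)) comp_idl associ_assoc.
  by rewrite (reassoc (assoc_associ _ _ _)) comp_idl assoc_associ.
apply: (iso_cancel_left i).
rewrite -[LHS]comp_assoc (reassoc (assoc_associ _ _ _)) comp_idl assoc_associ.
rewrite pentagon_assoc -?comp_assoc.
rewrite (reassoc (esym (tensm_comp _ _ _ _))) assoc_associ comp_idl tensm_id.
rewrite comp_idl (reassoc (assoc_associ _ _ _)) comp_idl -tensm_comp.
by rewrite assoc_associ comp_idl tensm_id.
Qed.

Lemma pentagon_mixed W X Y Z :
  (assoc W X Y ▷ Z) \o associ (W ⊗ X) Y Z
  = associ W (X ⊗ Y) Z \o ((W ◁ associ X Y Z) \o assoc W X (Y ⊗ Z)).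
Proof.
apply: (iso_cancel_right (associ_iso W X (Y ⊗ Z))).
rewrite -?comp_assoc pentagon_associ (reassoc (esym (tensm_comp _ _ _ _))).
by rewrite assoc_associ comp_idl tensm_id comp_idl assoc_associ comp_idr.
Qed.

Lemma pentagon_mixedi W X Y Z :
  assoc (W ⊗ X) Y Z \o ((associ W X Y ▷ Z) \o associ W (X ⊗ Y) Z)
  = associ W X (Y ⊗ Z) \o (W ◁ assoc X Y Z).
Proof.
have i : iso (W ◁ associ X Y Z) by apply: tensm_iso (iso_id _)
  (associ_iso _ _ _).
apply: (iso_cancel_right i); rewrite -?comp_assoc -pentagon_associ.
rewrite (reassoc (assoc_associ _ _ _)) comp_idl -tensm_comp assoc_associ.
by rewrite comp_idl tensm_id comp_idr.
Qed.

End Families.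

(** * String calculus in monoidal categories *)

(* Objects are written as right-nested words X ⊗ (Y ⊗ ... ⊗ Z) ending in an
   arbitrary tail Z. A morphism acting on the leading letters of a word becomes
   a family natural in Z, whiskering on the right is a choice of Z, and no
   associators appear in the resulting string calculus. The definitions are
   locked so that rewriting with associativity does not unfold them. *)
HB.lock Definition fam2 (K : fieldType) (C : moncat K) (X A Y B : C)
    (f : mor (X ⊗ A) (Y ⊗ B)) (Z : C) : mor (X ⊗ (A ⊗ Z)) (Y ⊗ (B ⊗ Z)) :=
  assoc Y B Z \o ((f ▷ Z) \o associ X A Z).

HB.lock Definition pairf (K : fieldType) (C : moncat K) (A B : C)
    (p : mor (A ⊗ B) one) (Z : C) : mor (A ⊗ (B ⊗ Z)) Z :=
  lunit Z \o ((p ▷ Z) \o associ A B Z).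

HB.lock Definition copairf (K : fieldType) (C : moncat K) (A B : C)
    (q : mor one (A ⊗ B)) (Z : C) : mor Z (A ⊗ (B ⊗ Z)) :=
  assoc A B Z \o ((q ▷ Z) \o luniti Z).

Section FamilyCalculus.
Variables (K : fieldType) (C : moncat K).
Implicit Types X Y Z A B W V : C.

Lemma fam2E X A Y B (f : mor (X ⊗ A) (Y ⊗ B)) Z :
  fam2 f Z = assoc Y B Z \o ((f ▷ Z) \o associ X A Z).
Proof. by rewrite unlock. Qed.

Lemma pairfE A B (p : mor (A ⊗ B) one) Z :
  pairf p Z = lunit Z \o ((p ▷ Z) \o associ A B Z).
Proof. by rewrite unlock. Qed.

Lemma copairfE A B (q : mor one (A ⊗ B)) Z :
  copairf q Z = assoc A B Z \o ((q ▷ Z) \o luniti Z).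
Proof. by rewrite unlock. Qed.

Lemma pairf_nat A B (p : mor (A ⊗ B) one) Z Z' (g : mor Z Z') :
  g \o pairf p Z = pairf p Z' \o (A ◁ (B ◁ g)).
Proof.
rewrite !pairfE -?comp_assoc associ_nat.
rewrite (reassoc (esym (lunit_nat _))) !tensm_id -?comp_assoc.
by rewrite (reassoc (esym (whiskerC _ _))) -comp_assoc.
Qed.

Lemma copairf_nat A B (q : mor one (A ⊗ B)) Z Z' (g : mor Z Z') :
  (A ◁ (B ◁ g)) \o copairf q Z = copairf q Z' \o g.
Proof.
rewrite !copairfE -?comp_assoc luniti_nat.
rewrite (reassoc (esym (assoc_nat _ _ _))) !tensm_id -?comp_assoc.
by rewrite (reassoc (esym (whiskerC _ _))) -comp_assoc.
Qed.

Lemma fam2_comp X A Y B V W (g : mor (Y ⊗ B) (V ⊗ W)) (f : mor (X ⊗ A) (Y ⊗ B))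
  Z :
  fam2 (g \o f) Z = fam2 g Z \o fam2 f Z.
Proof.
rewrite !fam2E tensm_compl -?comp_assoc (reassoc (associ_assoc _ _ _)).
by rewrite comp_idl.
Qed.

Lemma fam2_id X A Z : fam2 (idm (X ⊗ A)) Z = idm _.
Proof. by rewrite !fam2E tensm_id comp_idl assoc_associ. Qed.

Lemma fam2_tens X A Y B (f : mor X Y) (g : mor A B) Z :
  fam2 (f ⊠ g) Z = f ⊠ (g ▷ Z).
Proof. by rewrite !fam2E -associ_nat comp_assoc assoc_associ comp_idl. Qed.

(** Tensoring with the unit is faithful, so the tail [one] loses nothing: equations of pairings are
    proved in the string calculus and read back here. *)
Lemma pairf_inj A B (p q : mor (A ⊗ B) one) : pairf p one = pairf q one -> p =
  q.
Proof.
rewrite !pairfE => /(iso_cancel_left (lunit_iso _)).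
by move/(iso_cancel_right (associ_iso _ _ _))/tensm_one_injr.
Qed.

Lemma copairf_inj A B (p q : mor one (A ⊗ B)) :
  copairf p one = copairf q one -> p = q.
Proof.
rewrite !copairfE => /(iso_cancel_left (assoc_iso _ _ _)).
by move/(iso_cancel_right (luniti_iso _))/tensm_one_injr.
Qed.

Lemma pairf_comp A B A' B' (p : mor (A ⊗ B) one) (f : mor A' A) (g : mor B' B) Z
  :
  pairf (p \o (f ⊠ g)) Z = pairf p Z \o (f ⊠ (g ▷ Z)).
Proof. by rewrite !pairfE tensm_compl -?comp_assoc associ_nat. Qed.

Lemma pairf_fam2 A B A' B' (p : mor (A ⊗ B) one) (f : mor (A' ⊗ B') (A ⊗ B)) Z :
  pairf (p \o f) Z = pairf p Z \o fam2 f Z.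
Proof.
rewrite !pairfE !fam2E tensm_compl -?comp_assoc.
by rewrite (reassoc (associ_assoc _ _ _)) comp_idl.
Qed.

Lemma copairf_comp A B A' B' (q : mor one (A ⊗ B)) (f : mor A A') (g : mor B B')
  Z :
  copairf ((f ⊠ g) \o q) Z = (f ⊠ (g ▷ Z)) \o copairf q Z.
Proof.
by rewrite !copairfE tensm_compl -?comp_assoc (reassoc (assoc_nat _ _ _))
  -comp_assoc.
Qed.

Lemma pair_copair A B (p : mor (A ⊗ B) one) (q : mor one (A ⊗ B)) Z :
  pairf p Z \o copairf q Z = lunit Z \o (((p \o q) ▷ Z) \o luniti Z).
Proof.
rewrite !pairfE !copairfE -?comp_assoc (reassoc (associ_assoc _ _ _)) comp_idl.
by rewrite tensm_compl -?comp_assoc.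
Qed.

(** With an arbitrary tail, the mate becomes a cup followed by a cap; the pentagon and the triangle
    absorb all associators. [comate_fam] and [ptr_fam] do the same for the opposite bend and for
    partial traces. *)
Lemma mate_fam A X V (p : mor (A ⊗ X) one) (q : mor one (X ⊗ V)) Z :
  (lunit V \o (p ▷ V) \o associ A X V \o (A ◁ q) \o runiti A) ▷ Z
  = pairf p (V ⊗ Z) \o (A ◁ copairf q Z).
Proof.
rewrite !tensm_compl -?comp_assoc !pairfE !copairfE !tensm_compr -?comp_assoc.
rewrite -triangle_runiti (reassoc (esym (assoc_nat _ _ _))) -?comp_assoc.
rewrite -lunit_tens -?comp_assoc; congr (_ \o _).
rewrite (reassoc (assoc_nat _ _ _)) -comp_assoc tensm_id; congr (_ \o _).
by rewrite !comp_assoc -pentagon_mixedi -?comp_assoc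
  (reassoc (associ_assoc _ _ _)) comp_idl.
Qed.

Lemma comate_fam X Y W (p : mor (Y ⊗ W) one) (q : mor one (X ⊗ Y)) Z :
  (runit X \o (X ◁ p) \o assoc X Y W \o (q ▷ W) \o luniti W) ▷ Z
  = (X ◁ pairf p Z) \o copairf q (W ⊗ Z).
Proof.
rewrite !tensm_compl -?comp_assoc !pairfE !copairfE !tensm_compr -?comp_assoc.
rewrite luniti_tens (reassoc (esym (associ_nat _ _ _))) tensm_id -?comp_assoc.
rewrite (reassoc (pentagon_mixed _ _ _ _)) -?comp_assoc.
rewrite (reassoc (esym (associ_nat _ _ _))) -?comp_assoc.
by rewrite (reassoc (triangle_associ _ _)).
Qed.

Lemma ptr_fam X A Y A' B (f : mor (X ⊗ A) (Y ⊗ A')) (p : mor (A' ⊗ B) one)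
    (q : mor one (A ⊗ B)) Z :
  (runit Y \o (Y ◁ p) \o assoc Y A' B \o (f ▷ B) \o associ X A B \o (X ◁ q)
    \o runiti X) ▷ Z
  = (Y ◁ pairf p Z) \o (fam2 f (B ⊗ Z) \o (X ◁ copairf q Z)).
Proof.
rewrite !tensm_compl -?comp_assoc !pairfE !copairfE !fam2E !tensm_compr
  -?comp_assoc.
rewrite -triangle_runiti (reassoc (esym (assoc_nat _ _ _))) -?comp_assoc.
rewrite (comp_assoc (associ X A _)) -pentagon_mixedi -?comp_assoc.
rewrite (reassoc (associ_assoc _ _ _)) comp_idl.
rewrite -tensm_id (reassoc (esym (assoc_nat _ _ _))) -?comp_assoc.
rewrite (comp_assoc (Y ◁ associ _ _ _) (assoc _ _ _)).
rewrite (reassoc (_ : _ \o assoc _ _ _ = assoc _ _ _ \o (assoc _ _ _ ▷ _))).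
  rewrite -?comp_assoc (reassoc (esym (assoc_nat _ _ _))) -?comp_assoc.
  by rewrite (reassoc (triangle _ _)).
rewrite -comp_assoc pentagon_assoc (reassoc (esym (tensm_comp _ _ _ _))).
by rewrite associ_assoc comp_idl tensm_id comp_idl.
Qed.

Lemma zigzag1 X Y (ev : mor (Y ⊗ X) one) (coev : mor one (X ⊗ Y)) Z :
  is_left_dual ev coev -> (X ◁ pairf ev Z) \o copairf coev (X ⊗ Z) = idm _.
Proof. by case=> h _; rewrite -comate_fam h tensm_id. Qed.

Lemma zigzag2 X Y (ev : mor (Y ⊗ X) one) (coev : mor one (X ⊗ Y)) Z :
  is_left_dual ev coev -> pairf ev (Y ⊗ Z) \o (Y ◁ copairf coev Z) = idm _.
Proof. by case=> _ h; rewrite -mate_fam h tensm_id. Qed.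

End FamilyCalculus.

(** * Braided string calculus *)

HB.lock Definition cr (K : fieldType) (C : brcat K) (X Y Z : C) :
    mor (X ⊗ (Y ⊗ Z)) (Y ⊗ (X ⊗ Z)) := fam2 (braid X Y) Z.

Section BraidedFamilies.
Variables (K : fieldType) (C : brcat K).
Implicit Types X Y Z A B W V : C.

Lemma isomorphic_braid X Y : isomorphic (X ⊗ Y) (Y ⊗ X).
Proof. by exists (braid X Y); apply: braid_iso. Qed.

Lemma crE X Y Z : cr X Y Z = fam2 (braid X Y) Z.
Proof. by rewrite unlock. Qed.

Lemma cr_nat X X' Y Y' Z Z' (f : mor X X') (g : mor Y Y') (h : mor Z Z') :
  cr X' Y' Z' \o (f ⊠ (g ⊠ h)) = (g ⊠ (f ⊠ h)) \o cr X Y Z.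
Proof.
rewrite !crE !fam2E -?comp_assoc associ_nat.
rewrite (reassoc (esym (assoc_nat _ _ _))) -?comp_assoc.
by rewrite (comp_assoc (_ ⊠ h)) (comp_assoc (_ ▷ Z')) -!tensm_comp braid_nat
  comp_idl comp_idr.
Qed.

(** The hexagon axiom with [Y ⊗ Y'] read as two letters: crossing a product means crossing its
    factors in turn. *)
Lemma cr_hexagon X Y Y' Z :
  assoc Y Y' (X ⊗ Z) \o cr X (Y ⊗ Y') Z
  = (Y ◁ cr X Y' Z) \o (cr X Y (Y' ⊗ Z) \o (X ◁ assoc Y Y' Z)).
Proof.
have h : assoc Y Y' X \o braid X (Y ⊗ Y')
    = (Y ◁ braid X Y') \o (assoc Y X Y' \o ((braid X Y ▷ Y') \o associ X Y Y')).
  apply: (iso_cancel_right (assoc_iso X Y Y')).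
  by rewrite hexagon -!comp_assoc associ_assoc comp_idr.
rewrite {1}crE !fam2E (reassoc (pentagon_assoc _ _ _ _)) -?comp_assoc.
rewrite (comp_assoc (assoc Y Y' X ▷ Z)) -tensm_compl h !tensm_compl
  -?comp_assoc.
rewrite (reassoc (assoc_nat _ _ _)) !crE !fam2E !tensm_compr -?comp_assoc.
congr (_ \o _); congr (_ \o _).
have e : assoc Y (X ⊗ Y') Z \o (assoc Y X Y' ▷ Z)
    = (Y ◁ associ X Y' Z) \o (assoc Y X (Y' ⊗ Z) \o assoc (Y ⊗ X) Y' Z).
  rewrite pentagon_assoc (comp_assoc (Y ◁ associ _ _ _)) -tensm_comp.
  by rewrite associ_assoc comp_idl tensm_id comp_idl.
rewrite (reassoc e) -?comp_assoc; congr (_ \o _); congr (_ \o _).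
rewrite (reassoc (assoc_nat _ _ _)) -?comp_assoc tensm_id; congr (_ \o _).
exact: pentagon_mixedi.
Qed.

Lemma cr_hexagoni X X' Y Z :
  (Y ◁ assoc X X' Z) \o cr (X ⊗ X') Y Z
  = cr X Y (X' ⊗ Z) \o ((X ◁ cr X' Y Z) \o assoc X X' (Y ⊗ Z)).
Proof.
have h : braid (X ⊗ X') Y \o associ X X' Y
    = assoc Y X X' \o ((braid X Y ▷ X') \o (associ X Y X' \o (X ◁ braid X' Y))).
  apply: (iso_cancel_left (associ_iso Y X X')).
  by rewrite comp_assoc hexagoni !comp_assoc associ_assoc comp_idl.
rewrite !crE !fam2E !tensm_compr -?comp_assoc.
apply: (iso_cancel_right (associ_iso X X' (Y ⊗ Z))).
rewrite -?comp_assoc assoc_associ comp_idr pentagon_associ.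
rewrite (comp_assoc (braid _ _ ▷ Z)) -tensm_compl h !tensm_compl -?comp_assoc.
rewrite (reassoc (esym (associ_nat _ _ _))) -?comp_assoc.
have e : (Y ◁ assoc X X' Z) \o (assoc Y (X ⊗ X') Z \o (assoc Y X X' ▷ Z))
    = assoc Y X (X' ⊗ Z) \o assoc (Y ⊗ X) X' Z by rewrite -pentagon_assoc.
rewrite (comp_assoc (assoc Y (X ⊗ X') Z)) (reassoc e) -?comp_assoc.
congr (_ \o _).
rewrite (reassoc (assoc_nat _ _ _)) -?comp_assoc tensm_id; congr (_ \o _).
rewrite (comp_assoc (associ X Y X' ▷ Z)) (comp_assoc (assoc (X ⊗ Y) X' Z)).
by rewrite pentagon_mixedi -?comp_assoc.
Qed.

Lemma cr_one_right X Z : lunit (X ⊗ Z) \o cr X one Z = X ◁ lunit Z.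
Proof.
rewrite !crE !fam2E comp_assoc lunit_tens comp_assoc -tensm_compl
  braid_one_right.
exact: triangle_associ.
Qed.

Lemma luniti_cr X Z : cr X one Z \o (X ◁ luniti Z) = luniti (X ⊗ Z).
Proof.
apply: (iso_cancel_left (lunit_iso (X ⊗ Z))).
by rewrite comp_assoc cr_one_right -tensm_comp !lunit_luniti comp_idl tensm_id.
Qed.

Lemma assoc_iso_whisker X A B Z : iso (X ◁ assoc A B Z).
Proof. exact: tensm_iso (iso_id _) (assoc_iso _ _ _). Qed.

Section Pull.
Variables (A B : C).

(* In string diagrams: the strand X is pulled across a cap p or a cup q. *)
Lemma pull_pair_right (p : mor (A ⊗ B) one) X Z :
  pairf p (X ⊗ Z) \o ((A ◁ cr X B Z) \o cr X A (B ⊗ Z)) = X ◁ pairf p Z.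
Proof.
apply: (iso_cancel_right (assoc_iso_whisker X A B Z)).
rewrite -?comp_assoc -cr_hexagon !pairfE -?comp_assoc.
rewrite (reassoc (associ_assoc _ _ _)) comp_idl -(tensm_id X Z) -cr_nat.
rewrite (comp_assoc (lunit _)) cr_one_right -?tensm_comp !comp_idl.
by rewrite -?comp_assoc associ_assoc comp_idr.
Qed.

Lemma pull_copair_right (q : mor one (A ⊗ B)) X Z :
  (A ◁ cr X B Z) \o (cr X A (B ⊗ Z) \o (X ◁ copairf q Z)) = copairf q (X ⊗ Z).
Proof.
rewrite !copairfE !tensm_compr.
rewrite (comp_assoc (cr X A _)) (comp_assoc (A ◁ _)) -cr_hexagon -?comp_assoc.
by rewrite (comp_assoc (cr _ _ _)) cr_nat tensm_id -?comp_assoc luniti_cr.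
Qed.

End Pull.

(** Both hexagons are solved for the braiding with a product. The double braiding of [X] with [Z]
    ends up in the middle, so scalar double braidings of the factors multiply. *)
Lemma double_braid_tens X Y Z :
  braid Z (X ⊗ Y) \o braid (X ⊗ Y) Z
  = associ X Y Z \o ((X ◁ braid Z Y) \o (assoc X Z Y
      \o (((braid Z X \o braid X Z) ▷ Y) \o (associ X Z Y
      \o ((X ◁ braid Y Z) \o assoc X Y Z))))).
Proof.
have -> : braid Z (X ⊗ Y) = associ X Y Z \o ((X ◁ braid Z Y) \o (assoc X Z Y
    \o ((braid Z X ▷ Y) \o associ Z X Y))).
  apply: (iso_cancel_left (assoc_iso X Y Z)).
  apply: (iso_cancel_right (assoc_iso Z X Y)); rewrite hexagon -!comp_assoc.
  by rewrite associ_assoc comp_idr (reassoc (assoc_associ _ _ _)) comp_idl.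
have -> : braid (X ⊗ Y) Z = assoc Z X Y \o ((braid X Z ▷ Y) \o (associ X Z Y
    \o ((X ◁ braid Y Z) \o assoc X Y Z))).
  apply: (iso_cancel_left (associ_iso Z X Y)).
  apply: (iso_cancel_right (associ_iso X Y Z)); rewrite hexagoni -!comp_assoc.
  by rewrite assoc_associ comp_idr (reassoc (associ_assoc _ _ _)) comp_idl.
rewrite -!comp_assoc (reassoc (associ_assoc _ _ _)) comp_idl tensm_compl.
by rewrite -!comp_assoc.
Qed.

Lemma double_braid_nat X X' Y Y' (f : mor X X') (g : mor Y Y') :
  braid Y' X' \o (braid X' Y' \o (f ⊠ g)) = (f ⊠ g) \o (braid Y X \o braid X Y).
Proof. by rewrite braid_nat !comp_assoc braid_nat. Qed.

Lemma double_braid_sym X Y : braid Y X \o braid X Y = idm (X ⊗ Y) ->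
  braid X Y \o braid Y X = idm (Y ⊗ X).
Proof.
move=> c1; apply: (iso_cancel_right (braid_iso X Y)).
by rewrite -comp_assoc c1 comp_idr comp_idl.
Qed.

Lemma double_braid_sum n (V : 'I_n -> C) X m (W : 'I_m -> C) Y :
  direct_sum V X -> direct_sum W Y ->
  (forall k l, braid (W l) (V k) \o braid (V k) (W l) = idm _) ->
  braid Y X \o braid X Y = idm (X ⊗ Y).
Proof.
move=> [i [p [_ _ ip]]] [j [r [_ _ jr]]] cVW.
rewrite -[LHS]comp_idr -tensm_id -ip -jr tensm_suml comp_sumr.
apply: eq_bigr => k _; rewrite tensm_sumr comp_sumr; apply: eq_bigr => l _.
by rewrite tensm_comp -comp_assoc !(comp_assoc (braid X Y)) comp_assoc
  double_braid_nat cVW comp_idr.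
Qed.

End BraidedFamilies.

(** * Duals, pivotal structures and twists *)

Section Duals.
Variables (K : fieldType) (C : moncat K).
Implicit Types X Y Z A B W V : C.

(** One zigzag identity makes a pairing nondegenerate: bending the strand back recovers [f]. The
    pairing is arbitrary so that nested evaluations are covered. *)
Lemma fam_copair_inj X Y A (p : mor (Y ⊗ X) one) (q : mor one (X ⊗ Y))
    (f g : mor A X) :
  (forall Z, (X ◁ pairf p Z) \o copairf q (X ⊗ Z) = idm _) ->
  p \o (Y ◁ f) = p \o (Y ◁ g) -> f = g.
Proof.
move=> zz e; apply: tensm_one_injr.
have h (k : mor A X) :
    k ▷ one = (X ◁ pairf (p \o (Y ◁ k)) one) \o copairf q (A ⊗ one).
  rewrite pairf_comp tensm_compr -comp_assoc copairf_nat comp_assoc zz.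
  by rewrite comp_idl.
by rewrite (h f) (h g) e.
Qed.

Lemma left_dual_injr X Y A (ev : mor (Y ⊗ X) one) (coev : mor one (X ⊗ Y))
    (f g : mor A X) :
  is_left_dual ev coev -> ev \o (Y ◁ f) = ev \o (Y ◁ g) -> f = g.
Proof. by move=> dY; apply: (fam_copair_inj (q := coev)) => Z; exact: zigzag1.
  Qed.

(** A pairing determines its copairing: insert the zigzag of the dual, then cancel with the one
    assumed for [q]. *)
Lemma copair_unique X Y W (ev : mor (Y ⊗ X) one) (coev : mor one (X ⊗ Y))
    (q : mor one (X ⊗ W)) (h : mor W Y) :
  is_left_dual ev coev ->
  (forall Z, (X ◁ pairf (ev \o (h ▷ X)) Z) \o copairf q (X ⊗ Z) = idm _) ->
  (X ◁ h) \o q = coev.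
Proof.
move=> dY zz; apply: copairf_inj; set q' := _ \o q.
have zz' Z : (X ◁ pairf ev Z) \o copairf q' (X ⊗ Z) = idm _.
  rewrite -zz pairf_comp tensm_id tensm_compr -comp_assoc.
  by rewrite /q' copairf_comp.
rewrite -[LHS]comp_idl -[idm _](tensm_id X (Y ⊗ one)) -(zigzag2 one dY).
by rewrite tensm_compr -comp_assoc copairf_nat comp_assoc zz' comp_idl.
Qed.

(** Two caps, the one on [Y] inside the one on [X]; the product of the duals is therefore reversed.
    [conest] is the matching pair of cups. *)
Definition nest X X' Y Y' (p : mor (X ⊗ X') one) (q : mor (Y ⊗ Y') one) :
    mor ((X ⊗ Y) ⊗ (Y' ⊗ X')) one :=
  p \o (X ◁ (lunit X' \o (q ▷ X') \o associ Y Y' X')) \o assoc X Y (Y' ⊗ X').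

Definition conest X X' Y Y' (q : mor one (X ⊗ X')) (r : mor one (Y ⊗ Y')) :
    mor one ((X ⊗ Y) ⊗ (Y' ⊗ X')) :=
  associ X Y (Y' ⊗ X') \o ((X ◁ (assoc Y Y' X' \o ((r ▷ X') \o luniti X')))
    \o q).

Lemma pairf_nest X X' Y Y' (p : mor (X ⊗ X') one) (q : mor (Y ⊗ Y') one) Z :
  pairf (nest p q) Z = pairf p Z \o ((X ◁ pairf q (X' ⊗ Z))
    \o (assoc X Y (Y' ⊗ (X' ⊗ Z)) \o ((X ⊗ Y) ◁ assoc Y' X' Z))).
Proof.
rewrite /nest !pairfE !tensm_compl -?comp_assoc pentagon_mixed.
rewrite (reassoc (esym (associ_nat _ _ _))) -?comp_assoc.
rewrite -(tensm_id X Y) assoc_nat !(comp_assoc (X ◁ _) (X ◁ _)) -!tensm_compr.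
congr (_ \o _); congr (_ \o _); congr (_ \o _); congr (_ \o _); congr (_ ◁ _).
rewrite !tensm_compl -?comp_assoc.
have e : (associ Y Y' X' ▷ Z) \o associ Y (Y' ⊗ X') Z
    = associ (Y ⊗ Y') X' Z \o (associ Y Y' (X' ⊗ Z) \o (Y ◁ assoc Y' X' Z)).
  rewrite comp_assoc pentagon_associ -?comp_assoc -tensm_compr associ_assoc.
  by rewrite tensm_id comp_idr.
rewrite e (reassoc (esym (associ_nat _ _ _))) -?comp_assoc tensm_id.
by rewrite -lunit_tens -?comp_assoc (reassoc (assoc_associ _ _ _)) comp_idl.
Qed.

Lemma nest_comp X X' Y Y' V W (p : mor (V ⊗ X') one) (q : mor (W ⊗ Y') one)
    (f : mor X V) (g : mor Y W) :
  nest (p \o (f ▷ X')) (q \o (g ▷ Y')) = nest p q \o ((f ⊠ g) ▷ (Y' ⊗ X')).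
Proof.
rewrite /nest -?comp_assoc -(tensm_id Y' X') assoc_nat; congr (_ \o _).
rewrite [RHS](comp_assoc (_ ◁ _)) -tensm_comp comp_idl.
rewrite (comp_assoc (f ▷ X')) -tensm_comp comp_idl comp_idr.
by rewrite -?comp_assoc associ_nat tensm_compl -?comp_assoc.
Qed.

Lemma copairf_conest X X' Y Y' (q : mor one (X ⊗ X')) (r : mor one (Y ⊗ Y')) Z :
  (X ◁ (Y ◁ assoc Y' X' Z)) \o (assoc X Y ((Y' ⊗ X') ⊗ Z) \o copairf
    (conest q r) Z)
  = (X ◁ copairf r (X' ⊗ Z)) \o copairf q Z.
Proof.
rewrite /conest (copairfE _ Z) !tensm_compl -?comp_assoc.
rewrite (comp_assoc (assoc X Y _)) pentagon_assoc -?comp_assoc.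
rewrite (comp_assoc (assoc X Y _ ▷ Z)) -tensm_compl assoc_associ tensm_id
  comp_idl.
rewrite (comp_assoc (assoc X (Y ⊗ _) Z)) assoc_nat -?comp_assoc -(copairfE q Z).
rewrite (comp_assoc (X ◁ assoc _ _ _)) (comp_assoc (X ◁ (Y ◁ _))) -!tensm_compr.
congr (_ \o _); congr (_ ◁ _); rewrite !tensm_compl -?comp_assoc.
rewrite (comp_assoc (assoc Y (Y' ⊗ X') Z)) (comp_assoc (Y ◁ _)) -pentagon_assoc.
rewrite -?comp_assoc (comp_assoc (assoc _ X' Z)) assoc_nat tensm_id
  -?comp_assoc.
by rewrite luniti_tens (reassoc (assoc_associ _ _ _)) comp_idl copairfE.
Qed.

Lemma conest_zigzag X X' Y Y' (p : mor (X' ⊗ X) one) (q : mor one (X ⊗ X'))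
    (p' : mor (Y' ⊗ Y) one) (q' : mor one (Y ⊗ Y')) Z :
  is_left_dual p q -> is_left_dual p' q' ->
  ((X ⊗ Y) ◁ pairf (nest p' p) Z) \o copairf (conest q q') ((X ⊗ Y) ⊗ Z) = idm
    _.
Proof.
move=> dX dY; apply: (iso_cancel_left (assoc_iso X Y Z)).
rewrite comp_idr comp_assoc -{1}(tensm_id X Y) assoc_nat -?comp_assoc.
rewrite pairf_nest !tensm_compr -?comp_assoc.
rewrite (comp_assoc (X ◁ (Y ◁ ((_ ⊗ _) ◁ _)))) -assoc_nat tensm_id -comp_assoc.
rewrite copairf_nat (comp_assoc (assoc X Y _))
  (comp_assoc (X ◁ (Y ◁ assoc _ _ _))).
rewrite copairf_conest -?comp_assoc.
rewrite (comp_assoc (X ◁ (Y ◁ (Y' ◁ _)))) -tensm_compr copairf_nat tensm_compr.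
rewrite -?comp_assoc (comp_assoc (X ◁ pairf p _)) (zigzag1 _ dX) comp_idl.
by rewrite (comp_assoc (X ◁ _)) -tensm_compr (zigzag1 _ dY) tensm_id comp_idl.
Qed.

End Duals.

(** The cap on the other side of [X]: the pivotal structure turns the left dual into a right dual.
    Together with [coev] it closes a strand into a loop. *)
HB.lock Definition piv (K : fieldType) (C : moncat K) (d : left_duality C)
    (a : forall X : C, mor X (ldual d (ldual d X))) (X : C) :
    mor (X ⊗ ldual d X) one := ev d (ldual d X) \o (a X ▷ ldual d X).

Section Duality.
Variables (K : fieldType) (C : moncat K) (d : left_duality C).
Implicit Types X Y Z A B W V : C.
Local Notation "X ^*" := (ldual d X) : cat_scope.

Lemma mateK A X (p : mor (A ⊗ X) one) : ev d X \o (mate d p ▷ X) = p.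
Proof.
apply: pairf_inj; rewrite pairf_comp tensm_id /mate mate_fam comp_assoc.
rewrite pairf_nat -comp_assoc -tensm_compr (zigzag1 _ (dualP d X)).
by rewrite tensm_id comp_idr.
Qed.

Lemma dualmK X Y (f : mor X Y) : ev d X \o (dualm d f ▷ X) = ev d Y
  \o (Y^* ◁ f).
Proof. exact: mateK. Qed.

Lemma dual_tensK X Y :
  ev d (X ⊗ Y) \o (dual_tens d X Y ▷ (X ⊗ Y)) = nest (ev d Y) (ev d X).
Proof. exact: mateK. Qed.

Lemma coev_dualm X Y (f : mor X Y) :
  (f ▷ X^*) \o coev d X = (Y ◁ dualm d f) \o coev d Y.
Proof.
apply: copairf_inj; rewrite !copairf_comp tensm_id /dualm /mate mate_fam.
rewrite pairf_comp -(comp_assoc (pairf _ _)) -tensm_compr tensm_compr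
  -comp_assoc.
rewrite copairf_nat comp_assoc.
by rewrite (zigzag1 _ (dualP d Y)) comp_idl.
Qed.

Lemma coev_tens X Y :
  ((X ⊗ Y) ◁ dual_tens d X Y) \o conest (coev d X) (coev d Y) = coev d (X ⊗ Y).
Proof.
apply: (copair_unique (dualP d (X ⊗ Y))) => Z; rewrite dual_tensK.
exact: conest_zigzag (dualP d X) (dualP d Y).
Qed.

Section Pivotal.
Variables (a : forall X, mor X (ldual d (ldual d X))) (a_pivotal : pivotal a).

Local Notation piv := (piv a).

Lemma pivE X : piv X = ev d X^* \o (a X ▷ X^*).
Proof. by rewrite unlock. Qed.

(** Naturality of [a] lets a morphism slide around the cap [piv]; with [coev_dualm], which slides it
    around a cup, this gives cyclicity of the trace. *)
Lemma piv_dualm X Y (f : mor X Y) : piv Y \o (f ▷ Y^*) = piv X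
  \o (X ◁ dualm d f).
Proof.
case: a_pivotal => _ a_nat _.
rewrite !pivE -?comp_assoc -tensm_compl -a_nat tensm_compl comp_assoc dualmK.
by rewrite -?comp_assoc whiskerC.
Qed.

Lemma piv_tens X Y :
  piv (X ⊗ Y) \o ((X ⊗ Y) ◁ dual_tens d X Y) = nest (piv X) (piv Y).
Proof.
case: a_pivotal => _ _ a_tens.
rewrite !pivE -?comp_assoc whiskerC comp_assoc -dualmK -?comp_assoc
  -tensm_compl.
by rewrite a_tens tensm_compl comp_assoc dual_tensK nest_comp.
Qed.

End Pivotal.

End Duality.

(** * Naturality and balancing of the twist *)

Section Twist.
Variables (K : fieldType) (C : brcat K) (d : left_duality C).
Implicit Types X Y Z A B W V : C.
Local Notation "X ^*" := (ldual d X) : cat_scope.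

(** The geometric core of balancing: once the double crossing of [X] and [Y] is inserted, passing
    both strands across their duals untangles into two nested curls, because a strand can be pulled
    across a cap. *)
Lemma nest_braid X X' Y Y' (p : mor (X' ⊗ X) one) (q : mor (Y' ⊗ Y) one) :
  nest q p \o (braid (X ⊗ Y) (Y' ⊗ X')
    \o ((braid Y X \o braid X Y) ▷ (Y' ⊗ X')))
  = nest (p \o braid X X') (q \o braid Y Y').
Proof.
pose r := nest (p \o braid X X') (q \o braid Y Y').
pose l := nest q p \o (braid (X ⊗ Y) (Y' ⊗ X')
    \o ((braid Y X \o braid X Y) ▷ (Y' ⊗ X'))).
suff h Z : pairf l Z = pairf r Z by apply: pairf_inj; apply: h.
rewrite {}/l {}/r comp_assoc pairf_comp pairf_fam2 -crE tensm_id !pairf_nest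
  -?comp_assoc.
rewrite (pairf_fam2 p) (pairf_fam2 q) -!crE.
rewrite -(tensm_id Y' X') (reassoc (assoc_nat _ _ _)) -?comp_assoc.
rewrite (reassoc (cr_hexagon _ _ _ _)) -?comp_assoc.
rewrite (comp_assoc (Y' ◁ (X' ◁ _))) -tensm_compr cr_hexagoni !tensm_compr
  -?comp_assoc.
rewrite -whiskerC -(tensm_id Y' (X' ⊗ Z)) (comp_assoc (cr _ _ _) (_ ⊠ _)) cr_nat
  -?comp_assoc.
have e T : assoc X Y T \o ((braid Y X \o braid X Y) ▷ T)
    = cr Y X T \o (cr X Y T \o assoc X Y T).
  rewrite !crE !fam2E -?comp_assoc associ_assoc comp_idr.
  by rewrite (reassoc (associ_assoc _ _ _)) comp_idl tensm_compl.
rewrite (comp_assoc (Y' ◁ assoc _ _ _)) -tensm_compr e !tensm_compr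
  -?comp_assoc.
rewrite (comp_assoc (Y' ◁ assoc _ _ _)) cr_hexagoni -?comp_assoc.
have h0 : pairf p (Y ⊗ Z) \o (cr X X' (Y ⊗ Z)
    \o ((X ◁ cr Y X' Z) \o cr Y X (X' ⊗ Z))) = Y ◁ (pairf p Z \o cr X X' Z).
  by rewrite comp_assoc !(crE X X') -!pairf_fam2 pull_pair_right.
have h T (k : mor T _) : (Y' ◁ pairf p (Y ⊗ Z)) \o ((Y' ◁ cr X X' (Y ⊗ Z))
      \o ((Y' ◁ (X ◁ cr Y X' Z)) \o ((Y' ◁ cr Y X (X' ⊗ Z)) \o k)))
    = (Y' ◁ (Y ◁ (pairf p Z \o cr X X' Z))) \o k.
  by rewrite -h0 !tensm_compr -?comp_assoc.
rewrite h comp_assoc -pairf_nat -?comp_assoc; congr (_ \o _); congr (_ \o _).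
by rewrite (comp_assoc (Y' ◁ _)) (comp_assoc (pairf _ _)) pull_pair_right.
Qed.

Variables (a : forall X, mor X (ldual d (ldual d X))) (a_pivotal : pivotal a).
Variables (theta : forall X, mor X X) (theta_twist : is_twist a theta).

Lemma piv_twist X : piv a X = ev d X \o (braid X X^* \o (theta X ▷ X^*)).
Proof.
by rewrite pivE theta_twist tensm_compl comp_assoc mateK -comp_assoc.
Qed.

(** Naturality is transferred from [a] by testing against the nondegenerate evaluation, where the
    Drinfeld isomorphism becomes a crossing. *)
Lemma twist_nat X Y (f : mor X Y) : theta Y \o f = f \o theta X.
Proof.
apply: (left_dual_injr (dualP d Y)).
apply: (iso_cancel_right (braid_iso _ _)); rewrite -?comp_assoc -!braid_nat.
rewrite !tensm_compl !comp_assoc -(comp_assoc (ev d Y)) -piv_twist.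
rewrite (piv_dualm a_pivotal) piv_twist -?comp_assoc whiskerC.
rewrite (comp_assoc (braid _ _)) braid_nat !comp_assoc dualmK.
by rewrite -?comp_assoc (comp_assoc (Y^* ◁ f)) -braid_nat -?comp_assoc.
Qed.

(** Both sides are tested against the nested evaluation. Through [piv_twist], [piv_tens] relates the
    twist of the product to the two separate twists, and [nest_braid] supplies the double
    crossing. *)
Lemma balancing X Y :
  theta (X ⊗ Y) = braid Y X \o braid X Y \o (theta X ⊠ theta Y).
Proof.
apply: (fam_copair_inj (p := nest (ev d Y) (ev d X))) => [Z|].
  exact: conest_zigzag (dualP d X) (dualP d Y).
apply: (iso_cancel_right (braid_iso _ _)); rewrite -?comp_assoc -!braid_nat.
rewrite (tensm_compl _ (braid Y X)) tensm_compl.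
have /esym := piv_tens a_pivotal X Y; rewrite !piv_twist.
rewrite !(comp_assoc _ (braid _ _)) !nest_comp -nest_braid -?comp_assoc.
rewrite whiskerC (comp_assoc (braid _ _) (_ ◁ dual_tens _ _ _)) braid_nat
  !comp_assoc dual_tensK.
by rewrite tensm_compl !comp_assoc => ->.
Qed.

End Twist.

(** * Schur's lemma and dimensions of Hom spaces *)

Import VectorInternalTheory.

Section LinearMaps.
Variable K : fieldType.
Implicit Types V W : vectType K.

Lemma dim_biproduct V n (W : 'I_n -> vectType K)
    (i : forall k, {linear W k -> V}) (p : forall k, {linear V -> W k}) :
  (forall k w, p k (i k w) = w) ->
  (forall j k w, j != k -> p j (i k w) = 0) ->
  (forall v, \sum_k i k (p k v) = v) ->
  \dim {: V} = (\sum_k \dim {: W k})%N.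
Proof.
move=> pi1 pi0 ip1.
pose U k := limg (linfun (i k)).
have Ui k u : u \in U k -> exists w, u = i k w.
  by case/memv_imgP=> w _ ->; exists w; rewrite lfunE.
have dU : directv (\sum_k U k)%VS.
  apply/directv_sum_independent => us Uus us0 k _.
  have [w uk] := Ui k _ (Uus k isT).
  move/(congr1 (p k)): us0; rewrite linear0 linear_sum (bigD1 k) //= big1.
    by rewrite addr0 uk pi1 => ->; rewrite linear0.
  by move=> j jk; have [w' ->] := Ui j _ (Uus j isT); rewrite pi0 // eq_sym.
have -> : {: V}%VS = (\sum_k U k)%VS.
  apply/eqP; rewrite eqEsubv subvf andbT; apply/subvP => v _.
  rewrite -(ip1 v); apply: memv_sumr => k _.
  by rewrite -[i k _](lfunE (i k)); apply: memv_img; apply: memvf.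
rewrite (directvP dU) /=; apply: eq_bigr => k _; apply: limg_dim_eq.
apply/eqP; rewrite capfv; apply/lker0P => w w'; rewrite !lfunE /=.
by move/(congr1 (p k)); rewrite !pi1.
Qed.

Lemma dim_bij V W (f : {linear V -> W}) (g : {linear W -> V}) :
  cancel f g -> cancel g f -> \dim {: V} = \dim {: W}.
Proof.
move=> fK gK; rewrite (@dim_biproduct V 1 (fun=> W) (fun=> g) (fun=> f)).
- by rewrite big_ord1.
- by [].
- by move=> j k; rewrite !ord1.
- by move=> v; rewrite big_ord1 fK.
Qed.

(** Matrices act on row vectors, so a product of such matrices represents the composite in the
    opposite order. *)
Definition vmx V (f : V -> V) := lin1_mx (v2r \o f \o r2v)%FUN.

Lemma mul_vmx V (f : {linear V -> V}) u : u *m vmx f = v2r (f (r2v u)).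
Proof. by rewrite (mul_rV_lin1 (v2r \o f \o r2v)%FUN). Qed.

End LinearMaps.

Lemma linear_eigenvector (K : numClosedFieldType) (V : vectType K)
    (f : {linear V -> V}) (v0 : V) : v0 != 0 ->
  exists c v, v != 0 /\ f v = c *: v.
Proof.
move=> v0_neq0; have n_gt0 : (0 < dim V)%N.
  rewrite lt0n -dimvf; apply: contra_neq v0_neq0 => /eqP.
  by rewrite dimv_eq0 => /eqP V0; apply/eqP; rewrite -memv0 -V0 memvf.
have [c /eigenvalueP[v]] := eigenvalue_closed (vmx f) n_gt0.
rewrite mul_vmx => fv v_neq0; exists c, (r2v v); split.
  by apply: contra_neq v_neq0 => vz; rewrite -[v]r2vK vz linear0.
by rewrite -[f _]v2rK fv linearZZ.
Qed.

Section Semisimple.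
Variables (K : numClosedFieldType) (C : lincat K).
Hypothesis abC : abelian_category C.
Implicit Types X Y Z S : C.

Lemma direct_sum_idm0 (Y : 'I_0 -> C) X : direct_sum Y X -> idm X = 0.
Proof. by move=> [i [p [_ _ <-]]]; rewrite big_ord0. Qed.

Lemma zero_objectP X : zero_object X <-> idm X = 0.
Proof.
split=> [z|X0 Y]; first by case: (z X).
split=> f; first by rewrite -[f]comp_idr X0 comp0r.
by rewrite -[f]comp_idl X0 comp0l.
Qed.

Lemma idm_simple X : simple X -> idm X != 0.
Proof. by case=> nz _; apply/eqP => /zero_objectP. Qed.

Lemma schur_iso X Y (f : mor X Y) : simple X -> simple Y -> f != 0 -> iso f.
Proof.
move=> sX [_ sY] f_neq0; have [Z [k [fk0 ku]]] := abelian_ker abC f.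
have mk : Defs.monic k.
  move=> W g h e; have [w [_ wu]] : exists! w, k \o w = k \o g.
    by apply: ku; rewrite comp_assoc fk0 comp0l.
  by rewrite -(wu g erefl) (wu h (esym e)).
have [zZ|[k' [_ kk']]] := sX.2 Z k mk; last first.
  by case/eqP: f_neq0; rewrite -[f]comp_idr -kk' comp_assoc fk0 comp0l.
have [zX|//] : zero_object X \/ iso f; last by case: sX.1.
apply: sY => W g h e; apply/eqP; rewrite -subr_eq0; apply/eqP.
have [w [<- _]] : exists! w, k \o w = g - h by apply: ku; rewrite compBr e
  subrr.
by case: (zZ W) => _ /(_ w) ->; rewrite comp0r.
Qed.

Lemma simple_isomorphic X Y : isomorphic X Y -> simple X -> simple Y.
Proof.
move=> [f [g [gf fg]]] [nzX sX]; split.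
  move=> /zero_objectP Y0; apply: nzX; apply/zero_objectP.
  by rewrite -gf -[f]comp_idl Y0 comp0l comp0r.
move=> Z h mh; have [|//|[k [k1 k2]]] := sX Z (g \o h).
- move=> W u v; rewrite -!comp_assoc => e; apply: mh.
  by move/(congr1 (comp f)): e; rewrite !(reassoc fg) !comp_idl.
- by left.
right; exists (k \o g); split; first by rewrite -comp_assoc.
by rewrite -[RHS]fg -[in RHS](comp_idl g) -k2 -!comp_assoc (reassoc fg)
  comp_idl.
Qed.

(** Left composition with [f] on the endomorphisms of [X] has an eigenvector [v]; then [f - c] kills
    a nonzero morphism, so it is not invertible and must vanish. *)
Lemma schur_scalar X (f : mor X X) : simple X -> exists c, f = c *: idm X.
Proof.
move=> sX; have [c [v [v_neq0 fv]]] := linear_eigenvector (comp f)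
  (idm_simple sX).
exists c; apply/eqP; rewrite -subr_eq0; apply: contraNT v_neq0.
case/(schur_iso sX sX) => g [gf _]; rewrite -[v]comp_idl -gf -comp_assoc.
by rewrite compBl fv compZl comp_idl subrr comp0r.
Qed.

Lemma endo_scalarZ X c : idm X != 0 -> endo_scalar (c *: idm X) = c.
Proof.
move=> X_neq0; have fX : free [tuple idm X] by rewrite free_cons span_nil memv0
  X_neq0 nil_free.
have /= e := coord_free ord0 ord0 fX; by rewrite /endo_scalar linearZ /= e
  mulr1.
Qed.

Lemma endo_scalarE X (f : mor X X) : simple X -> f = endo_scalar f *: idm X.
Proof.
move=> sX; have [c ->] := schur_scalar f sX.
by rewrite endo_scalarZ // idm_simple.
Qed.

Lemma dim_endo_simple X : simple X -> \dim {: mor X X} = 1%N.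
Proof.
move=> sX; have -> : {: mor X X}%VS = <[idm X]>%VS.
  apply/eqP; rewrite eqEsubv subvf andbT; apply/subvP => f _.
  by apply/vlineP; apply: schur_scalar.
by rewrite dim_vline idm_simple.
Qed.

Lemma dim_hom_simple0 X Y : simple X -> simple Y -> ~ isomorphic X Y ->
  \dim {: mor X Y} = 0%N.
Proof.
move=> sX sY nXY; apply/eqP; rewrite dimv_eq0 -subv0; apply/subvP => f _.
rewrite memv0; apply/negP => /negP/(schur_iso sX sY) i; apply: nXY.
by exists f.
Qed.

Lemma dim_isol X Y Z : isomorphic X Y -> \dim {: mor X Z} = \dim {: mor Y Z}.
Proof.
move=> [f [g [gf fg]]].
apply: (@dim_bij _ _ _ (precomp g) (precomp f)) => h; rewrite /= /precomp
  -comp_assoc.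
  by rewrite gf comp_idr.
by rewrite fg comp_idr.
Qed.

Lemma dim_isor X Y Z : isomorphic X Y -> \dim {: mor Z X} = \dim {: mor Z Y}.
Proof.
move=> [f [g [gf fg]]].
apply: (@dim_bij _ _ _ (comp f) (comp g)) => h /=; rewrite comp_assoc.
  by rewrite gf comp_idl.
by rewrite fg comp_idl.
Qed.

Lemma dim_sumr n (Y : 'I_n -> C) X Z : direct_sum Y X ->
  \dim {: mor Z X} = (\sum_k \dim {: mor Z (Y k)})%N.
Proof.
move=> [i [p [pi1 pi0 ip1]]].
apply: (dim_biproduct (i := fun k => comp (i k)) (p := fun k => comp (p k))).
- by move=> k f /=; rewrite comp_assoc pi1 comp_idl.
- by move=> j k f jk /=; rewrite comp_assoc pi0 // comp0l.
- move=> f /=; rewrite -[RHS]comp_idl -ip1 comp_suml.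
  by apply: eq_bigr => k _; rewrite comp_assoc.
Qed.

Lemma dim_suml n (Y : 'I_n -> C) X Z : direct_sum Y X ->
  \dim {: mor X Z} = (\sum_k \dim {: mor (Y k) Z})%N.
Proof.
move=> [i [p [pi1 pi0 ip1]]].
apply: (dim_biproduct (i := fun k => precomp (p k))
  (p := fun k => precomp (i k))).
- by move=> k f /=; rewrite /precomp -comp_assoc pi1 comp_idr.
- by move=> j k f jk /=; rewrite /precomp -comp_assoc pi0 1?eq_sym // comp0r.
- move=> f /=; rewrite -[RHS]comp_idr -ip1 comp_sumr.
  by apply: eq_bigr => k _; rewrite /precomp comp_assoc.
Qed.

Lemma direct_sum_iso n (Y Y' : 'I_n -> C) X :
  (forall k, isomorphic (Y k) (Y' k)) -> direct_sum Y X -> direct_sum Y' X.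
Proof.
move=> /fin_all_exists[f] /fin_all_exists[g] fg [i [p [pi1 pi0 ip1]]].
exists (fun k => i k \o g k), (fun k => f k \o p k); split.
- move=> k; rewrite -comp_assoc (reassoc (pi1 k)) comp_idl.
  by case: (fg k).
- by move=> j k jk; rewrite -comp_assoc (reassoc (pi0 j k jk)) comp0l comp0r.
- rewrite -ip1; apply: eq_bigr => k _; rewrite -comp_assoc.
  by case: (fg k) => gf _; rewrite (reassoc gf) comp_idl.
Qed.

Lemma direct_sum1 X Y : isomorphic X Y -> direct_sum (fun _ : 'I_1 => X) Y.
Proof.
move=> [f [g [gf fg]]]; exists (fun=> f), (fun=> g); split=> //.
  by move=> j k; rewrite !ord1.
by rewrite big_ord1.
Qed.

(* The kernel of 1 - e splits e. *)
Lemma split_idempotent X (e : mor X X) : e \o e = e ->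
  exists W (i : mor W X) (p : mor X W), p \o i = idm W /\ i \o p = e.
Proof.
move=> ee; have [W [i [ei ku]]] := abelian_ker abC (idm X - e).
have [p [ip _]] : exists! p, i \o p = e.
  by apply: ku; rewrite compBl comp_idl ee subrr.
exists W, i, p; split=> //.
have ei' : e \o i = i.
  by move/eqP: ei; rewrite compBl comp_idl subr_eq0 => /eqP.
have [w [_ wu]] := ku W i ei.
have <- : w = p \o i by apply: wu; rewrite comp_assoc ip.
by apply: wu; rewrite comp_idr.
Qed.

End Semisimple.

Lemma dim_left_dual (K : numClosedFieldType) (C : moncat K) (X Y : C)
    (ev : mor (Y ⊗ X) one) (coev : mor one (X ⊗ Y)) (A B : C) :
  is_left_dual ev coev ->
  \dim {: mor A (X ⊗ B)} = \dim {: mor (Y ⊗ A) B}.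
Proof.
move=> dXY.
apply: (dim_bij (f := (comp (pairf ev B) \o tensm (idm Y))%FUN)
  (g := (precomp (copairf coev A) \o tensm (idm X))%FUN)) => f /=; rewrite
    /precomp.
  by rewrite tensm_compr -comp_assoc copairf_nat comp_assoc (zigzag1 _ dXY)
    comp_idl.
by rewrite tensm_compr comp_assoc -pairf_nat -comp_assoc (zigzag2 _ dXY)
  comp_idr.
Qed.

(** * Traces and loops *)

Section Traces.
Variables (K : numClosedFieldType) (C : brcat K) (d : left_duality C).
Variables (a : forall X, mor X (ldual d (ldual d X))) (a_pivotal : pivotal a).
Hypotheses (one_neq0 : idm (one : C) != 0)
  (one_scalar : forall f : mor (one : C) one, exists c, f = c *: idm one).
Implicit Types X Y Z A B W V : C.
Local Notation "X ^*" := (ldual d X) : cat_scope.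
Local Notation piv := (piv a).

Definition tr X (f : mor X X) : K :=
  endo_scalar (piv X \o ((f ▷ X^*) \o coev d X)).

Lemma qdimE X : qdim a X = tr (idm X).
Proof. by rewrite /tr tensm_id comp_idl pivE. Qed.

Lemma trD X (f g : mor X X) : tr (f + g) = tr f + tr g.
Proof.
rewrite /tr -[f]scale1r -[1 *: f + g]/(1 *: f + g) tensm_linl !scale1r.
by rewrite compDl compDr /endo_scalar linearD.
Qed.

Lemma trZ X c (f : mor X X) : tr (c *: f) = c * tr f.
Proof. by rewrite /tr tensmZl compZl compZr /endo_scalar linearZ. Qed.

Lemma tr_sum X I r (P : pred I) (f : I -> mor X X) :
  tr (\sum_(i <- r | P i) f i) = \sum_(i <- r | P i) tr (f i).
Proof.
by rewrite /tr tensm_suml comp_suml comp_sumr /endo_scalar linear_sum.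
Qed.

(** Endomorphisms of the unit are scalars, so a closed diagram can be pulled out of any word as a
    number. *)
Lemma tr_fam X (f : mor X X) Z :
  pairf (piv X) Z \o ((f ▷ (X^* ⊗ Z)) \o copairf (coev d X) Z) = tr f *: idm Z.
Proof.
have -> : (f ▷ (X^* ⊗ Z)) \o copairf (coev d X) Z
    = copairf ((f ▷ X^*) \o coev d X) Z by rewrite copairf_comp tensm_id.
have [c e] := one_scalar (piv X \o ((f ▷ X^*) \o coev d X)).
rewrite pair_copair /tr e.
rewrite endo_scalarZ // tensmZl tensm_id compZl compZr comp_idl.
by rewrite lunit_luniti.
Qed.

Lemma tr_comp X W (f : mor X W) (g : mor W X) : tr (g \o f) = tr (f \o g).
Proof.
rewrite /tr; congr endo_scalar; rewrite !tensm_compl -?comp_assoc coev_dualm.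
rewrite (comp_assoc (g ▷ _)) whiskerC -?comp_assoc (comp_assoc (piv X)).
by rewrite -(piv_dualm a_pivotal) -?comp_assoc.
Qed.

Definition ptr X Y V (f : mor (X ⊗ V) (Y ⊗ V)) : mor X Y :=
  runit Y \o (Y ◁ piv V) \o assoc Y V V^* \o (f ▷ V^*) \o associ X V V^*
    \o (X ◁ coev d V) \o runiti X.

Lemma ptrE X Y V (f : mor (X ⊗ V) (Y ⊗ V)) Z :
  ptr f ▷ Z = (Y ◁ pairf (piv V) Z)
    \o (fam2 f (V^* ⊗ Z) \o (X ◁ copairf (coev d V) Z)).
Proof. exact: ptr_fam. Qed.

Lemma ptr_id X V : ptr (idm (X ⊗ V)) = qdim a V *: idm X.
Proof.
apply: tensm_one_injr; rewrite ptrE fam2_id comp_idl -tensm_compr.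
rewrite -[copairf _ _]comp_idl -(tensm_id V (V^* ⊗ one)) tr_fam -qdimE.
by rewrite tensmZr tensmZl.
Qed.

(** By [piv_tens] and [coev_tens] a product is closed by nested arcs, so the inner strand [V] can be
    closed first. *)
Lemma tr_tens X V (f : mor (X ⊗ V) (X ⊗ V)) : tr f = tr (ptr f).
Proof.
suff h Z : tr f *: idm Z = tr (ptr f) *: idm Z.
  by rewrite -(endo_scalarZ (tr f) one_neq0) h endo_scalarZ.
rewrite -!tr_fam ptrE -coev_tens copairf_comp.
rewrite (comp_assoc (f ▷ _)) whiskerC -?comp_assoc (comp_assoc (pairf _ _)).
rewrite -pairf_comp (piv_tens a_pivotal) pairf_nest -?comp_assoc.
rewrite (comp_assoc ((X ⊗ V) ◁ _)) -whiskerC -?comp_assoc.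
congr (_ \o _); congr (_ \o _).
have e T : assoc X V T \o (f ▷ T) = fam2 f T \o assoc X V T.
  by rewrite fam2E -?comp_assoc associ_assoc comp_idr.
rewrite (comp_assoc (assoc _ _ _)) e -?comp_assoc; congr (_ \o _).
by rewrite -copairf_conest (comp_assoc (assoc _ _ _)) -(tensm_id X V) assoc_nat
  -comp_assoc.
Qed.

Lemma qdim_tens X V : qdim a (X ⊗ V) = qdim a X * qdim a V.
Proof. by rewrite qdimE tr_tens ptr_id trZ -qdimE mulrC. Qed.

Lemma tr_direct_sum n (Y : 'I_n -> C) X (i : forall k, mor (Y k) X)
    (p : forall k, mor X (Y k)) (f : mor X X) :
  \sum_k (i k \o p k) = idm X -> tr f = \sum_k tr (p k \o (f \o i k)).
Proof.
move=> ip1; rewrite -[f in LHS]comp_idr -ip1 comp_sumr tr_sum.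
by apply: eq_bigr => k _; rewrite comp_assoc tr_comp.
Qed.

Lemma qdim_sum n (Y : 'I_n -> C) X : direct_sum Y X ->
  qdim a X = \sum_k qdim a (Y k).
Proof.
move=> [i [p [pi1 _ ip1]]]; rewrite qdimE (tr_direct_sum _ ip1).
by apply: eq_bigr => k _; rewrite comp_idl pi1 qdimE.
Qed.

(* The endomorphism of Y obtained by encircling Y with a loop labelled V and
   decorated with h. *)
Definition loop V Y (h : mor V V) : mor Y Y :=
  ptr ((Y ◁ h) \o (braid V Y \o braid Y V)).

Lemma loopE V Y h Z : loop Y h ▷ Z
  = (Y ◁ pairf (piv V) Z) \o ((Y ◁ (h ▷ (V^* ⊗ Z))) \o (cr V Y (V^* ⊗ Z)
     \o (cr Y V (V^* ⊗ Z) \o (Y ◁ copairf (coev d V) Z)))).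
Proof.
by rewrite /loop ptrE !fam2_comp fam2_tens -!crE -!comp_assoc.
Qed.

(** The decoration travels around the loop, through both crossings, by naturality. Hence a loop can
    be evaluated on the summands of its label. *)
Lemma loop_comp V W Y (f : mor V W) (g : mor W V) :
  loop Y (g \o f) = loop Y (f \o g).
Proof.
suff h Z : loop Y (g \o f) ▷ Z = loop Y (f \o g) ▷ Z by apply/tensm_one_injr/h.
have cr2 X X' T T' (u : mor X X') (v : mor T T') S (k : mor S _) :
    (Y ◁ (u ⊠ v)) \o (cr X Y T \o (cr Y X T \o k))
    = cr X' Y T' \o (cr Y X' T' \o ((Y ◁ (u ⊠ v)) \o k)).
  by rewrite (comp_assoc (Y ◁ _)) -cr_nat -?comp_assoc (comp_assoc (u ⊠ _))
    -cr_nat -?comp_assoc.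
have cupV : (f ▷ (V^* ⊗ Z)) \o copairf (coev d V) Z
    = (W ◁ (dualm d f ▷ Z)) \o copairf (coev d W) Z.
  by rewrite -(tensm_id V^* Z) -copairf_comp coev_dualm copairf_comp.
have capW : pairf (piv V) Z \o (V ◁ (dualm d f ▷ Z))
    = pairf (piv W) Z \o (f ▷ (W^* ⊗ Z)).
  by rewrite -pairf_comp -(piv_dualm a_pivotal) pairf_comp tensm_id.
rewrite !loopE !tensm_compl !tensm_compr -?comp_assoc cr2.
rewrite -[(Y ◁ (f ▷ _)) \o (Y ◁ _)]tensm_compr cupV tensm_compr -cr2.
rewrite (comp_assoc (Y ◁ (g ▷ _))) -(tensm_compr Y (g ▷ _)) whiskerC
  tensm_compr.
rewrite -?comp_assoc (comp_assoc (Y ◁ pairf _ _)) -tensm_compr capW.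
by rewrite tensm_compr -?comp_assoc.
Qed.

Lemma loop_sum V Y I r (P : pred I) (h : I -> mor V V) :
  loop Y (\sum_(i <- r | P i) h i) = \sum_(i <- r | P i) loop Y (h i).
Proof.
by rewrite /loop tensm_sumr comp_suml /ptr tensm_suml !(comp_sumr, comp_suml).
Qed.

Lemma loop_direct_sum n (V : 'I_n -> C) X Y : direct_sum V X ->
  loop Y (idm X) = \sum_k loop Y (idm (V k)).
Proof.
move=> [i [p [pi1 _ ip1]]]; rewrite -ip1 loop_sum.
by apply: eq_bigr => k _; rewrite loop_comp pi1.
Qed.

Lemma loop_transparent V Y : braid V Y \o braid Y V = idm (Y ⊗ V) ->
  loop Y (idm V) = qdim a V *: idm Y.
Proof. by move=> c1; rewrite /loop c1 tensm_id comp_idl ptr_id. Qed.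

(** The label [X ⊗ V] gives two parallel loops; the one labelled [V] contracts to the scalar [c] and
    leaves the one labelled [X]. *)
Lemma loop_tens X V Y c : loop Y (idm V) = c *: idm Y ->
  loop Y (idm (X ⊗ V)) = c *: loop Y (idm X).
Proof.
move=> loopV.
suff h Z : loop Y (idm (X ⊗ V)) ▷ Z = (c *: loop Y (idm X)) ▷ Z.
  exact/tensm_one_injr/h.
have cr2 U T T' (v : mor T T') S (k : mor S _) :
    (Y ◁ (U ◁ v)) \o (cr U Y T \o (cr Y U T \o k))
    = cr U Y T' \o (cr Y U T' \o ((Y ◁ (U ◁ v)) \o k)).
  by rewrite (comp_assoc (Y ◁ _)) -cr_nat -?comp_assoc (comp_assoc (U ◁ _))
    -cr_nat -?comp_assoc.
have loopE1 U T : loop Y (idm U) ▷ T = (Y ◁ pairf (piv U) T)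
    \o (cr U Y (U^* ⊗ T) \o (cr Y U (U^* ⊗ T) \o (Y ◁ copairf (coev d U) T))).
  by rewrite loopE !tensm_id comp_idl.
rewrite loopE1 -coev_tens copairf_comp tensm_compr.
rewrite -cr2 (comp_assoc (Y ◁ pairf _ _)) -tensm_compr -pairf_comp.
rewrite (piv_tens a_pivotal) pairf_nest !tensm_compr -?comp_assoc.
rewrite cr2.
rewrite (comp_assoc (Y ◁ assoc _ _ _)) cr_hexagoni -?comp_assoc.
rewrite (comp_assoc (assoc _ _ _)) cr_hexagon -?comp_assoc.
rewrite -(tensm_compr _ ((X ⊗ V) ◁ _)) -(tensm_compr _ (assoc _ _ _)).
rewrite (comp_assoc (assoc _ _ _) (_ ◁ _)) -(tensm_id X V) assoc_nat
  -?comp_assoc.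
rewrite copairf_conest tensm_compr (comp_assoc (cr Y X _)) cr_nat -?comp_assoc.
rewrite (comp_assoc (Y ◁ (X ◁ _))) -cr_nat -?comp_assoc.
have e T (k : mor T _) : (X ◁ (Y ◁ pairf (piv V) (X^* ⊗ Z)))
    \o ((X ◁ cr V Y (V^* ⊗ (X^* ⊗ Z))) \o ((X ◁ cr Y V (V^* ⊗ (X^* ⊗ Z)))
      \o ((X ◁ (Y ◁ copairf (coev d V) (X^* ⊗ Z))) \o k))) = c *: k.
  rewrite !comp_assoc -!tensm_compr -!comp_assoc -loopE1 loopV tensmZl tensm_id.
  by rewrite tensmZr tensm_id compZl comp_idl.
by rewrite e tensmZl !compZr loopE1.
Qed.

Variables (theta : forall X, mor X X) (theta_twist : is_twist a theta).

(** Closing one strand of a self-crossing leaves a curl; writing the cap as in [piv_twist] undoes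
    the curl at the price of [theta]. *)
Lemma ptr_braid X : ptr (braid X X) = theta X.
Proof.
suff h Z : ptr (braid X X) ▷ Z = theta X ▷ Z by apply/tensm_one_injr/h.
rewrite ptrE (piv_twist theta_twist) (comp_assoc (ev d X)) pairf_comp pairf_fam2
  -!crE tensm_id.
rewrite !tensm_compr -?comp_assoc (comp_assoc (X ◁ (_ ▷ _))) -cr_nat
  -?comp_assoc.
rewrite tensm_id whiskerC (comp_assoc (cr _ _ _)) (comp_assoc (X ◁ cr _ _ _)).
rewrite pull_copair_right comp_assoc.
by rewrite (zigzag1 _ (dualP d X)) comp_idl.
Qed.

End Traces.

(** * Twists are roots of unity *)

(** Every root of the characteristic polynomial is [1] or [t]. The bound on [k] is what later keeps
    a difference of exponents positive. *)
Lemma det_two_eigenvalues (K : numClosedFieldType) n (A : 'M[K]_n) t :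
  (A - 1%:M) *m (A - t%:M) = 0 -> exists2 k, (k <= n)%N & \det A = t ^+ k.
Proof.
move=> A0; have [r chA] := closed_field_poly_normal (char_poly A).
rewrite (monicP (char_poly_monic A)) scale1r in chA.
have szr : size r = n.
  by have := size_char_poly A; rewrite chA size_prod_XsubC => -[].
have rP z : z \in r -> (z == 1) || (z == t).
  rewrite -root_prod_XsubC -chA -eigenvalue_root_char => /eigenvalueP[v vA v0].
  have /eqP := congr1 (mulmx v) A0; rewrite mulmx0 mulmxA (mulmxBr v A) vA
    mulmx1.
  rewrite -[X in _ - X]scale1r -scalerBl -scalemxAl mulmxBr vA mul_mx_scalar
    -scalerBl.
  by rewrite scalerA scaler_eq0 mulf_eq0 !subr_eq0 (negPf v0) orbF.
have -> : \det A = \prod_(z <- r) z.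
  have := char_poly_det A; rewrite chA -horner_coef0 horner_prod => h; move: h.
  rewrite -[in (-1) ^+ _]szr; under eq_bigr do rewrite hornerXsubC sub0r
    -mulN1r.
  rewrite big_split /= big_const_seq count_predT iter_mulr_1.
  by move/mulfI => -> //; rewrite signr_eq0.
rewrite -szr; elim: r rP {chA szr} => [_|z r IHr rP]; first by exists 0%N;
  rewrite ?big_nil.
have [|k kr rk] := IHr; first by move=> y yr; apply: rP; rewrite inE yr orbT.
rewrite big_cons rk; have /orP[/eqP->|/eqP->] := rP z (mem_head z r).
  by exists k; rewrite ?mul1r //= leqW.
by exists k.+1; rewrite ?exprS.
Qed.

Section RootOfUnity.
Variables (K : numClosedFieldType) (C : brcat K)
  (theta : forall X : C, mor X X).
Hypotheses (theta_nat : forall X Y (f : mor X Y), theta Y \o f = f \o theta X)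
  (balancing : forall X Y : C,
     theta (X ⊗ Y) = braid Y X \o braid X Y \o (theta X ⊠ theta Y)).

Variables (X : C) (t : K).
Hypotheses (t_neq0 : t != 0) (thetaX : theta X = t *: idm X)
  (thetaXX : (theta (X ⊗ X) - idm (X ⊗ X)) \o (theta (X ⊗ X) - t *: idm (X ⊗ X))
    = 0)
  (h0 : mor X (X ⊗ (X ⊗ X))) (h0_neq0 : h0 != 0).

Let H := mor X (X ⊗ (X ⊗ X)).
Let s1 : mor (X ⊗ (X ⊗ X)) (X ⊗ (X ⊗ X)) := cr X X X.
Let s2 : mor (X ⊗ (X ⊗ X)) (X ⊗ (X ⊗ X)) := X ◁ braid X X.

Let braid12 : braid X (X ⊗ X) = associ X X X \o (s2 \o s1).
Proof.
apply: (iso_cancel_left (assoc_iso X X X)); rewrite comp_assoc assoc_associ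
  comp_idl.
apply: (iso_cancel_right (assoc_iso X X X)); rewrite hexagon /s1 /s2 crE fam2E.
by rewrite -!comp_assoc associ_assoc comp_idr.
Qed.

Let braid21 : braid (X ⊗ X) X = s1 \o (s2 \o assoc X X X).
Proof.
apply: (iso_cancel_left (associ_iso X X X)).
apply: (iso_cancel_right (associ_iso X X X)); rewrite hexagoni /s1 /s2 crE
  fam2E.
by rewrite -!comp_assoc assoc_associ comp_idr (reassoc (associ_assoc _ _ _))
  comp_idl.
Qed.

(** The Yang-Baxter equation: naturality of the braiding of [X] with [X ⊗ X], applied to the
    crossing [braid X X]. *)
Let artin : s1 \o (s2 \o s1) = s2 \o (s1 \o s2).
Proof.
have := braid_nat (idm X) (braid X X); rewrite braid12 /= -!comp_assoc
  => /(congr1 (comp (assoc X X X))).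
rewrite (reassoc (assoc_associ _ _ _)) comp_idl => ->.
by rewrite {1}/s1 crE fam2E -?comp_assoc.
Qed.

Let thetaXX2 : theta (X ⊗ X) = t ^+ 2 *: (braid X X \o braid X X).
Proof.
by rewrite balancing thetaX tensmZl tensmZr tensm_id !compZr comp_idr scalerA.
Qed.

(** By naturality the twist of the triple product acts on [h] as [t], while balancing writes it as
    [t ^+ 3] times the full twist on three strands. *)
Let full_twist (h : H) :
  t ^+ 2 *: (s1 \o (s2 \o (s2 \o (s1 \o (s2 \o (s2 \o h)))))) = h.
Proof.
have := theta_nat h; rewrite thetaX compZr comp_idr balancing thetaX thetaXX2.
rewrite tensmZl tensmZr tensm_compr braid12 braid21 -/s2 -!comp_assoc.
rewrite (reassoc (assoc_associ _ _ _)) comp_idl !(compZl, compZr) scalerA.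
rewrite -exprS => e; apply: (scalerI t_neq0); rewrite scalerA -exprS -e.
by rewrite -?comp_assoc.
Qed.

Let S1 := vmx (comp s1 : H -> H).
Let S2 := vmx (comp s2 : H -> H).
Let M := dim H.

Let mulS1 u : u *m S1 = v2r (s1 \o (r2v u : H)).
Proof. exact: mul_vmx. Qed.

Let mulS2 u : u *m S2 = v2r (s2 \o (r2v u : H)).
Proof. exact: mul_vmx. Qed.

Let eq_mx (A B : 'M[K]_M) : (forall u : 'rV_M, u *m A = u *m B) -> A = B.
Proof. by move=> AB; apply/row_matrixP => i; rewrite !rowE AB. Qed.

Let det_iso (s s' : mor (X ⊗ (X ⊗ X)) (X ⊗ (X ⊗ X))) : inverse s s' ->
  \det (vmx (comp s : H -> H)) != 0.
Proof.
move=> [s's _]; have : \det (vmx (comp s : H -> H)) * \det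
  (vmx (comp s' : H -> H)) != 0.
  rewrite -det_mulmx; have -> : vmx (comp s : H -> H) *m vmx (comp s' : H -> H)
    = 1%:M.
    by apply: eq_mx => u; rewrite mulmxA !mul_vmx v2rK /= comp_assoc s's
      comp_idl r2vK mulmx1.
  by rewrite det1 oner_eq0.
by rewrite mulf_eq0 negb_or => /andP[].
Qed.

(** The Artin relation gives both crossings the same determinant [δ] on the space of dimension [M].
    The full twist yields [t^(2M) δ^6 = 1]; the twist of the last two strands, with eigenvalues
    among [1] and [t], yields [t^(2M) δ^2 = t^k] with [k <= M]. Cubing the second and dividing by
    the first leaves [t^(4M - 3k) = 1]. *)
Lemma twist_root_of_unity : exists2 n, (0 < n)%N & t ^+ n = 1.
Proof.
have M_gt0 : (0 < M)%N.
  rewrite lt0n -[M]dimvf; apply: contra_neq h0_neq0 => /eqP.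
  by rewrite dimv_eq0 => /eqP H0; apply/eqP; rewrite -memv0 -H0 memvf.
have iB : iso (braid X X) by exact: braid_iso.
have S1_neq0 : \det S1 != 0.
  have [s1' h] : iso s1; last exact: det_iso h.
  by rewrite /s1 crE fam2E; apply: iso_comp
    (iso_comp _ (tensm_iso iB (iso_id _))) (assoc_iso _ _ _); apply: associ_iso.
have S2_neq0 : \det S2 != 0.
  have [s2' h] : iso s2; last exact: det_iso h.
  exact: tensm_iso (iso_id _) iB.
have S12 : \det S1 = \det S2.
  have : S1 *m S2 *m S1 = S2 *m S1 *m S2.
    apply: eq_mx => u; rewrite !mulmxA !(mulS1, mulS2) !v2rK.
    by rewrite (comp_assoc s2 s1) (comp_assoc s1 (s2 \o s1)) artin -?comp_assoc.
  move/(congr1 determinant); rewrite !det_mulmx (mulrC (\det S2)) => /mulfI;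
    apply.
  by rewrite mulf_neq0.
have full : (t ^+ 2) ^+ M * \det S2 ^+ 6 = 1.
  have -> : \det S2 ^+ 6 = \det (S2 *m S2 *m S1 *m S2 *m S2 *m S1).
    by rewrite !det_mulmx S12 !exprS expr0 mulr1 !mulrA.
  rewrite -detZ -[RHS](det1 K M); congr determinant; apply: eq_mx => u.
  rewrite -scalemxAr !mulmxA !(mulS1, mulS2) !v2rK mulmx1.
  by have /(congr1 v2r) := full_twist (r2v (u : 'rV_(dim H)) : H); rewrite
    linearZ r2vK.
have [k leM det23] : exists2 k, (k <= M)%N & (t ^+ 2) ^+ M * \det S2 ^+ 2 = t ^+
  k.
  have -> : (t ^+ 2) ^+ M * \det S2 ^+ 2 = \det (t ^+ 2 *: (S2 *m S2)).
    by rewrite detZ det_mulmx expr2.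
  apply: det_two_eigenvalues; apply: eq_mx => u; rewrite mulmx0.
  have mulT (w : 'rV_(dim H)) : w *m (t ^+ 2 *: (S2 *m S2)) = v2r
    ((X ◁ theta (X ⊗ X)) \o (r2v w : H)).
    rewrite -scalemxAr mulmxA !mulS2 v2rK thetaXX2 tensmZr tensm_compr.
    by rewrite compZl linearZ -comp_assoc.
  have mulTB (c : K) (w : 'rV_(dim H)) : w *m (t ^+ 2 *: (S2 *m S2) - c%:M)
      = v2r ((X ◁ (theta (X ⊗ X) - c *: idm (X ⊗ X))) \o (r2v w : H)).
    rewrite mulmxBr mulT mul_mx_scalar tensmBr tensmZr tensm_id.
    rewrite compBl compZl comp_idl linearB; congr (_ - _).
    by rewrite linearZ /= r2vK.
  rewrite mulmxA !mulTB scale1r v2rK comp_assoc -tensm_compr.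
  have -> : (theta (X ⊗ X) - t *: idm _) \o (theta (X ⊗ X) - idm _) = 0.
    rewrite -thetaXX !(compBl, compBr, compZl, compZr, comp_idl, comp_idr).
    by rewrite !opprB !addrA; congr (_ - _); rewrite addrAC.
  by rewrite tensm0r comp0l linear0.
have k3 : t ^+ (M * 4) = t ^+ (k * 3).
  rewrite [RHS]exprM -det23 exprMn -(exprM (\det S2)) exprSr -mulrA full mulr1.
  by rewrite -!exprM mulnAC mulnC.
have k4 : (k * 3 < M * 4)%N.
  by rewrite (leq_ltn_trans (_ : _ <= M * 3)%N) ?leq_mul2r ?leM // ltn_mul2l
    M_gt0.
exists (M * 4 - k * 3)%N; first by rewrite subn_gt0.
apply: (mulIf (expf_neq0 (k * 3) t_neq0)).
by rewrite mul1r -exprD subnK // ltnW.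
Qed.

End RootOfUnity.

(** * The braiding trace in Rep(G) *)

Section FunctorTrace.
Variables (K : fieldType) (C E : brcat K) (F : braided_functor C E).
Implicit Types X Y : C.

(** The structure isomorphisms of a braided functor cancel in a closed diagram, so its scalar
    survives and can be computed in the target. *)
Lemma functor_left_dual X Y (ev : mor (Y ⊗ X) one) (coev : mor one (X ⊗ Y)) c :
  is_left_dual ev coev -> ev \o (braid X Y \o coev) = c *: idm one ->
  exists (ev' : mor (F Y ⊗ F X) one) (coev' : mor one (F X ⊗ F Y)),
    runit (F X) \o (F X ◁ ev') \o assoc _ _ _ \o (coev' ▷ F X) \o luniti (F X)
      = idm (F X)
    /\ ev' \o (braid (F X) (F Y) \o coev') = c *: idm one.
Proof.
move=> [zz _] tr_c; have [u [uf fu]] := fone_iso F.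
have [v [vf fv]] := ftens_iso F X Y.
exists (u \o (fmap F ev \o ftens F Y X)), (v \o (fmap F coev \o fone F)).
split; last first.
  rewrite -!comp_assoc (comp_assoc (ftens F Y X)) -ftens_braid -!comp_assoc.
  rewrite (reassoc fv) comp_idl !(comp_assoc (fmap F _)) -!fmap_comp.
  rewrite (comp_assoc (fmap F _)) -fmap_comp -comp_assoc tr_c -[c *: _]addr0
    (fmap_linear F) fmap_id.
  have -> : fmap F 0 = 0 :> mor (F one) (F one).
    by have := fmap_linear F (-1) (idm one) (idm one); rewrite !scaleN1r !addNr.
  by rewrite addr0 compZl comp_idl compZr uf.
have Flu : fmap F (luniti X) = ftens F one X
  \o ((fone F ▷ F X) \o luniti (F X)).
  have e : fmap F (lunit X) \o (ftens F one X
    \o ((fone F ▷ F X) \o luniti (F X)))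
      = idm (F X) by rewrite !comp_assoc ftens_lunit lunit_luniti.
  by rewrite -[RHS]comp_idl -(fmap_id F) -luniti_lunit fmap_comp -comp_assoc e
    comp_idr.
have Fru : runit (F X) \o (F X ◁ u) = fmap F (runit X) \o ftens F X one.
  by rewrite -ftens_runit -!comp_assoc -tensm_comp fu comp_idl tensm_id
    comp_idr.
have Fas : ftens F X (Y ⊗ X) \o ((F X ◁ ftens F Y X)
  \o (assoc _ _ _ \o (v ▷ F X)))
    = fmap F (assoc X Y X) \o ftens F (X ⊗ Y) X.
  rewrite !comp_assoc -ftens_assoc -!comp_assoc -tensm_comp fv comp_idl
    tensm_id.
  by rewrite comp_idr.
rewrite !tensm_compr !tensm_compl -?comp_assoc (reassoc Fru) -?comp_assoc.
rewrite (comp_assoc (ftens F X one)) -(fmap_id F) ftens_nat -?comp_assoc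
  fmap_id.
rewrite (comp_assoc (assoc _ _ _)) (comp_assoc (F X ◁ _)) (reassoc Fas)
  -?comp_assoc.
rewrite (comp_assoc (ftens F (X ⊗ Y) X)) -{1}(fmap_id F X) ftens_nat
  -?comp_assoc -Flu.
by rewrite -!fmap_comp !comp_assoc zz fmap_id.
Qed.

End FunctorTrace.

Lemma sum_mxtens_index (R : nmodType) m n (F : 'I_(m * n) -> R) :
  \sum_k F k = \sum_i \sum_j F (mxtens_index (i, j)).
Proof.
rewrite pair_bigA (reindex (@mxtens_index m n)) /=.
  by apply: eq_bigr => -[i j].
by exists (@mxtens_unindex m n) => k _; [apply: mxtens_indexK|apply:
  mxtens_unindexK].
Qed.

Section RepTrace.
Variables (K : fieldType) (gT : finGroupType) (G : {group gT}).

(** Entrywise, the zigzag says that for each [i] the products of coefficients of [coev] and [ev] sum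
    to 1 over [j]. As the standard braiding swaps indices, the closed diagram adds up these ones
    over a basis of [V]. *)
Lemma rep_trace (V W : rep_brcat K G) (ev : mor (W ⊗ V) one)
    (coev : mor one (V ⊗ W)) c :
  runit V \o (V ◁ ev) \o assoc V W V \o (coev ▷ V) \o luniti V = idm V ->
  ev \o (braid V W \o coev) = c *: idm one -> c = (rep_dim (V : rep K G))%:R.
Proof.
move=> /(congr1 vsval) /= zz /(congr1 vsval) /= tr_c.
have {}zz i : \sum_j (vsval coev) ord0 (mxtens_index (i, j))
    * (vsval ev) (mxtens_index (j, i)) ord0 = 1.
  move/matrixP/(_ i i): zz; rewrite [RHS]mxE eqxx mulr1n => <-.
  rewrite mul_fun_mx mxE (mulmx_fun _ (@trunitK _) (@trunitiK _)) mul_fun_mx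
    mxE.
  rewrite sum_mxtens_index sum_mxtens_index (bigD1 i) //= [X in _ + X]big1
    ?addr0.
    apply: eq_bigr => j _; rewrite (bigD1 i) //= [X in _ + X]big1 ?addr0.
      rewrite !mxE tassocE /tluniti /truniti !mxtens_indexK /= !eqxx.
      by rewrite mulr1 mul1r !ord1.
    move=> l li; rewrite !mxE /tluniti !mxtens_indexK /= eq_sym (negPf li).
    by rewrite mulr0 mul0r.
  move=> v vi; rewrite big1 // => j _; rewrite big1 // => l _.
  rewrite !mxE tassocE /truniti !mxtens_indexK /= (negPf vi).
  by rewrite mul0r mulr0.
move/matrixP/(_ ord0 ord0): tr_c; rewrite !mxE mulr1 => <-.
rewrite (mulmx_fun _ (@tswapK _ _) (@tswapK _ _)) sum_mxtens_index exchange_big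
  /=.
transitivity (\sum_(i < rep_dim (V : rep K G)) (1 : K)).
  by apply: eq_bigr => i _; rewrite -(zz i); apply: eq_bigr => j _; rewrite mxE
    tswapE.
by rewrite sumr_const card_ord.
Qed.

Lemma tannakian_trace (C : brcat K) (F : braided_functor C (rep_brcat K G))
  (X Y : C)
    (ev : mor (Y ⊗ X) one) (coev : mor one (X ⊗ Y)) c :
  is_left_dual ev coev -> ev \o (braid X Y \o coev) = c *: idm one ->
  c = (rep_dim (F X : rep K G))%:R.
Proof.
move=> dXY tr_c; have [ev' [coev' [zz tr_c']]] := functor_left_dual F dXY tr_c.
exact: rep_trace zz tr_c'.
Qed.

End RepTrace.

(** * Eigenvalues and roots of unity *)

(** The elementary half of Perron-Frobenius theory: if [w A = x w], pairing the absolute values of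
    [w] with the positive vector [v] gives [x <= q]. The index [i0] excludes the empty matrix. *)
Lemma sup_eigenvalues (R : realType) n (A : 'M[R]_n) (v : 'I_n -> R) q
  (i0 : 'I_n) :
  (forall i j, 0 <= A i j) -> (forall i, 0 < v i) ->
  (forall i, \sum_j A i j * v j = q * v i) ->
  sup [set x : R | 0 <= x /\ eigenvalue A x]%classic = q.
Proof.
move=> A_ge0 v_gt0 Av.
have q_ge0 : 0 <= q.
  rewrite -(pmulr_lge0 _ (v_gt0 i0)) -Av.
  by apply: sumr_ge0 => j _; rewrite mulr_ge0 // ltW.
(* [eigenvalue] speaks of row vectors while [v] is a column, so the argument goes through
   singularity of [A - q]. *)
have q_eigen : eigenvalue A q.
  rewrite /eigenvalue kermx_eq0 row_free_unit; apply/negP => unitAq.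
  have : (A - q%:M) *m (\col_j v j) = 0.
    rewrite mulmxBl mul_scalar_mx; apply/colP => i; rewrite !mxE -Av -sumrB.
    by apply: big1 => j _; rewrite !mxE subrr.
  move/(congr1 (mulmx (invmx (A - q%:M)))); rewrite mulmxA mulVmx // mul1mx
    mulmx0.
  by move/colP/(_ i0); rewrite !mxE => v0; have := v_gt0 i0; rewrite v0 ltxx.
have q_ub x : 0 <= x /\ eigenvalue A x -> x <= q.
  move=> [x_ge0 /eigenvalueP[w wA w_neq0]].
  have w_gt0 : 0 < \sum_j `|w ord0 j| * v j.
    rewrite lt_def sumr_ge0 ?andbT; last by move=> j _; rewrite mulr_ge0 // ltW.
    apply: contra_neq w_neq0 => /eqP.
    rewrite psumr_eq0 => [/allP w0|j _]; last by rewrite mulr_ge0 // ltW.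
    apply/rowP => j; rewrite mxE; have := w0 j (mem_index_enum j).
    by rewrite mulf_eq0 normr_eq0 (gt_eqF (v_gt0 j)) orbF => /eqP.
  rewrite -(ler_pM2r w_gt0) mulr_sumr [leRHS]mulr_sumr.
  have -> : \sum_i q * (`|w ord0 i| * v i) = \sum_j \sum_i `|w ord0 i| * A i j *
    v j.
    rewrite exchange_big; apply: eq_bigr => i _.
    by rewrite mulrCA -Av mulr_sumr; apply: eq_bigr => j _; rewrite mulrA.
  apply: ler_sum => j _; rewrite mulrA -mulr_suml ler_wpM2r ?(ltW (v_gt0 j)) //.
  rewrite -{1}(ger0_norm x_ge0) -normrM.
  have := congr1 (fun u : 'rV_n => u ord0 j) wA; rewrite !mxE => <-.
  apply: le_trans (ler_norm_sum _ _ _) _; apply: ler_sum => i _.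
  by rewrite normrM (ger0_norm (A_ge0 _ _)).
apply/eqP; rewrite eq_le; apply/andP; split.
  by apply: ge_sup; [exists q | move=> x /q_ub].
by apply: ub_le_sup; [exists q => x /q_ub | split].
Qed.

Lemma sup_ge0 (R : realType) (P : set R) :
  (forall x, P x -> 0 <= x) -> 0 <= sup P.
Proof.
(* Without a supremum, [sup] takes the default value 0. *)
move=> P_ge0; have [hs|/sup_out -> //] := boolp.pselect (has_sup P).
have [[x Px] ub] := hs.
exact: le_trans (P_ge0 x Px) (ub_le_sup ub Px).
Qed.

(** * Roots of unity of order 3 and 4, and traces of roots of unity *)

Section Zeta.
Variable R : realType.
Local Notation pi := (@trigo.pi R).

Lemma cis_mul (x y : R) :
  (cos x +i* sin x)%C * (cos y +i* sin y)%C = (cos (x + y) +i* sin (x + y))%C.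
Proof. by rewrite cosD sinD /=; congr (_ +i* _)%C; ring. Qed.

Lemma zeta4_sqr : zeta R 4 ^+ 2 = -1.
Proof.
rewrite /zeta expr2 cis_mul.
have -> : 2 * pi / 4%:R + 2 * pi / 4%:R = pi by field.
by rewrite cospi sinpi; congr (_ +i* _)%C; rewrite oppr0.
Qed.

Lemma zeta3_minpoly : zeta R 3 ^+ 2 + zeta R 3 + 1 = 0.
Proof.
have z3 : zeta R 3 ^+ 3 = 1.
  rewrite /zeta !exprS expr0 mulr1 !cis_mul.
  have -> : 2 * pi / 3%:R + (2 * pi / 3%:R + 2 * pi / 3%:R) = pi *+ 2 by field.
  by rewrite cos2pi sin2pi.
have z_neq1 : zeta R 3 - 1 != 0.
  rewrite subr_eq0; apply/eqP => /(congr1 (@complex.Im R)) /=; apply/eqP;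
    rewrite gt_eqF //.
  have pi0 : 0 < pi by exact: pi_gt0.
  apply: sin_gt0_pi; apply/andP; split; first by rewrite divr_gt0 ?mulr_gt0.
  by rewrite ltr_pdivrMr // mulrC ltr_pM2l // ltr_nat.
by apply: (mulfI z_neq1); rewrite mulr0; apply: etrans
  (_ : zeta R 3 ^+ 3 - 1 = 0); [ring | rewrite z3 subrr].
Qed.

Lemma root_zeta4 (x : R[i]) : x ^+ 2 + 1 = 0 -> x = zeta R 4 \/ x = - zeta R 4.
Proof.
move=> x2; have : (x - zeta R 4) * (x + zeta R 4) = 0.
  by rewrite -subr_sqr zeta4_sqr opprK.
move/eqP; rewrite mulf_eq0 subr_eq0 addr_eq0.
by case/orP=> /eqP; [left|right].
Qed.

Lemma root_zeta3 (x : R[i]) : x ^+ 2 + x + 1 = 0 ->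
  x = zeta R 3 \/ x = (zeta R 3)^-1.
Proof.
move=> x2; set z := zeta R 3; have z2 : z ^+ 2 + z + 1 = 0 := zeta3_minpoly.
have z_neq0 : z != 0.
  by apply/eqP => z0; move: z2; rewrite z0 expr2 mulr0 !add0r => /eqP; rewrite
    oner_eq0.
have : (x - z) * (x - z^-1) = 0.
  have -> : (x - z) * (x - z^-1) = (x ^+ 2 + x + 1) - x * (z ^+ 2 + z + 1) / z
    by field.
  by rewrite x2 z2 mulr0 mul0r subr0.
move/eqP; rewrite mulf_eq0 !subr_eq0.
by case/orP=> /eqP; [left|right].
Qed.

End Zeta.

(* Clearing denominators in theta^k + theta^-k gives integers c_k with
   c_k = (-a)^k mod N; since c_n = 2 N^n for some n > 0, N divides a^n. *)
Lemma unity_trace_coprime (K : numFieldType) (a N n : nat) (theta : K) :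
  (0 < n)%N -> (0 < N)%N -> coprime N a -> theta ^+ n = 1 ->
  N%:R * theta ^+ 2 + a%:R * theta + N%:R = 0 -> N = 1%N.
Proof.
move=> n_gt0 N_gt0 coNa th_n eq_th.
have th_neq0 : theta != 0.
  by apply/eqP => th0; move/eqP: th_n; rewrite th0 expr0n gtn_eqF // eq_sym
    oner_eq0.
pose u k := theta ^+ k + theta ^- k.
have uS k : N%:R * u k.+2 = - a%:R * u k.+1 - N%:R * u k.
  have e1 : N%:R * (theta * (theta * theta ^+ k)) = - a%:R *
    (theta * theta ^+ k) - N%:R * theta ^+ k.
    apply/eqP; rewrite -subr_eq0; apply/eqP.
    by rewrite -(mul0r (theta ^+ k)) -eq_th; ring.
  have e2 : N%:R * theta ^- k.+2 = - a%:R * theta ^- k.+1 - N%:R * theta ^- k.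
    apply/eqP; rewrite -subr_eq0; apply/eqP.
    rewrite -(mul0r (theta ^- k.+2)) -eq_th !exprS; field.
    by rewrite th_neq0 expf_neq0.
  rewrite /u mulrDr e2 !exprS e1; ring.
(* Two consecutive values are carried along for the recurrence. The congruence starts at exponent 1,
   since [u 0] is 2 and not 1. *)
have uP k : exists (c0 c1 e : int), [/\ N%:R ^+ k * u k = c0%:~R,
    N%:R ^+ k.+1 * u k.+1 = c1%:~R & c1 = (- a%:Z) ^+ k.+1 + N%:Z * e].
  elim: k => [|k [c0 [c1 [e [h0 h1 h2]]]]].
    exists 2, (- a%:Z), 0; rewrite /u !expr0 !expr1 invr1 mul1r mulr0 addr0;
      split=> //.
    apply: (mulfI th_neq0); apply/eqP; rewrite -subr_eq0; apply/eqP.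
    by rewrite -eq_th mulrNz /=; field.
  exists c1, (- a%:Z * c1 - N%:Z ^+ 2 * c0), (- a%:Z * e - N%:Z * c0); split=>
    //.
    rewrite exprSr -mulrA uS !(intrD, rmorphN, rmorphM, rmorphXn) /= -h0 -h1
      !exprS; ring.
  by rewrite h2 [in RHS]exprS; ring.
have [c0 [c1 [e [_ h1 h2]]]] := uP n.-1; rewrite prednK // in h1 h2.
have c1E : c1 = 2 * N%:Z ^+ n.
  apply/eqP; rewrite -(eqr_int K) -h1 /u th_n invr1 rmorphM rmorphXn /=.
  by rewrite mulrC.
have : (N%:Z %| (- a%:Z) ^+ n)%Z.
  apply/dvdzP; exists (2 * N%:Z ^+ n.-1 - e).
  have -> : (- a%:Z) ^+ n = c1 - N%:Z * e by rewrite h2; ring.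
  by rewrite c1E -{1}(prednK n_gt0) exprS; ring.
rewrite dvdzE abszX abszN !absz_nat => N_dvd.
have := coprimeXr n coNa; rewrite /coprime => /eqP.
by move/gcdn_idPl: N_dvd => ->.
Qed.

(** After division by the gcd, [unity_trace_coprime] leaves leading coefficient 1, so [N] divides
    [a]. The quotient is at most 2 by the triangle inequality, as [theta] has modulus 1. *)
Lemma unity_trace_cases (K : numClosedFieldType) (a N n : nat) (theta : K) :
  (0 < n)%N -> (0 < N)%N -> theta ^+ n = 1 ->
  N%:R * theta ^+ 2 + a%:R * theta + N%:R = 0 ->
  exists2 t, (t <= 2)%N & a = (t * N)%N /\ theta ^+ 2 + t%:R * theta + 1 = 0.
Proof.
move=> n_gt0 N_gt0 th_n eq_th; pose g := gcdn N a.
have g_gt0 : (0 < g)%N by rewrite gcdn_gt0 N_gt0.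
have NE : N = (N %/ g * g)%N by rewrite divnK ?dvdn_gcdl.
have aE : a = (a %/ g * g)%N by rewrite divnK ?dvdn_gcdr.
have eq_th' : (N %/ g)%:R * theta ^+ 2 + (a %/ g)%:R * theta + (N %/ g)%:R = 0.
  have g0 : g%:R != 0 :> K by rewrite pnatr_eq0 -lt0n.
  apply: (mulIf g0); rewrite mul0r -eq_th [in RHS]NE
    [in X in _ = _ + X * _ + _]aE !natrM; ring.
have N1 : (N %/ g)%N = 1%N.
  apply: (unity_trace_coprime n_gt0 _ _ th_n eq_th').
    by rewrite divn_gt0 // dvdn_leq // dvdn_gcdl.
  by rewrite /coprime -(eqn_pmul2r g_gt0) mul1n muln_gcdl -NE -aE.
rewrite N1 mul1r in eq_th'; exists (a %/ g)%N; last first.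
  by split=> //; rewrite [in RHS]NE N1 mul1n -aE.
have th1 : `|theta| = 1.
  by apply: (pexpIrn n_gt0); rewrite ?nnegrE ?normr_ge0 ?ler01 // -normrX th_n
    normr1 expr1n.
rewrite -(ler_nat K).
have -> : (a %/ g)%:R = `|(a %/ g)%:R * theta| :> K by rewrite normrM th1 mulr1
  normr_nat.
have -> : (a %/ g)%:R * theta = - (theta ^+ 2 + 1).
  by apply/eqP; rewrite -addr_eq0 -eq_th'; apply/eqP; ring.
by rewrite normrN (le_trans (ler_normD _ _)) // normrX th1 expr1n normr1 -mulr2n
  lexx.
Qed.

(** * Near-integral braided fusion categories *)

Lemma sum_option (V : nmodType) (I : finType) (F : option I -> V) :
  \sum_s F s = F None + \sum_i F (Some i).
Proof.
rewrite (bigD1 None) //=; congr (_ + _).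
by rewrite (reindex_omap Some id) => [|[]] //=; apply: eq_bigl => i; rewrite
  eqxx.
Qed.

Section NearIntegral.
Variables (R : realType) (C : brcat R[i]) (fC : fusion C).
Variables (D : C -> Prop) (hD : fusion_subcategory D)
  (fD : fusion (sub_moncat hD)).
Hypothesis rankD : (rank fD + 1)%N = rank fC.
Variables (rho : C) (rho_simple : simple rho) (rho_notin : ~ D rho).
Variables (d : left_duality C) (a : forall X : C, mor X (ldual d (ldual d X))).
Hypotheses (a_spherical : spherical a)
  (a_canonical : forall X : C, qdim a X = (FPdim R fC X)%:C).
Implicit Types X Y Z : C.
Local Notation "X ^*" := (ldual d X) : cat_scope.
Local Notation abC := (fusion_abelian fC).

Let a_pivotal : pivotal a := a_spherical.1.

(** * Simple objects of [D] and of [C] *)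

Lemma closed_iso X Y : isomorphic X Y -> D X -> D Y.
Proof. by move=> /direct_sum1 dY DX; apply: (subcategory_sum hD dY). Qed.

Definition irrD i : C := sval (irr fD i).

Lemma irrD_in i : D (irrD i).
Proof. exact: svalP. Qed.

(** Simplicity in [D] only tests subobjects lying in [D]. A simple summand in [C] lies in [D] by
    closure under summands, so its inclusion is an isomorphism. *)
Lemma irrD_simple i : simple (irrD i).
Proof.
have [nz smin] : simple (irr fD i) by case: (irrP fD).
have [n [Y [Ys dY]]] := fusion_semisimple fC (irrD i).
have DY k : D (Y k) := subcategory_summand hD dY (irrD_in i) k.
case: n Y Ys dY DY => [|n] Y Ys dY DY.
  by case: nz; apply/zero_objectP; apply: direct_sum_idm0 dY.
have [j [p [pj _ _]]] := dY.
apply: (simple_isomorphic (X := Y ord0)) => //.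
have [| z | [g gP]] := smin (exist D (Y ord0) (DY ord0)) (j ord0).
- move=> Z g h /(congr1 (comp (p ord0))).
  by rewrite !comp_assoc pj !comp_idl.
- have /eqP := idm_simple (Ys ord0); case.
  by have /zero_objectP := z.
- by exists (j ord0), g.
Qed.

Lemma irrD_inj i j : isomorphic (irrD i) (irrD j) -> i = j.
Proof. by move=> ij; case: (irrP fD) => _ + _; apply. Qed.

(** [None] stands for [rho], so that [sum_option] splits its term off a sum over the simple
    objects. *)
Definition simples (s : option 'I_(rank fD)) : C :=
  if s is Some i then irrD i else rho.

Lemma simples_simple s : simple (simples s).
Proof. by case: s => [i|] //=; apply: irrD_simple. Qed.

Lemma simples_inj s t : isomorphic (simples s) (simples t) -> s = t.
Proof.
case: s t => [i|] [j|] //= st.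
- by rewrite (irrD_inj st).
- by case: rho_notin; apply: closed_iso st (irrD_in i).
- by case: rho_notin; apply: closed_iso (isomorphic_sym st) (irrD_in j).
Qed.

(** The rank condition enters here: an injection between index sets of equal size is onto, so a
    simple object lies in [D] or is [rho]. *)
Lemma simples_bij : exists2 f : option 'I_(rank fD) -> 'I_(rank fC), bijective f
  &
  forall s, isomorphic (simples s) (irr fC (f s)).
Proof.
case: (irrP fC) => irr_s irr_inj irr_all.
have /fin_all_exists[f fP] s : exists i, isomorphic (simples s) (irr fC i).
  exact: irr_all (simples_simple s).
exists f => //; apply: inj_card_bij => [s t fst|].
  apply: simples_inj; apply: isomorphic_trans (fP s) _.
  by rewrite fst; apply/isomorphic_sym/fP.
by rewrite card_option !card_ord -rankD addn1.
Qed.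

Lemma simples_all X : simple X -> exists s, isomorphic X (simples s).
Proof.
case: (irrP fC) => irr_s irr_inj irr_all sX; have [f [g fK gK] fP] :=
  simples_bij.
have [i Xi] := irr_all X sX; exists (g i); apply: isomorphic_trans Xi _.
by have := fP (g i); rewrite gK => /isomorphic_sym.
Qed.

Lemma decompose X : exists n (c : 'I_n -> option 'I_(rank fD)),
  direct_sum (fun k => simples (c k)) X.
Proof.
have [n [Y [Ys dY]]] := fusion_semisimple fC X.
have /fin_all_exists[c cP] k : exists s, isomorphic (Y k) (simples s).
  exact: simples_all.
by exists n, c; apply: direct_sum_iso dY.
Qed.

Lemma decompose_in n (c : 'I_n -> option 'I_(rank fD)) X :
  direct_sum (fun k => simples (c k)) X -> D X -> forall k, exists i, c k = Some
    i.
Proof.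
move=> dX DX k; have := subcategory_summand hD dX DX k.
by case: (c k) => [i _|//]; exists i.
Qed.

Lemma dim_simples s t : \dim {: mor (simples s) (simples t)} = (s == t).
Proof.
have [<-|/eqP st] := eqVneq s t; first by rewrite (dim_endo_simple abC) //;
  apply: simples_simple.
apply: (dim_hom_simple0 abC) => [||/simples_inj //]; exact: simples_simple.
Qed.

Lemma dim_hom_simples n (c : 'I_n -> option 'I_(rank fD)) X s :
  direct_sum (fun k => simples (c k)) X ->
  \dim {: mor (simples s) X} = (\sum_k (s == c k))%N.
Proof. by move/(dim_sumr (simples s)) ->; apply: eq_bigr => k _; rewrite
  dim_simples. Qed.

Lemma sum_decompose (V : nmodType) (f : option 'I_(rank fD) -> V) n
    (c : 'I_n -> option 'I_(rank fD)) X :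
  direct_sum (fun k => simples (c k)) X ->
  \sum_k f (c k) = \sum_s f s *+ \dim {: mor (simples s) X}.
Proof.
move=> dX; under [RHS]eq_bigr => s _ do rewrite (dim_hom_simples s dX) -sumrMnr.
rewrite exchange_big; apply: eq_bigr => k _; rewrite (bigD1 (c k)) //= eqxx.
by rewrite big1 ?addr0 // => s /negPf ->.
Qed.

(** The endomorphism space of a direct sum has dimension at least the number of summands, so
    dimension one leaves a single summand. *)
Lemma one_simple : simple (one : C).
Proof.
have [n [c dc]] := decompose one; have d1 := fusion_one fC.
case: n c dc => [|n] c dc.
  by have := dim_suml one dc; rewrite big_ord0 d1.
have := dim_suml one dc; rewrite d1.
under eq_bigr => k _ do rewrite (dim_hom_simples _ dc) (bigD1 k) //= eqxx.
rewrite big_split /= sum_nat_const card_ord muln1 => /eqP.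
rewrite addSn eqSS eq_sym addn_eq0 => /andP[/eqP n0 _]; subst n.
have [j [p [pj _ jp]]] := dc; rewrite big_ord1 in jp.
apply: (simple_isomorphic (X := simples (c ord0))); last exact: simples_simple.
by exists (j ord0), (p ord0).
Qed.

Let one_neq0 : idm (one : C) != 0 := idm_simple one_simple.
Let one_scalar (f : mor (one : C) one) : exists c, f = c *: idm one.
Proof. exact: (schur_scalar abC f one_simple). Qed.

(** * Frobenius-Perron dimensions as traces *)

Local Notation q := (FPdim R fC).

Lemma q_ge0 X : 0 <= q X.
Proof. by apply: sup_ge0 => x []. Qed.

Lemma q_sum n (Y : 'I_n -> C) X : direct_sum Y X -> q X = \sum_k q (Y k).
Proof.
move=> dX; apply: (@complexI R); rewrite -a_canonical.
rewrite (qdim_sum a_pivotal dX) rmorph_sum.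
by apply: eq_bigr => k _; rewrite a_canonical.
Qed.

Lemma q_tens X Y : q (X ⊗ Y) = q X * q Y.
Proof.
apply: (@complexI R); rewrite rmorphM /= -!a_canonical.
exact: (qdim_tens a_pivotal one_neq0 one_scalar).
Qed.

Lemma q_iso X Y : isomorphic X Y -> q X = q Y.
Proof. by move=> /direct_sum1/q_sum ->; rewrite big_ord1. Qed.

Lemma q_ldual X : q X^* = q X.
Proof. by apply: (@complexI R); rewrite -!a_canonical; case: a_spherical. Qed.

Lemma q_one : q one = 1.
Proof.
case: (irrP fC) => irr_s irr_inj irr_all; have [i0 _] := irr_all one one_simple.
apply: (sup_eigenvalues (v := fun=> 1) i0) => // [i j|i]; rewrite ?mxE ?ler0n
  //.
rewrite (bigD1 i) //= big1 ?addr0 => [|j ji]; rewrite mxE mulr1.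
  rewrite (dim_isor (Y := irr fC i)) ?(dim_endo_simple abC) ?mulr1 //.
  by exists (lunit (irr fC i)); apply: lunit_iso.
rewrite (dim_isor (Y := irr fC i)) ?(dim_hom_simple0 abC) //.
  by move=> /irr_inj e; rewrite e eqxx in ji.
by exists (lunit (irr fC i)); apply: lunit_iso.
Qed.

Lemma q_idm0 X : idm X = 0 -> q X = 0.
Proof.
by move=> X0; apply: (@complexI R); rewrite -a_canonical qdimE X0
  -(scale0r (idm X)) trZ mul0r.
Qed.

(** The coevaluation is nonzero, so the unit is a summand of [X ⊗ X^*], whose dimension is then at
    least 1. *)
Lemma q_simple_gt0 X : simple X -> 0 < q X.
Proof.
move=> sX; have [n [c dXX]] := decompose (X ⊗ X^*).
suff qXX : 1 <= q (X ⊗ X^*).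
  rewrite lt_def q_ge0 andbT; apply: contraTneq qXX => qX.
  by rewrite q_tens qX mul0r -ltNge ltr01.
have [j [p [_ _ jp]]] := dXX.
have [k pk0] : exists k, p k \o coev d X != 0.
  apply/existsP; apply: contraT; rewrite negb_exists => /forallP p0.
  have coev0 : coev d X = 0.
    rewrite -[coev d X]comp_idl -jp comp_suml big1 // => k _.
    by rewrite -comp_assoc (eqP (negPn (p0 k))) comp0r.
  case/eqP: (idm_simple sX); have [<- _] := dualP d X.
  rewrite coev0 -(scale0r (coev d X)) tensmZl compZr compZl.
  by rewrite scale0r.
have /(schur_iso abC one_simple (simples_simple _)) i1 := pk0.
rewrite (q_sum dXX) (bigD1 k) //= -(q_iso (ex_intro _ _ i1)) q_one lerDl.
by apply: sumr_ge0 => l _; apply: q_ge0.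
Qed.

(** * Fusion rules with [rho] *)

Lemma dim_hom_rho_r V : D V -> \dim {: mor V rho} = 0%N.
Proof.
move=> DV; have [n [c dV]] := decompose V.
rewrite (dim_suml rho dV) big1 // => k _; have [i ci] := decompose_in dV DV k.
by rewrite ci (dim_simples (Some i) None).
Qed.

Lemma dim_hom_rho_l V : D V -> \dim {: mor rho V} = 0%N.
Proof.
move=> DV; have [n [c dV]] := decompose V.
rewrite (dim_hom_simples None dV) big1 // => k _.
by have [i ->] := decompose_in dV DV k.
Qed.

Lemma simple_multiple n (c : 'I_n -> option 'I_(rank fD)) X :
  direct_sum (fun k => simples (c k)) X ->
  (forall i, \dim {: mor (irrD i) X} = 0%N) -> forall k, c k = None.
Proof.
move=> dX h k; case ck: (c k) => [i|//].
by have := h i; rewrite (dim_hom_simples (Some i) dX) (bigD1 k) //= ck eqxx.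
Qed.

(** A morphism from a simple of [D] to [X ⊗ rho] bends, along a dual taken inside [D], to a morphism
    from an object of [D] to [rho], which vanishes. So only [rho] occurs, and dimensions count its
    copies. *)
Lemma decompose_tens_rho X : D X ->
  exists m, direct_sum (fun _ : 'I_m => rho) (X ⊗ rho) /\ q X = m%:R.
Proof.
move=> DX; have [n [c dX]] := decompose (X ⊗ rho).
have cN : forall k, c k = None.
  apply: (simple_multiple dX) => i.
  have [[[Y DY] [ev [coev dXY]]] _] := fusion_rigid fD (exist D X DX).
  have dXY' : @is_left_dual _ C X Y ev coev := dXY.
  rewrite (dim_left_dual _ _ dXY') dim_hom_rho_r //.
  exact: closed_tens hD _ _ DY (irrD_in i).
exists n.
have dX' : direct_sum (fun _ : 'I_n => rho) (X ⊗ rho).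
  apply: direct_sum_iso dX => k; rewrite cN; exact: isomorphic_refl.
split=> //; have := q_sum dX'; rewrite q_tens sumr_const card_ord
  -[RHS]mulr_natl.
by apply: mulIf; rewrite gt_eqF // q_simple_gt0.
Qed.

Lemma closed_one_C : D one.
Proof. exact: closed_one hD. Qed.

(** Morphisms from the dual to a simple [V] of [D] correspond to morphisms from the unit to
    [rho ⊗ V], a multiple of [rho], and vanish. So the dual is a multiple of [rho], and equal
    dimensions leave one copy. *)
Lemma rho_self_dual : isomorphic rho^* rho.
Proof.
have [n [c dr]] := decompose rho^*.
have cN : forall k, c k = None.
  apply: (simple_multiple dr) => i; have [m [dm _]] := decompose_tens_rho
    (irrD_in i).
  have : \dim {: mor one (rho ⊗ irrD i)} = 0%N.
    rewrite (dim_isor _ (isomorphic_braid _ _)) (dim_sumr _ dm) big1 // => k _.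
    exact/dim_hom_rho_r/closed_one_C.
  rewrite (dim_left_dual _ _ (dualP d rho)) => e.
  have : \dim {: mor rho^* (irrD i)} = 0%N.
    rewrite -(dim_isol (X := rho^* ⊗ one)) //.
    by exists (runit rho^*); apply: runit_iso.
  rewrite (dim_suml _ dr) (dim_hom_simples (Some i) dr) => /eqP.
  rewrite sum_nat_eq0 => /forallP h; apply: big1 => k _.
  by have /eqP := h k; rewrite (dim_simples _ (Some i)) eq_sym.
have q_rho0 : q rho != 0 by rewrite gt_eqF // q_simple_gt0.
have n1 : n = 1%N.
  have := q_sum dr; rewrite q_ldual; under eq_bigr do rewrite cN.
  rewrite sumr_const card_ord -mulr_natl -[LHS]mul1r => /(mulIf q_rho0)/eqP.
  by rewrite -[1]/(1%:R) eqr_nat => /eqP.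
subst n; have [j [p [pj _ jp]]] := dr; rewrite big_ord1 in jp.
suff : isomorphic (simples (c ord0)) rho^* by rewrite cN => /isomorphic_sym.
by exists (j ord0), (p ord0).
Qed.

(** Bending one [rho] down identifies the multiplicity with the number of copies of [rho] in
    [irrD i ⊗ rho]. *)
Lemma mult_rho2 i : q (irrD i) = (\dim {: mor (irrD i) (rho ⊗ rho)})%:R.
Proof.
have [m [dm ->]] := decompose_tens_rho (irrD_in i).
rewrite (dim_left_dual _ _ (dualP d rho)).
rewrite (dim_isol _ (isomorphic_tens rho_self_dual (isomorphic_refl (irrD i)))).
rewrite (dim_isol _ (isomorphic_braid _ _)) (dim_suml _ dm).
under eq_bigr => k _ do rewrite (dim_endo_simple abC rho_simple).
by rewrite sum_nat_const card_ord muln1.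
Qed.

(** The left side uses the smaller fusion matrix of [D]; the dimensions taken in [C] form a positive
    eigenvector of it. *)
Lemma FPdim_in (X : sub_moncat hD) : FPdim R fD X = q (sval X).
Proof.
have [i0 _] : exists i, isomorphic one (irrD i).
  have [[i|] oi] := simples_all one_simple; first by exists i.
  by case: rho_notin; apply: closed_iso oi closed_one_C.
apply: (sup_eigenvalues (v := fun i => q (irrD i)) i0) => [i j|i|i].
- by rewrite mxE ler0n.
- exact/q_simple_gt0/irrD_simple.
have [n [c dX]] := decompose (sval X ⊗ irrD i).
rewrite -q_tens (q_sum dX) (sum_decompose (fun s => q (simples s)) dX)
  sum_option.
rewrite dim_hom_rho_l ?add0r; last exact: closed_tens hD _ _ (svalP X)
  (irrD_in i).
by apply: eq_bigr => j _; rewrite mxE mulr_natl.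
Qed.

Local Notation mult := (fun s => \dim {: mor (simples s) (rho ⊗ rho)}).
Local Notation N := (FPdim_cat R fD).
Local Notation kappa := (\dim {: mor rho (rho ⊗ rho)}).

Lemma FPdim_catD : N = \sum_i q (irrD i) ^+ 2.
Proof. by apply: eq_bigr => i _; rewrite FPdim_in. Qed.

Lemma FPdim_catD_nat : exists2 n, (0 < n)%N & N = n%:R.
Proof.
have [i0 _] : exists i, isomorphic one (irrD i).
  have [[i|] oi] := simples_all one_simple; first by exists i.
  by case: rho_notin; apply: closed_iso oi closed_one_C.
exists (\sum_i mult (Some i) ^ 2)%N.
  rewrite (bigD1 i0) //= addn_gt0 expn_gt0 -(ltr0n R) -mult_rho2 q_simple_gt0
    //.
  exact: irrD_simple.
by rewrite FPdim_catD natr_sum; apply: eq_bigr => i _; rewrite mult_rho2 natrX.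
Qed.

Lemma q_rho_sq : q rho ^+ 2 = N + kappa%:R * q rho.
Proof.
have [n [c dr]] := decompose (rho ⊗ rho).
rewrite expr2 -q_tens (q_sum dr) (sum_decompose (fun s => q (simples s)) dr)
  sum_option.
rewrite addrC mulr_natl FPdim_catD; congr (_ + _); apply: eq_bigr => i _.
by rewrite -mulr_natr -mult_rho2 expr2.
Qed.

Lemma FPdim_catC : FPdim_cat R fC = N + q rho ^+ 2.
Proof.
have [f fb fP] := simples_bij.
rewrite [LHS]/FPdim_cat (reindex f) /=; last exact: onW_bij.
rewrite (eq_bigr (fun s => q (simples s) ^+ 2)) => [|s _].
  by rewrite sum_option addrC FPdim_catD.
by rewrite (q_iso (fP s)).
Qed.

Lemma global_dimE : global_dim fC a = (N + q rho ^+ 2)%:C.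
Proof.
rewrite -FPdim_catC rmorph_sum; apply: eq_bigr => i _.
by case: a_spherical => _ ->; rewrite a_canonical -rmorphM /= expr2.
Qed.

(** * Twists and double braidings on [D] *)

Variables (theta : forall X : C, mor X X) (theta_twist : is_twist a theta).

Let theta_nat := twist_nat a_pivotal theta_twist.
Let theta_bal := balancing a_pivotal theta_twist.
Local Notation th X := (endo_scalar (theta X)).
Local Notation b2 X Y := (braid Y X \o braid X Y).

Lemma thetaE X : simple X -> theta X = th X *: idm X.
Proof. exact: (endo_scalarE abC). Qed.

(** By [piv_twist] a zero twist would make the dimension of [X] vanish. *)
Lemma th_neq0 X : simple X -> th X != 0.
Proof.
move=> sX; apply: contraTneq (q_simple_gt0 sX) => th0.
suff -> : q X = 0 by rewrite ltxx.
apply: (@complexI R); rewrite -a_canonical qdimE /tr (piv_twist theta_twist).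
have -> : theta X = 0 by rewrite (thetaE sX) th0 scale0r.
rewrite -[0 : mor X X](scale0r (idm X)) tensmZl scale0r !(comp0r, comp0l).
exact: linear0.
Qed.

Lemma theta_scalar n (c : 'I_n -> option 'I_(rank fD)) X t :
  direct_sum (fun k => simples (c k)) X ->
  (forall k, th (simples (c k)) = t) -> theta X = t *: idm X.
Proof.
move=> [i [p [_ _ ip]]] tk; rewrite -[LHS]comp_idr -ip comp_sumr scaler_sumr.
apply: eq_bigr => k _; rewrite comp_assoc theta_nat (thetaE (simples_simple _)).
by rewrite tk compZr comp_idr compZl.
Qed.

Lemma theta_tens X Y : simple X -> simple Y ->
  theta (X ⊗ Y) = (th X * th Y) *: b2 X Y.
Proof.
move=> sX sY; rewrite theta_bal.
have h (f : mor X X) (g : mor Y Y) x y : f = x *: idm X -> g = y *: idm Y ->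
    b2 X Y \o (f ⊠ g) = (x * y) *: b2 X Y.
  by move=> -> ->; rewrite tensmZl tensmZr tensm_id !compZr comp_idr scalerA.
exact: h (thetaE sX) (thetaE sY).
Qed.

Lemma double_braid_rho X : D X -> simple X -> b2 X rho = (th X)^-1 *: idm _.
Proof.
move=> DX sX; have [m [dm _]] := decompose_tens_rho DX.
have := theta_scalar (c := fun=> None) dm (fun=> erefl).
rewrite theta_tens // mulrC -scalerA => /(scalerI (th_neq0 rho_simple)) <-.
by rewrite scalerA mulVf ?scale1r // th_neq0.
Qed.

(** By [double_braid_tens], the double braiding of [irrD i ⊗ irrD j] with [rho] is the product of
    the inverse twists; naturality along the inclusion of a summand equates it with the inverse
    twist of that summand. *)
Lemma th_summand i j n (c : 'I_n -> option 'I_(rank fD)) k :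
  direct_sum (fun k => simples (c k)) (irrD i ⊗ irrD j) ->
  th (simples (c k)) = th (irrD i) * th (irrD j).
Proof.
move=> dX; have [u [p [pu _ _]]] := dX.
have [l cl] := decompose_in dX (closed_tens hD (irrD_in i) (irrD_in j)) k.
rewrite cl; move: (u k) (p k) (pu k); rewrite cl /= => {}u {}p {}pu.
have e : b2 (irrD i ⊗ irrD j) rho = ((th (irrD i))^-1 * (th (irrD j))^-1) *: idm
  _.
  rewrite double_braid_tens (double_braid_rho (irrD_in i) (irrD_simple i)).
  rewrite tensmZl tensm_id compZl comp_idl !compZr.
  rewrite (reassoc (assoc_associ _ _ _)) comp_idl.
  rewrite (reassoc (esym (tensm_compr _ _ _)))
    (double_braid_rho (irrD_in j) (irrD_simple j)).
  rewrite tensmZr tensm_id compZl comp_idl compZr associ_assoc scalerA.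
  by [].
have := double_braid_nat u (idm rho); rewrite comp_assoc e.
rewrite (double_braid_rho (irrD_in l) (irrD_simple l)) compZl comp_idl compZr
  comp_idr.
move/(congr1 (comp (p ▷ rho))); rewrite !compZr -tensm_compl pu tensm_id
  => /eqP.
rewrite -subr_eq0 -scalerBl scaler_eq0 subr_eq0
  => /orP[/eqP h|/eqP /q_idm0 /eqP].
  by apply: invr_inj; rewrite invfM -h.
by rewrite q_tens mulf_eq0 !gt_eqF // q_simple_gt0 //; apply: irrD_simple.
Qed.

Lemma double_braid_irrD i j : b2 (irrD i) (irrD j) = idm _.
Proof.
have [n [c dX]] := decompose (irrD i ⊗ irrD j).
have := theta_scalar dX (fun k => th_summand k dX).
rewrite theta_tens ?[in simple _]/=; try exact: irrD_simple.
by apply: scalerI; rewrite mulf_neq0 // th_neq0 //; apply: irrD_simple.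
Qed.

Lemma D_symmetric X Y : D X -> D Y -> b2 X Y = idm _.
Proof.
move=> DX DY; have [n [c dX]] := decompose X; have [m [e dY]] := decompose Y.
apply: (double_braid_sum dX dY) => k l.
have [i ->] := decompose_in dX DX k; have [j ->] := decompose_in dY DY l.
exact: double_braid_irrD.
Qed.

(** Closing a strand with the braiding gives a number independent of the chosen dual, which differs
    from the dimension by the twist. A dual taken in [D] can thus be used. *)
Lemma qdim_left_dual X Y (e : mor (Y ⊗ X) one) (f : mor one (X ⊗ Y)) c :
  simple X -> is_left_dual e f -> e \o (braid X Y \o f) = c *: idm one ->
  (q X)%:C = th X * c.
Proof.
move=> sX dXY efc; have eE : ev d X \o (mate d e ▷ X) = e by exact: mateK.
have fE : (X ◁ mate d e) \o f = coev d X.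
  by apply: (copair_unique (dualP d X)) => Z; rewrite eE (zigzag1 _ dXY).
have h : ev d X \o (braid X X^* \o coev d X) = c *: idm one.
  by rewrite -fE (comp_assoc (braid _ _)) braid_nat -efc -comp_assoc comp_assoc
    eE.
have {h} h : tr a (idm X) = endo_scalar ((th X * c) *: idm (one : C)).
  rewrite /tr tensm_id comp_idl (piv_twist theta_twist).
  have -> : theta X ▷ X^* = th X *: idm _ by rewrite {1}(thetaE sX) tensmZl
    tensm_id.
  by rewrite !compZr comp_idr compZl -comp_assoc h scalerA.
by rewrite -a_canonical qdimE h endo_scalarZ.
Qed.

Lemma th_pos i : tannakian (sub_brcat (symmetric_center_closed (sub_brcat hD)))
  ->
  exists r : R, 0 < r /\ th (irrD i) = r%:C.
Proof.
move=> [gT [G [F _]]]; set E := sub_brcat _ in F.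
have symD (X : sub_brcat hD) : symmetric_center X.
  by move=> Y _; apply: D_symmetric; apply: svalP.
have [[Y [e [f dXY]]] _] := fusion_rigid fD (irr fD i).
(* The equivalence starts from the symmetric center of [D], which is all of [D] by [symD]. *)
pose XE : E := exist _ (irr fD i) (symD (irr fD i)).
pose YE : E := exist _ Y (symD Y).
have [c efc] : exists c, (e : mor (sval Y ⊗ irrD i) one)
    \o (braid (irrD i) (sval Y) \o (f : mor one (irrD i ⊗ sval Y))) = c *: idm
      one.
  exact: one_scalar.
have cn := @tannakian_trace _ _ _ E F XE YE e f c dXY efc.
have qc := qdim_left_dual (irrD_simple i) (dXY : @is_left_dual _ C _ _ e f) efc.
have q_gt0 := q_simple_gt0 (irrD_simple i).
rewrite cn in qc; set n := rep_dim _ in qc.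
have n_gt0 : (0 < n)%N.
  rewrite lt0n; apply/eqP => n0; move: qc; rewrite n0 mulr0 => /complexI q0.
  by rewrite q0 ltxx in q_gt0.
have n_neq0 : n%:R != 0 :> R by rewrite pnatr_eq0 -lt0n.
exists (q (irrD i) / n%:R); split; first by rewrite divr_gt0 // ltr0n.
apply: (mulIf (_ : n%:R != 0)); first by rewrite pnatr_eq0 -lt0n.
by rewrite -qc -(rmorph_nat (real_complex R)) -rmorphM /= divfK.
Qed.

Hypothesis D_tannakian : tannakian (sub_brcat
  (symmetric_center_closed (sub_brcat hD))).

Lemma th_in i : th (irrD i) = 1.
Proof.
have /fin_all_exists[r rP] j : exists r : R, 0 < r /\ th (irrD j) = r%:C.
  exact: th_pos.
(* The positive numbers [r] form a finite set closed under squaring, so its maximum is at most 1 and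
   its minimum at least 1. *)
have sq j : exists l, r l = r j ^+ 2.
  have [n [c dX]] := decompose (irrD j ⊗ irrD j).
  case: n c dX => [|n] c dX.
    have /eqP := q_idm0 (direct_sum_idm0 dX).
    by rewrite q_tens mulf_eq0 !gt_eqF // q_simple_gt0 //; apply: irrD_simple.
  have [l cl] := decompose_in dX (closed_tens hD (irrD_in j) (irrD_in j)) ord0.
  exists l; apply: (@complexI R); have := th_summand ord0 dX.
  by rewrite cl /= !(rP _).2 -rmorphM /= expr2.
have le1 j : r j <= 1.
  case: (@arg_maxP _ _ _ i predT r) => // k _ kmax.
  apply: le_trans (kmax j isT) _; have [l lk] := sq k.
  have := kmax l isT; rewrite /= lk expr2 -[leRHS]mul1r ler_pM2r //.
  by case: (rP k).
have ge1 j : 1 <= r j.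
  case: (@arg_minP _ _ _ i predT r) => // k _ kmin.
  apply: le_trans (kmin j isT); have [l lk] := sq k.
  have := kmin l isT; rewrite /= lk expr2 -[leLHS]mul1r ler_pM2r //.
  by case: (rP k).
by rewrite (rP i).2; congr (_%:C); apply/le_anti; rewrite le1 ge1.
Qed.

Lemma D_transparent X Y : D X -> b2 X Y = idm _.
Proof.
move=> DX; have [n [c dX]] := decompose X; have [m [e dY]] := decompose Y.
apply: (double_braid_sum dX dY) => k l.
have [i ->] := decompose_in dX DX k; case: (e l) => [j|]; first exact:
  double_braid_irrD.
by rewrite /= double_braid_rho ?th_in ?invr1 ?scale1r //;
  [apply: irrD_in | apply: irrD_simple].
Qed.

Hypothesis C_not_symmetric : ~ symmetrically_braided C.

Lemma rho_not_transparent : b2 rho rho <> idm _.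
Proof.
move=> r1; apply: C_not_symmetric => X Y _.
have [n [c dX]] := decompose X; have [m [e dY]] := decompose Y.
apply: (double_braid_sum dX dY) => k l.
case: (c k) => [i|]; first by apply: D_transparent; apply: irrD_in.
case: (e l) => [j|//].
by apply/double_braid_sym/D_transparent/irrD_in.
Qed.

Lemma symmetric_centerE X : symmetric_center X <-> D X.
Proof.
split=> [cX|DX Y _]; last exact: D_transparent.
have [n [c dX]] := decompose X; apply: (subcategory_sum hD dX) => k.
case ck: (c k) => [i|]; first exact: irrD_in.
case: rho_not_transparent; have [j [p [pj _ _]]] := dX.
move: (j k) (p k) (pj k); rewrite ck /= => {}j {}p {}pj.
have := double_braid_nat j (idm rho); rewrite comp_assoc (cX rho) // comp_idl.
move/(congr1 (comp (p ▷ rho))).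
by rewrite !comp_assoc -tensm_compl pj tensm_id comp_idl.
Qed.

(** * The twist of [rho] *)

Local Notation t := (th rho).

Lemma th_simples s : th (simples s) = if s is None then t else 1.
Proof. by case: s => //= i; apply: th_in. Qed.

Lemma theta_rho2 : theta (rho ⊗ rho) = t ^+ 2 *: b2 rho rho.
Proof. exact: theta_tens. Qed.

(** Each simple summand of [rho ⊗ rho] is [rho], with twist [t], or lies in [D], with twist 1. *)
Lemma theta_rho2_quadratic :
  (theta (rho ⊗ rho) - idm _) \o (theta (rho ⊗ rho) - t *: idm _) = 0.
Proof.
have [n [c [i [p [_ _ ip]]]]] := decompose (rho ⊗ rho).
rewrite -[LHS]comp_idr -[X in _ \o X]ip comp_sumr big1 // => k _.
have e : theta (rho ⊗ rho) \o i k = th (simples (c k)) *: i k.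
  by rewrite theta_nat (thetaE (simples_simple _)) compZr comp_idr
    (endo_scalarZ _ (idm_simple (simples_simple _))).
have e1 : (theta (rho ⊗ rho) - idm _) \o i k = (th (simples (c k)) - 1) *: i k.
  by rewrite compBl e comp_idl scalerBl scale1r.
have e2 : (theta (rho ⊗ rho) - t *: idm _) \o i k =
  (th (simples (c k)) - t) *: i k.
  by rewrite compBl e compZl comp_idl scalerBl.
rewrite comp_assoc -(comp_assoc (_ - idm _)) e2 compZr e1 scalerA.
have -> : (th (simples (c k)) - t) * (th (simples (c k)) - 1) = 0.
  by rewrite th_simples; case: (c k) => [l|]; rewrite subrr ?mulr0 ?mul0r.
by rewrite scale0r comp0l.
Qed.

Lemma tr_theta_rho2 : tr a (theta (rho ⊗ rho)) = N%:C + (kappa%:R * q rho)%:C *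
  t.
Proof.
have [n [c dr]] := decompose (rho ⊗ rho); have [i [p [pi _ ip]]] := dr.
rewrite (tr_direct_sum a_pivotal _ ip).
rewrite (eq_bigr (fun k => th (simples (c k)) * (q (simples (c k)))%:C)); last
  first.
  move=> k _; rewrite theta_nat (thetaE (simples_simple _)) compZr comp_idr
    compZr pi trZ.
  by rewrite -qdimE a_canonical (endo_scalarZ _
    (idm_simple (simples_simple _))).
rewrite (sum_decompose (fun s => th (simples s) * (q (simples s))%:C) dr)
  sum_option /=.
rewrite addrC FPdim_catD rmorph_sum /=; congr (_ + _).
  apply: eq_bigr => l _; rewrite th_in mul1r -mulr_natr
    -(rmorph_nat (real_complex R)).
  by rewrite -rmorphM /= -mult_rho2 expr2.
by rewrite rmorphM /= rmorph_nat -[LHS]mulr_natl -mulrA (mulrC t).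
Qed.

Lemma twist_rho_root_of_unity : exists2 n, (0 < n)%N & t ^+ n = 1.
Proof.
have h0 : (0 < \dim {: mor rho (rho ⊗ (rho ⊗ rho))})%N.
  rewrite (dim_left_dual _ _ (dualP d rho)).
  rewrite (dim_isol _ (isomorphic_tens rho_self_dual (isomorphic_refl rho))).
  rewrite lt0n dimv_eq0; apply: contraTneq
    (mulr_gt0 (q_simple_gt0 rho_simple) (q_simple_gt0 rho_simple)) => f0.
  have : idm (rho ⊗ rho) = 0 by apply/eqP; rewrite -memv0 -f0 memvf.
  by move/q_idm0; rewrite q_tens => ->; rewrite ltxx.
apply: (twist_root_of_unity theta_nat theta_bal (th_neq0 rho_simple)
  (thetaE rho_simple)
  theta_rho2_quadratic (h0 := vpick {: mor rho (rho ⊗ (rho ⊗ rho))})).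
by rewrite vpick0 -dimv_eq0 -lt0n.
Qed.

(** By [loop_tens], a loop labelled [rho ⊗ rho] has value [s ^+ 2]. Decomposing its label, each
    transparent summand contributes its dimension and each [rho] contributes [s]. *)
Lemma rho_loop : exists s : R[i],
  [/\ t ^+ 2 * (s * (q rho)%:C) = N%:C + (kappa%:R * q rho)%:C * t
    & s ^+ 2 = N%:C + kappa%:R * s].
Proof.
have [s sE] : exists s, loop a rho (idm rho) = s *: idm rho.
  exact: (schur_scalar abC _ rho_simple).
exists s; split.
  have sE' : ptr a (b2 rho rho) = s *: idm rho.
    by rewrite -sE /loop tensm_id comp_idl.
  have := tr_theta_rho2; rewrite theta_rho2 trZ => <-; congr (_ * _).
  by rewrite (tr_tens a_pivotal one_neq0 one_scalar) sE' trZ -qdimE a_canonical.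
have [n [c dr]] := decompose (rho ⊗ rho).
have := loop_tens a_pivotal rho sE; rewrite sE scalerA -expr2.
rewrite (loop_direct_sum a_pivotal _ dr).
pose f x : R[i] := if x is Some i then (q (irrD i))%:C else s.
rewrite (eq_bigr (fun k => f (c k) *: idm rho)) => [|k _]; last first.
  case: (c k) => [i|//]; rewrite (loop_transparent a one_neq0 one_scalar)
    ?a_canonical //.
  by apply/double_braid_sym/D_transparent/irrD_in.
rewrite -scaler_suml => /eqP; rewrite -subr_eq0 -scalerBl scaler_eq0
  (negPf (idm_simple rho_simple)).
rewrite orbF subr_eq0 => /eqP <-; rewrite (sum_decompose f dr) sum_option addrC
  mulr_natl.
congr (_ + _); rewrite FPdim_catD rmorph_sum; apply: eq_bigr => i _ /=.
by rewrite -mulr_natr -(rmorph_nat (real_complex R)) -mult_rho2 -rmorphM /=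
  expr2.
Qed.

Lemma theta_rho2_id : kappa = 0%N \/ t = 1 -> theta (rho ⊗ rho) = idm _.
Proof.
move=> h; have [n [c dr]] := decompose (rho ⊗ rho).
rewrite (theta_scalar (t := 1) dr) ?scale1r // => k; rewrite th_simples.
case ck: (c k) => [//|]; case: h => // /eqP.
by rewrite (dim_hom_simples None dr) (bigD1 k) //= ck eqxx.
Qed.

(* c = c_{rho,rho} satisfies c^2 = -1 and has trace t d with t^2 = -1, so the
   idempotent (1 + t c) / 2 has trace (d^2 - d) / 2, which is the dimension of
   an object of D. *)
Lemma q_rho_int0 : kappa = 0%N -> t ^+ 2 = -1 -> q rho \is a Num.int.
Proof.
move=> k0 t2; pose c := braid rho rho.
have cc : c \o c = - idm (rho ⊗ rho).
  have := theta_rho2; rewrite theta_rho2_id; last by left.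
  by rewrite t2 scaleN1r => ->; rewrite opprK.
pose u := t *: c; have uu : u \o u = idm _.
  by rewrite /u compZl compZr cc scalerA -expr2 t2 scaleN1r opprK.
pose e := 2^-1 *: (idm (rho ⊗ rho) + u).
have ee : e \o e = e.
  rewrite /e compZl compZr compDl !compDr !comp_idl !comp_idr uu.
  rewrite [u + _]addrC -mulr2n -[(_ + u) *+ 2]scaler_nat !scalerA.
  by congr (_ *: _); field.
have [W [i [p [pi ip]]]] := split_idempotent abC ee.
have trt : tr a (theta rho) = t * (q rho)%:C.
  by rewrite {1}(thetaE rho_simple) trZ -qdimE a_canonical.
have qW : 2 * q W = q rho ^+ 2 - q rho.
  apply: (@complexI R); rewrite rmorphM rmorphB /= -a_canonical qdimE -pi.
  rewrite (tr_comp a_pivotal) ip /e trZ trD /u trZ.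
  rewrite (tr_tens a_pivotal one_neq0 one_scalar c) (ptr_braid theta_twist) trt.
  rewrite -qdimE a_canonical q_tens (mulrA t) -(expr2 t) t2 mulN1r -expr2.
  by rewrite mulrA (rmorph_nat (real_complex R)) divff ?pnatr_eq0 // mul1r.
have [n [cW dW]] := decompose W.
(* [W] embeds in [rho ⊗ rho], which contains no [rho] since [kappa] is 0. *)
have W_rho : \dim {: mor rho W} = 0%N.
  apply/eqP; rewrite dimv_eq0 -subv0; apply/subvP => f _; rewrite memv0.
  have /eqP : i \o f = 0.
    apply/eqP; rewrite -memv0; move/eqP: k0; rewrite dimv_eq0 => /eqP <-; apply:
      memvf.
  by move/eqP/(congr1 (comp p)); rewrite comp_assoc pi comp_idl comp0r => ->.
have qWn : q W \is a Num.int.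
  rewrite (q_sum dW); apply: rpred_sum => k _; case ck: (cW k) => [l|].
    by rewrite mult_rho2 rpred_nat.
  by move/eqP: W_rho; rewrite (dim_hom_simples None dW) (bigD1 k) //= ck eqxx.
have -> : q rho = q rho ^+ 2 - 2 * q W by rewrite qW; ring.
have [m _ Nm] := FPdim_catD_nat.
by rewrite q_rho_sq k0 mul0r addr0 Nm rpredB ?rpredM ?rpred_nat.
Qed.

Hypothesis FPdimC_int : FPdim_cat R fC \is a Num.int.

Lemma near_integral_braided :
  [/\ forall X : C, symmetric_center X <-> D X,
      [\/ [/\ t = zeta R 4 \/ t = - zeta R 4,
              kappa = 0%N & global_dim fC a = (2 * N)%:C],
          [/\ t = zeta R 3 \/ t = (zeta R 3)^-1,
              N = 2 * kappa%:R ^+ 2,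
              global_dim fC a = (3 * N)%:C
              & global_dim fC a = (6 * kappa%:R ^+ 2)%:C] |
          [/\ t = -1,
              N = 3 / 4 * kappa%:R ^+ 2,
              global_dim fC a = (4 * N)%:C
              & global_dim fC a = (3 * kappa%:R ^+ 2)%:C]] &
      q rho \is a Num.int].
Proof.
have [m m_gt0 Nm] := FPdim_catD_nat.
have q_gt0 := q_simple_gt0 rho_simple; have q_neq0 : q rho != 0 by rewrite
  gt_eqF.
have N_neq0 : N != 0 by rewrite Nm pnatr_eq0 -lt0n.
have [n n_gt0 tn] := twist_rho_root_of_unity.
(* The total dimension is [2 N + kappa d], so its integrality makes [kappa d] a natural number. *)
have [l kq] : exists l : nat, kappa%:R * q rho = l%:R.
  apply/natrP; rewrite natrEint mulr_ge0 ?ler0n ?q_ge0 // andbT.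
  have -> : kappa%:R * q rho = FPdim_cat R fC - 2 * N by rewrite FPdim_catC
    q_rho_sq; ring.
  by rewrite rpredB // Nm rpredM ?rpred_nat.
have eq_t : m%:R * t ^+ 2 + l%:R * t + m%:R = 0.
  have [s [ts ss]] := rho_loop.
  have qC : (q rho)%:C ^+ 2 = N%:C + kappa%:R * (q rho)%:C.
    by rewrite -rmorphXn /= q_rho_sq rmorphD rmorphM /= rmorph_nat.
  (* The quadratic equation for [s] has the roots [d] and [-N/d]; this is its factorization,
     multiplied by [d]. *)
  have : (s - (q rho)%:C) * (s * (q rho)%:C + N%:C) = 0.
    have -> : (s - (q rho)%:C) * (s * (q rho)%:C + N%:C)
      = s ^+ 2 * (q rho)%:C - s * (q rho)%:C ^+ 2 + s * N%:C - (q rho)%:C * N%:C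
        by ring.
    by rewrite ss qC; ring.
  have not_id : theta (rho ⊗ rho) = idm _ -> t ^+ 2 = 1 -> False.
    move=> th1 t2; apply: rho_not_transparent; have := theta_rho2.
    by rewrite th1 t2 scale1r => <-.
  move/eqP; rewrite mulf_eq0 subr_eq0 addr_eq0 => /orP[/eqP sd|/eqP sd]; last
    first.
    rewrite sd Nm kq !rmorph_nat in ts.
    have -> : m%:R * t ^+ 2 + l%:R * t + m%:R
      = (m%:R + l%:R * t) - t ^+ 2 * - m%:R by ring.
    by rewrite ts subrr.
  rewrite sd rmorphM rmorph_nat /= in ts.
  (* The branch [s = d]: either factor will make [rho] transparent. *)
  have : (t - 1) * ((q rho)%:C ^+ 2 * t + N%:C) = 0.
    have -> : (t - 1) * ((q rho)%:C ^+ 2 * t + N%:C) = t ^+ 2 *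
      ((q rho)%:C * (q rho)%:C)
      - (q rho)%:C ^+ 2 * t + t * N%:C - N%:C by ring.
    by rewrite ts qC; ring.
  move/eqP; rewrite mulf_eq0 subr_eq0 addr_eq0 => /orP[/eqP t1|/eqP tN].
    by case: not_id; rewrite ?t1 ?expr1n //; apply: theta_rho2_id; right.
  have t_norm : `|t| = 1.
    by apply: (pexpIrn n_gt0); rewrite ?nnegrE ?normr_ge0 ?ler01 // -normrX tn
      normr1 expr1n.
  have qN : (q rho)%:C ^+ 2 = N%:C.
    move/(congr1 Num.norm): tN; rewrite normrM t_norm mulr1 normrN.
    by rewrite !ger0_norm // ?exprn_ge0 // ler0c ?q_ge0 // Nm ler0n.
  have k0 : kappa = 0%N.
    move/eqP: qC; rewrite qN -subr_eq0 opprD addrA subrr sub0r oppr_eq0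
      mulf_eq0.
    case/orP=> [|/eqP/complexI/eqP]; last by rewrite (negPf q_neq0).
    by rewrite pnatr_eq0 => /eqP.
  case: not_id; first by apply: theta_rho2_id; left.
  move: tN; rewrite qN -[RHS]mulrN1 => /mulfI ->; first by rewrite sqrrN expr1n.
  by rewrite Nm rmorph_nat pnatr_eq0 -lt0n.
have qN : q rho ^+ 2 = N + l%:R by rewrite q_rho_sq kq.
have [c c_le [lE tE]] := unity_trace_cases n_gt0 m_gt0 tn eq_t.
have lN : l%:R = c%:R * N by rewrite Nm -natrM lE.
(* Square [kappa d = c N] and use [d^2 = (1 + c) N]. *)
have k2 : kappa%:R ^+ 2 * (1 + c%:R) = c%:R ^+ 2 * N.
  apply: (mulIf N_neq0); rewrite -mulrA mulrDl mul1r -lN -qN -exprMn kq lN;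
    ring.
split; first exact: symmetric_centerE.
- rewrite global_dimE qN lN.
  case: c c_le lE tE lN k2 => [|[|[|]]] // _ lE tE lN k2.
  + apply: Or31; split.
    * by apply: root_zeta4; rewrite mul0r addr0 in tE.
    * apply/eqP; move/eqP: k2; rewrite addr0 mulr1 expr0n mul0r expf_eq0 /=.
      by rewrite pnatr_eq0.
    * by congr (_%:C); ring.
  + have NE : N = 2 * kappa%:R ^+ 2 by move: k2; rewrite expr1n mul1r mulrC
    => <-; ring.
    apply: Or32; split=> //.
    * by apply: root_zeta3; rewrite mul1r in tE.
    * by congr (_%:C); ring.
    * by congr (_%:C); rewrite NE; ring.
  + have NE : N = 3 / 4 * kappa%:R ^+ 2.
      by apply: (mulfI (_ : 4 != 0 :> R));
        [rewrite pnatr_eq0|move: k2 => /=; lra].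
    apply: Or33; split=> //.
    * have /eqP : (t + 1) ^+ 2 = 0 by rewrite -tE; ring.
      by rewrite expf_eq0 /= addr_eq0 => /eqP.
    * by congr (_%:C); ring.
    * by congr (_%:C); rewrite NE; field.
case: c c_le lE tE lN k2 => [|[|[|]]] // _ lE tE lN k2.
- apply: q_rho_int0.
    apply/eqP; move/eqP: k2; rewrite addr0 mulr1 expr0n mul0r expf_eq0 /=.
    by rewrite pnatr_eq0.
  by apply/eqP; rewrite -addr_eq0 -tE mul0r addr0.
- have k_neq0 : kappa%:R != 0 :> R.
    by apply: contraNneq N_neq0 => k0; move: k2; rewrite k0 expr0n mul0r expr1n
      mul1r => <-.
  have -> : q rho = 2 * kappa%:R.
    by apply: (mulfI k_neq0); rewrite kq lN mul1r; move: k2; rewrite expr1n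
      mul1r => <-; ring.
  by rewrite rpredM ?rpred_nat.
have k_neq0 : kappa%:R != 0 :> R.
  apply: contraNneq N_neq0 => k0; move: k2; rewrite k0 expr0n mul0r => /esym e.
  by move/eqP: e; rewrite mulf_eq0 expf_eq0 pnatr_eq0.
(* [3 kappa^2 = 4 N] makes [kappa] even, which turns [d = 3 kappa / 2] into an integer. *)
have [j kj] : exists j, kappa = (j * 2)%N.
  have k4 : (kappa ^ 2 * 3 = 4 * m)%N.
    by apply/eqP; rewrite -(eqr_nat R) natrM natrX natrM -Nm; apply/eqP; move:
      k2; lra.
  apply/dvdnP; have : (2 %| kappa ^ 2 * 3)%N by rewrite k4 dvdn_mulr.
  by rewrite Gauss_dvdl // Euclid_dvdX // => /andP[].
have -> : q rho = 3 * j%:R.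
  apply: (mulfI k_neq0); rewrite kq lN; move: k2; rewrite kj natrM => k2.
  have -> : N = 3 * j%:R ^+ 2 by lra.
  by ring.
by rewrite rpredM ?rpred_nat.
Qed.

End NearIntegral.

Theorem proposition4p11 (R : realType)
    (C : brcat R[i]) (fC : fusion C)
    (* D and rho exhibit C as a near-integral fusion category *)
    (D : C -> Prop) (hD : fusion_subcategory D) (fD : fusion (sub_moncat hD))
    (rankD : (rank fD + 1)%N = rank fC)
    (rho : C) (rho_simple : simple rho) (rho_notin : ~ D rho)
    (C_not_symmetric : ~ symmetrically_braided C)
    (FPdimC_int : FPdim_cat R fC \is a Num.int)
    (* the canonical spherical structure a, and its twist theta *)
    (d : left_duality C) (a : forall X : C, mor X (ldual d (ldual d X)))
    (a_spherical : spherical a)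
    (a_canonical : forall X : C, qdim a X = (FPdim R fC X)%:C)
    (theta : forall X : C, mor X X) (theta_twist : is_twist a theta)
    (D_tannakian : tannakian (sub_brcat (symmetric_center_closed
                                           (sub_brcat hD)))) :
  let N : R := FPdim_cat R fD in
  let kappa : nat := \dim {: mor rho (rho ⊗ rho)} in
  let d_plus : R := FPdim R fC rho in
  let theta_rho : R[i] := endo_scalar (theta rho) in
  let dimC : R[i] := global_dim fC a in
  [/\ forall X : C, symmetric_center X <-> D X,
      [\/ [/\ theta_rho = zeta R 4 \/ theta_rho = - zeta R 4,
              kappa = 0%N & dimC = (2 * N)%:C],
          [/\ theta_rho = zeta R 3 \/ theta_rho = (zeta R 3)^-1,
              N = 2 * kappa%:R ^+ 2,
              dimC = (3 * N)%:C & dimC = (6 * kappa%:R ^+ 2)%:C] |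
          [/\ theta_rho = -1,
              N = 3 / 4 * kappa%:R ^+ 2,
              dimC = (4 * N)%:C & dimC = (3 * kappa%:R ^+ 2)%:C]] &
      d_plus \is a Num.int].
Proof.
exact: (near_integral_braided rankD rho_simple rho_notin a_spherical
  a_canonical theta_twist D_tannakian C_not_symmetric FPdimC_int).
Qed.
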